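(* Let $\sigma\ge2$ be an integer. The law of the invasion percolation cluster $C$ on $\mathcal{T}_\sigma$ and the law of the incipient infinite cluster $C_\infty$ on $\mathcal{T}_\sigma$ (as probability measures on the space of subgraphs of $\mathcal{T}_\sigma$) are mutually singular.
   Context: $\mathcal{T}_\sigma$ is the infinite rooted tree in which every vertex has exactly $\sigma$ children (the root $o$ has degree $\sigma$, all other vertices have degree $\sigma+1$). The height of a vertex is its graph distance from $o$. Invasion percolation cluster (IPC): assign i.i.d. uniform $(0,1)$ weights to the edges of $\mathcal{T}_\sigma$. Let $I_0=\{o\}$ and, given $I_N$, let $I_{N+1}$ be obtained by adjoining to $I_N$ the edge in its boundary (edges with exactly one endpoint in $I_N$) with smallest weight, together with its other endpoint. Then $C=\bigcup_{N\ge 0} I_N$. Incipient infinite cluster (IIC): let $p_c=1/\sigma$ and let $\mathbb{P}_{p_c}$ be the law of independent bond percolation on $\mathcal{T}_\sigma$ with parameter $p_c$. $C_\infty$ is the random infinite subgraph (cluster of the root) whose law $\mathbb{P}_\infty$ is the limit as $n\to\infty$ of the law of the open cluster of $o$ under $\mathbb{P}_{p_c}$ conditioned on $o$ being connected by open edges to some vertex at height $n$ (limit in the sense of convergence of probabilities of cylinder events). Equivalently, $C_\infty$ consists of a uniformly random infinite self-avoiding path from $o$ (the backbone), with independent critical percolation clusters attached at each backbone vertex in each direction away from the backbone. *)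

(* Defs.v *)
From HB Require Import structures.
From mathcomp Require Import all_boot all_order all_algebra.
From mathcomp Require Import all_classical all_reals all_analysis.
From mathcomp Require Import measurable_realfun.

Set Implicit Arguments.
Unset Strict Implicit.
Unset Printing Implicit Defensive.
Import Order.TTheory GRing.Theory Num.Theory.
Import numFieldNormedType.Exports.
Local Open Scope classical_set_scope.
Local Open Scope ring_scope.

(* A vertex of the tree is the word of the child labels met on the way from the
   root, most recent label first: the root is [::], the children of v are the
   i :: v, and the height of v is size v. The pair (v, i) is the edge joining v
   to its child i :: v, so every inhabitant of edge sigma is an edge. *)
Notation vertex sigma := (seq 'I_sigma).
Notation edge sigma := (vertex sigma * 'I_sigma)%type.

Definition root sigma : vertex sigma := [::].
Definition parent_end sigma (e : edge sigma) : vertex sigma := e.1.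
Definition child_end sigma (e : edge sigma) : vertex sigma := e.2 :: e.1.

Definition cylinder sigma : set (set (edge sigma -> bool)) :=
  [set A | exists s : seq (edge sigma),
     forall c c' : edge sigma -> bool, {in s, c =1 c'} -> A c -> A c'].

(* A subgraph is given by (the indicator function of) its set of edges; the
   root is always understood to be one of its vertices. *)
Notation subgraph sigma := (g_sigma_algebraType (@cylinder sigma)).

Section invasion.
Context {R : realType} {sigma : nat}.
Implicit Types (w : edge sigma -> R) (E : seq (edge sigma)).

(* Vertices of the subgraph with edges E, including the root. *)
Definition vertices E : seq (vertex sigma) :=
  root sigma :: map (@parent_end sigma) E ++ map (@child_end sigma) E.

Definition boundary E (e : edge sigma) : bool :=
  (parent_end e \in vertices E) (+) (child_end e \in vertices E).

Definition smallest w E : set (edge sigma) :=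
  [set e | boundary E e /\ forall f, boundary E f -> w e <= w f].

(* Ties, a null event for i.i.d. uniform weights, are broken by choice. The
   boundary of a finite E is finite, and nonempty when 0 < sigma, so that the
   default None is never selected. *)
Definition invade w E : seq (edge sigma) :=
  if xget None (Some @` smallest w E) is Some e then e :: E else E.

Definition invasion w (N : nat) : seq (edge sigma) := iter N (invade w) [::].

Definition ipc w : subgraph sigma := fun e => `[< exists N, e \in invasion w N >].

End invasion.

Section percolation.
Context {sigma : nat}.
Implicit Types (c : subgraph sigma) (u v : vertex sigma).

Definition open_adj c : rel (vertex sigma) := fun u v =>
  [exists i, ((v == i :: u) && c (u, i)) || ((u == i :: v) && c (v, i))].

Definition connected_to c u v : Prop :=
  exists p : seq (vertex sigma), path (open_adj c) u p /\ last u p = v.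

Definition open_cluster c : subgraph sigma :=
  fun e => c e && `[< connected_to c (root sigma) (parent_end e) >].

Definition reaches_height (n : nat) : set (subgraph sigma) :=
  [set c | exists v, size v = n /\ connected_to c (root sigma) v].

End percolation.

Section probability_notions.
Context d (T : measurableType d) (R : realType) (P : probability T R).

Definition mutually_independent d' (T' : measurableType d') (I : eqType)
    (X : I -> T -> T') : Prop :=
  forall (s : seq I) (B : I -> set T'), uniq s -> (forall i, measurable (B i)) ->
    P (\bigcap_(i in [set` s]) (X i @^-1` B i)) =
    (\prod_(i <- s) P (X i @^-1` B i))%E.

Definition uniform01 (X : {RV P >-> R}) : Prop :=
  forall B : set R, measurable B ->
    distribution P X B = uniform_prob (@ltr01 R) B.

Definition iid_uniform01 (I : eqType) (U : I -> {RV P >-> R}) : Prop :=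
  (forall i, uniform01 (U i)) /\ mutually_independent (fun i => U i : T -> R).

Definition cond_probability (A B : set T) : R := fine (P (A `&` B)) / fine (P B).

Definition mutually_singular (nu : probability T R) : Prop :=
  exists A : set T, [/\ measurable A, P A = 0%E & nu (~` A) = 0%E].

End probability_notions.

Definition is_bond_percolation sigma (R : realType) (p : R)
    (P : probability (subgraph sigma) R) : Prop :=
  (forall e : edge sigma, P [set c : subgraph sigma | c e] = p%:E) /\
  mutually_independent P (fun (e : edge sigma) (c : subgraph sigma) => c e).

(* Pinf is the law of the incipient infinite cluster, where Ppc is critical
   bond percolation. *)
Definition is_iic_law sigma (R : realType)
    (Ppc Pinf : probability (subgraph sigma) R) : Prop :=
  forall A : set (subgraph sigma), cylinder A ->
    cond_probability Ppc (open_cluster @^-1` A) (reaches_height n) @[n --> \oo]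
      --> fine (Pinf A).

Section ipc_measurable.
Context d (T : measurableType d) (R : realType) (P : probability T R).
Context (sigma : nat) (U : edge sigma -> {RV P >-> R}).

Definition random_ipc (t : T) : subgraph sigma := ipc (fun e => U e t).

Let dmeas (K : Type) (f : T -> K) := forall B : set K, measurable (f @^-1` B).

Let bigcupK (K : countType) (D : set K) (F : K -> set T) :
  (forall k, measurable (F k)) -> measurable (\bigcup_(k in D) F k).
Proof.
move=> mF; rewrite bigcup_mkcond; apply: countable_bigcupT_measurable => //.
by move=> k; case: ifP.
Qed.

Let dmeas1 (K : countType) (f : T -> K) :
  (forall k, measurable (f @^-1` [set k])) -> dmeas f.
Proof.
move=> mf B.
have -> : f @^-1` B = \bigcup_(k in B) (f @^-1` [set k]).
  by apply/seteqP; split=> [t Bt|t [k Bk /= ->]//]; exists (f t).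
exact: bigcupK.
Qed.

Let dmeas_cst (K : Type) (k : K) : dmeas (fun=> k).
Proof.
move=> B; have [Bk|nBk] := pselect (B k).
  by rewrite (_ : _ @^-1` B = setT)//; apply/seteqP; split.
by rewrite (_ : _ @^-1` B = set0)//; apply/seteqP; split.
Qed.

Let dmeas_map (K : Type) (p : K -> T -> bool) (s : seq K) :
  (forall e, measurable [set t | p e t]) ->
  dmeas (fun t => [seq p e t | e <- s]).
Proof.
move=> mp; elim: s => [|e s IH] B /=.
  exact: dmeas_cst.
have mN : measurable [set t | ~~ p e t].
  rewrite (_ : [set _ | _] = ~` [set t | p e t]); first exact: measurableC.
  by apply/seteqP; split=> t /= /negP.
have -> : (fun t => p e t :: [seq p e t | e <- s]) @^-1` B =
  ([set t | p e t] `&` (fun t => [seq p e t | e <- s]) @^-1` [set l | B (true :: l)])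
  `|` ([set t | ~~ p e t] `&`
       (fun t => [seq p e t | e <- s]) @^-1` [set l | B (false :: l)]).
  apply/seteqP; split=> t /=; case: (p e t); first by left.
  - by right.
  - by case=> -[].
  - by case=> -[].
by apply: measurableU; apply: measurableI => //; exact: IH.
Qed.

Let boundary_finite (E : seq (edge sigma)) :
  exists L : seq (edge sigma), forall e, boundary E e -> e \in L.
Proof.
exists ([seq (v, i) | v <- vertices E, i <- enum 'I_sigma] ++
        flatten [seq (if v is i :: u then [:: (u, i)] else [::]) | v <- vertices E]).
case=> u i be; rewrite mem_cat; case: (boolP (u \in vertices E)) => uE.
  apply/orP; left; apply: allpairs_f => //; exact: mem_enum.
apply/orP; right; apply/flattenP; exists [:: (u, i)]; last by rewrite inE.
move: be; rewrite /boundary /parent_end /= (negbTE uE) /= => ciE.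
by apply/mapP; exists (child_end (u, i)).
Qed.

Let measurable_le (e f : edge sigma) : measurable [set t | U e t <= U f t].
Proof.
have : measurable_fun setT (fun t => U e t <= U f t).
  by apply: measurable_fun_ler; exact: measurable_funPT.
by move=> /(_ measurableT [set true] Logic.I); rewrite setTI.
Qed.

Let dmeas_invade E : dmeas (fun t => invade (fun e => U e t) E).
Proof.
have [L HL] := boundary_finite E.
pose p e t := `[< smallest (fun e => U e t) E e >].
have mp e : measurable [set t | p e t].
  have [be|nbe] := boolP (boundary E e); last first.
    rewrite (_ : [set t | p e t] = set0)//; apply/seteqP; split=> // t.
    by move=> /asboolP[be]; rewrite be in nbe.
  have -> : [set t | p e t] =
      ~` \bigcup_(f in [set f | boundary E f]) ~` [set t | U e t <= U f t].
    rewrite setC_bigcup; apply/seteqP; split=> t.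
      by move=> /asboolP[_ H] f bf; rewrite setCK; exact: H.
    move=> H; apply/asboolP; split=> // f bf.
    by have := H f bf; rewrite setCK.
  by apply: measurableC; apply: bigcupK => f; exact: measurableC.
pose g (l : seq bool) := if xget None (Some @` [set` mask l L]) is Some e
  then e :: E else E.
have -> : (fun t => invade (fun e => U e t) E) =
    g \o (fun t => [seq p e t | e <- L]).
  apply/funext => t; rewrite /g/= /invade -filter_mask.
  suff -> : [set` [seq e <- L | p e t]] = smallest (fun e => U e t) E by [].
  apply/seteqP; split=> e /=; rewrite mem_filter.
    by case/andP=> /asboolP.
  by move=> H; rewrite HL ?andbT; [exact/asboolP|case: H].
by move=> B; rewrite comp_preimage; exact: dmeas_map.
Qed.

Let dmeas_invasion N : dmeas (fun t => invasion (fun e => U e t) N).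
Proof.
elim: N => [|N IH]; first by move=> B; exact: dmeas_cst.
apply: dmeas1 => s.
have -> : (fun t => invasion (fun e => U e t) N.+1) @^-1` [set s] =
  \bigcup_(E in [set: seq (edge sigma)])
   ((fun t => invasion (fun e => U e t) N) @^-1` [set E] `&`
    (fun t => invade (fun e => U e t) E) @^-1` [set s]).
  apply/seteqP; split=> t /=; first by move=> <-; exists (invasion (U ^~ t) N).
  by case=> E _ [<- <-].
by apply: bigcupK => E; apply: measurableI;
  [exact: IH|exact: dmeas_invade].
Qed.

Let measurable_random_ipc : measurable_fun setT random_ipc.
Proof.
apply: (@measurability _ _ T (subgraph sigma) setT random_ipc (@cylinder sigma))
  => // _ [A [s cA] <-]; rewrite setTI.
have mp e : measurable [set t | random_ipc t e].
  have -> : [set t | random_ipc t e] = \bigcup_N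
     ((fun t => invasion (fun e => U e t) N) @^-1` [set E | e \in E]).
    apply/seteqP; split=> t; first by move=> /asboolP[N]; exists N.
    by case=> N _ H; apply/asboolP; exists N.
  by apply: bigcupT_measurable => N; exact: dmeas_invasion.
have := @dmeas_map _ (fun e t => random_ipc t e) s mp
  [set l | exists2 c, A c & [seq c e | e <- s] = l].
congr measurable; apply/seteqP; split=> t /=; last by exists (random_ipc t).
by case=> c Ac /eq_in_map/cA; exact.
Qed.

HB.instance Definition _ :=
  isMeasurableFun.Build _ _ _ _ random_ipc measurable_random_ipc.

Definition ipc_law : probability (subgraph sigma) R :=
  distribution P (random_ipc : {RV P >-> subgraph sigma}).

End ipc_measurable.

(* Main.v *)
(* Let s = 1 - 1 / sigma and let Z_m be the number of vertices at height m.
   The law of the incipient infinite cluster up to height m is that of the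
   critical cluster biased by Z_m. So the mean of Z_m / m, even truncated at 8
   and weighted by a function of finitely many levels, is asymptotically at
   least (7 / 8) s under this law.
   For the invasion the corresponding mean is at most (3 / 4) s. Indeed suppose
   that the invasion has explored a finite tree E, and that it later continues
   beyond the boundary edge e. All weights met there are at most p_k, where k is
   the least level at which another boundary edge leads to infinity through
   weights at most p_k; the same applies at each later branching. These caps
   bound the mean number of vertices at height m beyond e by
   (3 / 4) s m th_k + O(1), where th_k is the survival probability at p_k. But
   th_k is about the conditional probability that e leads to infinity through
   weights just below p_k, hence before any other boundary edge: these events
   are disjoint, so the sum over e is at most (3 / 4) s m + O(1).
   Finally the gap between the two means, uniform over the conditioning on
   finitely many levels, makes the products of the factors
   (1 + la min (Z_m / m, 8)) / c over a sparse sequence of heights m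
   exponentially small under one law and exponentially large under the other. *)
Require Import Defs.
From HB Require Import structures.
From mathcomp Require Import all_boot all_order all_algebra.
From mathcomp Require Import all_classical all_reals all_analysis.
From mathcomp Require Import measurable_realfun.
From mathcomp Require Import zify lra.
Set Implicit Arguments.
Unset Strict Implicit.
Unset Printing Implicit Defensive.
Import Order.TTheory GRing.Theory Num.Theory.
Import numFieldNormedType.Exports.
Local Open Scope classical_set_scope.
Local Open Scope ring_scope.

(** * Bounded random variables and independence *)

(** The weights depend on finitely many levels because these are accessible on either side: the
    incipient cluster is known only through cylinder events, and the invasion can be cut at a stage
    after which it is unlikely to return to the first levels. Survival is discretised: the levels
    form a finite grid of pairs (p l, th l), where th l enters as a lower bound for the survival
    probability at p l. Escape levels then take finitely many values, and conditioning becomes a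
    finite sum over states and levels. The obstacle is that an event just below p_k has to be read
    at the previous grid level, which is harmless for the count at height m when the mesh is at most
    1 / m. Hence the grid changes with m, and every O(1) term must be bounded independently of it.
    Neither slope comes from a sharp estimate: 7/8 is what the truncation leaves of the slope s of
    the biased law, and 3/4 leaves room for the discretisation. *)

Section bounded_expectation.
Context d (T : measurableType d) (R : realType) (P : probability T R).
Implicit Types (f g : T -> R) (A B : set T).

Definition prb A : R := fine (P A).
Definition mean f : R := \int[P]_x f x.
Definition bmeas f := measurable_fun setT f /\ exists M, forall x, `|f x| <= M.

Lemma prbE A : measurable A -> P A = (prb A)%:E.
Proof.
move=> mA; rewrite /prb fineK//.
by rewrite fin_numElt (lt_le_trans _ (measure_ge0 P A))// (le_lt_trans (probability_le1 P mA)) ?ltry.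
Qed.

Lemma bmeas_cst (r : R) : bmeas (fun=> r).
Proof. by split; [exact: measurable_cst|exists `|r|]. Qed.

Lemma bmeasD f g : bmeas f -> bmeas g -> bmeas (fun x => f x + g x).
Proof.
move=> [mf [M fM]] [mg [N gN]]; split; first exact: measurable_funD.
by exists (M + N) => x; rewrite (le_trans (ler_normD _ _))// lerD.
Qed.

Lemma bmeasN f : bmeas f -> bmeas (fun x => - f x).
Proof.
move=> [mf [M fM]]; split; first exact: measurableT_comp.
by exists M => x; rewrite normrN.
Qed.

Lemma bmeasB f g : bmeas f -> bmeas g -> bmeas (fun x => f x - g x).
Proof. by move=> bf bg; apply: bmeasD => //; exact: bmeasN. Qed.

Lemma bmeasM f g : bmeas f -> bmeas g -> bmeas (fun x => f x * g x).
Proof.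
move=> [mf [M fM]] [mg [N gN]]; split; first exact: measurable_funM.
by exists (M * N) => x; rewrite normrM ler_pM.
Qed.

Lemma bmeasZ r f : bmeas f -> bmeas (fun x => r * f x).
Proof. by move=> bf; apply: bmeasM => //; exact: bmeas_cst. Qed.

Lemma bmeas_sum I (s : seq I) (Q : pred I) (F : I -> T -> R) :
  (forall i, bmeas (F i)) -> bmeas (fun x => \sum_(i <- s | Q i) F i x).
Proof.
move=> bF; elim: s => [|i s IH].
  by under eq_fun do rewrite big_nil; exact: bmeas_cst.
by under eq_fun do rewrite big_cons; case: (Q i) => //; exact: bmeasD.
Qed.

Lemma bmeas_indic A : measurable A -> bmeas (\1_A : T -> R).
Proof.
move=> mA; split; first exact: measurable_indic.
by exists 1 => x; rewrite indicE; case: (x \in A); rewrite ?normr0 ?normr1.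
Qed.

Lemma bmeas_integrable f : bmeas f -> P.-integrable setT (EFin \o f).
Proof.
move=> [mf [M fM]]; apply: measurable_bounded_integrable => //.
  by rewrite (le_lt_trans (probability_le1 P measurableT)) ?ltry.
exists M; split; first exact: num_real.
by move=> N MN x _ /=; rewrite (le_trans (fM x))// ltW.
Qed.
Hint Resolve bmeas_integrable : core.

Lemma mean_cst r : mean (fun=> r) = r.
Proof.
rewrite /mean Rintegral_cst// -[RHS]mulr1; congr (_ * _).
by rewrite -[RHS]/(fine 1%E); congr fine; exact: probability_setT.
Qed.

Lemma meanD f g : bmeas f -> bmeas g ->
  mean (fun x => f x + g x) = mean f + mean g.
Proof. by move=> bf bg; rewrite /mean RintegralD//; exact: bmeas_integrable. Qed.

Lemma meanB f g : bmeas f -> bmeas g ->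
  mean (fun x => f x - g x) = mean f - mean g.
Proof. by move=> bf bg; rewrite /mean RintegralB//; exact: bmeas_integrable. Qed.

Lemma meanZ r f : bmeas f -> mean (fun x => r * f x) = r * mean f.
Proof. by move=> bf; rewrite /mean RintegralZl//; exact: bmeas_integrable. Qed.

Lemma mean_sum I (s : seq I) (Q : pred I) (F : I -> T -> R) :
  (forall i, bmeas (F i)) ->
  mean (fun x => \sum_(i <- s | Q i) F i x) = \sum_(i <- s | Q i) mean (F i).
Proof.
move=> bF; elim: s => [|i s IH].
  by under eq_fun do rewrite big_nil; rewrite big_nil mean_cst.
under eq_fun do rewrite big_cons; rewrite big_cons; case: (Q i) => //.
by rewrite meanD ?IH//; exact: bmeas_sum.
Qed.

Lemma le_mean f g : bmeas f -> bmeas g -> (forall x, f x <= g x) ->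
  mean f <= mean g.
Proof.
by move=> bf bg fg; apply: le_Rintegral => //; exact: bmeas_integrable.
Qed.

Lemma mean_ge0 f : (forall x, 0 <= f x) -> 0 <= mean f.
Proof. by move=> f0; exact: Rintegral_ge0. Qed.

Lemma mean_indic A : measurable A -> mean \1_A = prb A.
Proof. by move=> mA; rewrite /mean /Rintegral integral_indic// setIT. Qed.

Lemma prb_ge0 A : 0 <= prb A.
Proof. by rewrite fine_ge0. Qed.

Lemma prb_le1 A : measurable A -> prb A <= 1.
Proof. by move=> mA; rewrite -lee_fin -prbE// probability_le1. Qed.

Lemma prb_setT : prb setT = 1.
Proof. by rewrite /prb probability_setT. Qed.

Lemma prb_set0 : prb set0 = 0.
Proof. by rewrite /prb measure0. Qed.

Lemma le_prb A B : measurable A -> measurable B -> A `<=` B -> prb A <= prb B.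
Proof. by move=> mA mB AB; rewrite -lee_fin -!prbE// le_measure// inE. Qed.

Lemma prbC A : measurable A -> prb (~` A) = 1 - prb A.
Proof.
move=> mA; apply: EFin_inj; rewrite -prbE; last exact: measurableC.
by rewrite probability_setC// prbE// EFinB.
Qed.

Lemma prbU A B : measurable A -> measurable B -> A `&` B = set0 ->
  prb (A `|` B) = prb A + prb B.
Proof.
move=> mA mB AB; apply: EFin_inj; rewrite EFinD -!prbE//; last exact: measurableU.
exact: measureU.
Qed.

Lemma prb_bigcap_cvg (F : (set T)^nat) : (forall n, measurable (F n)) ->
  nonincreasing_seq F -> prb (F n) @[n --> \oo] --> prb (\bigcap_n F n).
Proof.
move=> mF ndF; have mU : measurable (\bigcap_n F n) by exact: bigcapT_measurable.
have F0 : (P (F 0%N) < +oo)%E by rewrite prbE// ltry.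
have : P (F n) @[n --> \oo] --> (prb (\bigcap_n F n))%:E.
  by rewrite -prbE//; exact: nonincreasing_cvg_mu.
by move=> /fine_cvgP[_]; exact: cvg_trans.
Qed.

End bounded_expectation.

Section independent_events.
Context d (T : measurableType d) (R : realType) (P : probability T R).
Context d' (T' : measurableType d') (I : eqType) (X : I -> T -> T').
Implicit Types (S : set I) (A B : set T).

(** The pi-system on which [mutually_independent] gives the product formula. *)
Definition rectangles S : set (set T) :=
  [set A | exists s (B : I -> set T'), [/\ uniq s, [set` s] `<=` S,
     forall i, measurable (B i) & A = \bigcap_(i in [set` s]) X i @^-1` B i]].

(** The events decided by the variables with index in [S]. The inductive wrapper keeps the generated
    sigma-algebra from being unfolded. *)
Variant sig S A : Prop := Sig of <<s rectangles S >> A.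

Lemma rectangles_setI S : setI_closed (rectangles S).
Proof.
move=> _ _ [s [B [us sS mB ->]]] [s' [B' [us' sS' mB' ->]]].
exists (undup (s ++ s')).
exists (fun i => (if i \in s then B i else setT) `&`
                 (if i \in s' then B' i else setT)).
split; first exact: undup_uniq.
- by move=> i /=; rewrite mem_undup mem_cat => /orP[/sS|/sS'].
- by move=> i; apply: measurableI; case: ifP.
- apply/seteqP; split=> t /=.
    move=> [H H'] i /=; rewrite mem_undup mem_cat => _.
    by split; case: ifP => // ?; [exact: H|exact: H'].
  move=> H; split=> i /= si.
    by have := H i; rewrite /= mem_undup mem_cat si => /(_ isT)[].
  by have := H i; rewrite /= mem_undup mem_cat si orbT => /(_ isT)[].
Qed.

Lemma sig_sub S S' A : sig S A -> S `<=` S' -> sig S' A.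
Proof.
move=> [sA] SS'; split; have: rectangles S `<=` rectangles S'.
  by move=> _ [s [B [us sS mB ->]]]; exists s, B; split=> //; exact: subset_trans SS'.
by move=> /(@sub_sigma_algebra2 _ setT)/(_ _ sA).
Qed.

Lemma sig_rect S s (B : I -> set T') : uniq s -> [set` s] `<=` S ->
  (forall i, measurable (B i)) -> sig S (\bigcap_(i in [set` s]) X i @^-1` B i).
Proof. by move=> us sS mB; split; apply: sub_sigma_algebra; exists s, B. Qed.

Lemma sig_preimage S i (B : set T') : S i -> measurable B ->
  sig S (X i @^-1` B).
Proof.
move=> Si mB; have -> : X i @^-1` B = \bigcap_(j in [set` [:: i]]) X j @^-1` B.
  apply/seteqP; split=> t /=; first by move=> Bt j /=; rewrite inE => /eqP ->.
  by apply; rewrite /= inE.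
by apply: sig_rect => // j /=; rewrite inE => /eqP ->.
Qed.

Lemma sig_set0 S : sig S set0.
Proof. by split; case: (smallest_sigma_algebra setT (rectangles S)). Qed.

Lemma sigC S A : sig S A -> sig S (~` A).
Proof.
move=> [sA]; split.
by rewrite -setTD; case: (smallest_sigma_algebra setT (rectangles S)) => _ + _; exact.
Qed.

Lemma sig_setT S : sig S setT.
Proof. by rewrite -setC0; apply: sigC; exact: sig_set0. Qed.

Lemma sig_bigcupT S (F : (set T)^nat) : (forall n, sig S (F n)) ->
  sig S (\bigcup_n F n).
Proof.
move=> sF; split; case: (smallest_sigma_algebra setT (rectangles S)) => _ _; apply.
by move=> n; have [] := sF n.
Qed.

Lemma sig_bigcapT S (F : (set T)^nat) : (forall n, sig S (F n)) ->
  sig S (\bigcap_n F n).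
Proof.
move=> sF; rewrite -[X in sig S X]setCK setC_bigcap; apply: sigC.
by apply: sig_bigcupT => n; exact: sigC.
Qed.

Lemma sigU S A B : sig S A -> sig S B -> sig S (A `|` B).
Proof.
move=> sA sB; rewrite -bigcup2E; apply: sig_bigcupT => -[|[|n]] //=.
exact: sig_set0.
Qed.

Lemma sigI S A B : sig S A -> sig S B -> sig S (A `&` B).
Proof.
by move=> sA sB; rewrite -[A]setCK -[B]setCK -setCU; apply: sigC; apply: sigU;
  exact: sigC.
Qed.

Lemma sig_bigcap_seq S (J : eqType) (s : seq J) (F : J -> set T) :
  (forall j, j \in s -> sig S (F j)) -> sig S [set t | forall j, j \in s -> F j t].
Proof.
elim: s => [|j s IH] sF.
  rewrite (_ : [set _ | _] = setT); first exact: sig_setT.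
  by apply/seteqP; split.
rewrite (_ : [set _ | _] = F j `&` [set t | forall j, j \in s -> F j t]).
  apply: sigI; first by apply: sF; rewrite mem_head.
  by apply: IH => k ks; apply: sF; rewrite inE ks orbT.
apply/seteqP; split=> t /=.
  by move=> H; split=> [|k ks]; apply: H; rewrite inE ?eqxx// ks orbT.
by move=> [Fj H] k; rewrite inE => /orP[/eqP ->//|]; exact: H.
Qed.

Lemma sig_bigcup_seq S (J : eqType) (s : seq J) (F : J -> set T) :
  (forall j, j \in s -> sig S (F j)) -> sig S [set t | exists2 j, j \in s & F j t].
Proof.
move=> sF; rewrite (_ : [set _ | _] = ~` [set t | forall j, j \in s -> (~` F j) t]).
  by apply: sigC; apply: sig_bigcap_seq => j js; apply: sigC; exact: sF.
apply/seteqP; split=> t /=; first by move=> [j js Fj] /(_ j js).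
by move=> /existsNP[j /not_implyP[js /contrapT Fj]]; exists j.
Qed.

Lemma sig_cst S (Q : Prop) : sig S [set t | Q].
Proof.
have [q|nq] := pselect Q.
  by rewrite (_ : [set _ | _] = setT); [exact: sig_setT|apply/seteqP; split].
by rewrite (_ : [set _ | _] = set0); [exact: sig_set0|apply/seteqP; split].
Qed.

Hypothesis mX : forall i, measurable_fun setT (X i).

Lemma sig_measurable S A : sig S A -> measurable A.
Proof.
suff : <<s rectangles S >> `<=` measurable by move=> h [/h].
apply: smallest_sub; first exact: sigma_algebra_measurable.
move=> _ [s [B [us sS mB ->]]].
have mXB i : measurable (X i @^-1` B i).
  by rewrite -[X in measurable X]setTI; exact: mX.
elim: s {us sS} => [|i s IH].
  by rewrite (_ : \bigcap_(i in _) _ = setT)//; apply/seteqP; split.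
rewrite (_ : \bigcap_(i in _) _ =
  X i @^-1` B i `&` \bigcap_(i in [set` s]) X i @^-1` B i); first exact: measurableI.
apply/seteqP; split=> t /=.
  by move=> H; split=> [|j /= js]; apply: H; rewrite /= inE ?eqxx// js orbT.
by move=> [Hi H] j; rewrite /= inE => /orP[/eqP ->//|]; exact: H.
Qed.

Hypothesis indX : mutually_independent P X.

Lemma indep_dynkin B : measurable B ->
  dynkin [set A | measurable A /\ prb P (A `&` B) = prb P A * prb P B].
Proof.
move=> mB; split => /=.
- by split=> //; rewrite setTI prb_setT mul1r.
- move=> A [mA AB]; split; first exact: measurableC.
  rewrite prbC// mulrBl mul1r -AB.
  apply/eqP; rewrite eq_sym subr_eq -prbU.
  + by rewrite -setIUl setUCl setTI.
  + by apply: measurableI => //; exact: measurableC.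
  + exact: measurableI.
  + by rewrite setIACA setICl set0I.
- move=> F tF HF; have mF n : measurable (F n) by have [] := HF n.
  have mU : measurable (\bigcup_n F n) by exact: bigcupT_measurable.
  split=> //; rewrite setI_bigcupl.
  have mFB n : measurable (F n `&` B) by exact: measurableI.
  have tFB : trivIset setT (fun n => F n `&` B).
    by apply/trivIsetP => i j _ _ ij; rewrite setIACA (trivIsetP.1 tF)// set0I.
  apply: EFin_inj; rewrite EFinM -[LHS]prbE; last exact: bigcupT_measurable.
  have -> : P (\bigcup_n (F n `&` B)) = (\sum_(n <oo) P (F n `&` B))%E.
    by rewrite measure_bigcup//; apply: eq_eseriesl => n; rewrite in_setT.
  rewrite -prbE//.
  have -> : P (\bigcup_n F n) = (\sum_(n <oo) P (F n))%E.
    by rewrite measure_bigcup//; apply: eq_eseriesl => n; rewrite in_setT.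
  rewrite muleC -nneseriesZl//; apply: eq_eseriesr => n _.
  by rewrite (prbE _ (mFB n)) (HF n).2 EFinM -!prbE// muleC.
Qed.

(** Dynkin's pi-lambda theorem, applied once on each side. For two rectangles, disjointness of [S]
    and [S'] makes the concatenated index list duplicate-free, so the product formula of [indX]
    splits. *)
Lemma indep_sig S S' A A' : S `&` S' = set0 -> sig S A -> sig S' A' ->
  prb P (A `&` A') = prb P A * prb P A'.
Proof.
move=> SS' sA sA'.
have key G B : setI_closed G -> measurable B ->
    (forall C, G C -> measurable C /\ prb P (C `&` B) = prb P C * prb P B) ->
    forall C, <<s G >> C -> prb P (C `&` B) = prb P C * prb P B.
  move=> GI mB GB C; rewrite -setI_closed_g_dynkin_g_sigma_algebra// => dC.
  have : <<d G >> `<=` [set A | measurable A /\ prb P (A `&` B) = prb P A * prb P B].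
    by apply: smallest_sub => //; exact: indep_dynkin.
  by move=> /(_ _ dC)[].
case: (sA) => rA; move: rA; apply: (key).
- exact: rectangles_setI.
- exact: sig_measurable sA'.
have rm S0 C : rectangles S0 C -> measurable C.
  by move=> rC; apply: (@sig_measurable S0); split; exact: sub_sigma_algebra.
move=> C rC; split; first exact: rm rC.
rewrite setIC mulrC; case: sA' => rA'; move: rA'; apply: (key _ _).
- exact: rectangles_setI.
- exact: rm rC.
move=> C' rC'; split; first exact: rm rC'.
have mC := rm _ _ rC; have mC' := rm _ _ rC'.
case: rC mC => s [B [us sS mB ->]] mC; case: rC' mC' => s' [B' [us' sS' mB' ->]] mC'.
have ss' i : i \in s -> i \in s' -> False.
  move=> si s'i; suff : set0 i by [].
  by rewrite -SS'; split; [exact: sS|exact: sS'].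
apply: EFin_inj; rewrite EFinM -!prbE//; last exact: measurableI.
pose B2 i := if i \in s then B i else B' i.
have -> : \bigcap_(i in [set` s']) X i @^-1` B' i `&`
          \bigcap_(i in [set` s]) X i @^-1` B i =
          \bigcap_(i in [set` s ++ s']) X i @^-1` B2 i.
  apply/seteqP; split=> t /=.
    move=> [H' H] i /=; rewrite mem_cat /B2; case: ifPn => [si _|si /= s'i].
      exact: H.
    exact: H'.
  move=> H; split=> i /= si.
    have := H i; rewrite /= mem_cat si orbT /B2 => /(_ isT).
    by case: ifPn => // si'; case: (ss' i si' si).
  by have := H i; rewrite /= mem_cat si /B2 si => /(_ isT).
rewrite !indX//.
- rewrite big_cat/= muleC; congr (_ * _)%E.
    rewrite big_seq [RHS]big_seq; apply: eq_bigr => i s'i; rewrite /B2.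
    by case: ifPn => // si; case: (ss' i si s'i).
  by rewrite big_seq [RHS]big_seq; apply: eq_bigr => i si; rewrite /B2 si.
- rewrite cat_uniq us us' andbT/=; apply/hasPn => i s'i; apply/negP => /= si.
  exact: ss' si s'i.
- by move=> i; rewrite /B2; case: ifP.
Qed.

Lemma prb_disjoint_sig (J : eqType) (s : seq J) (S : J -> set I)
    (A : J -> set T) : uniq s ->
  {in s &, forall i j, i != j -> S i `&` S j = set0} ->
  (forall j, sig (S j) (A j)) ->
  prb P [set t | forall j, j \in s -> A j t] = \prod_(j <- s) prb P (A j).
Proof.
move=> + + sA; elim: s => [_ _|i s IH /= /andP[nis us] dS].
  rewrite big_nil (_ : [set _ | _] = setT) ?prb_setT//.
  by apply/seteqP; split.
rewrite big_cons -IH//; last first.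
  by move=> j k js ks; apply: dS; rewrite inE ?js ?ks orbT.
rewrite (_ : [set _ | _] = A i `&` [set t | forall j, j \in s -> A j t]).
  apply: (indep_sig (S := S i)
    (S' := [set e | exists2 j, j \in s & S j e])) => //.
  - apply/seteqP; split=> // e [bi [j js bj]].
    rewrite -(dS i j) ?mem_head ?inE ?js ?orbT//.
    by apply: contraNN nis => /eqP ->.
  - apply: sig_bigcap_seq => j js; apply: (sig_sub (sA j)) => e bj.
    by exists j.
apply/seteqP; split=> t /=.
  by move=> H; split=> [|k ks]; apply: H; rewrite inE ?eqxx// ks orbT.
by move=> [Fj H] k; rewrite inE => /orP[/eqP ->//|]; exact: H.
Qed.

End independent_events.

(** * A criterion for singularity *)

(** Borel-Cantelli with errors 2^-n: the points lying in infinitely many [D n] form a null set for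
    [nu], and those lying in only finitely many a null set for [mu]. *)
Lemma mutually_singular_tests d (T : measurableType d) (R : realType)
    (nu mu : probability T R) :
  (forall e : R, 0 < e ->
     exists D, [/\ measurable D, prb nu D <= e & prb mu (~` D) <= e]) ->
  mutually_singular nu mu.
Proof.
move=> H.
have e0 n : 0 < (2^-1 : R) ^+ n by rewrite exprn_gt0// invr_gt0.
have /choice[D HD] : forall n, exists D, [/\ measurable D,
    prb nu D <= (2^-1 : R) ^+ n & prb mu (~` D) <= (2^-1 : R) ^+ n].
  by move=> n; exact: H.
have mD n : measurable (D n) by have [] := HD n.
have cvg0 : (2^-1 : R) ^+ n @[n --> \oo] --> (0 : R).
  by apply: cvg_expr; rewrite ger0_norm ?invf_lt1 ?ltr1n ?invr_ge0.
have small (m : {measure set T -> \bar R}) (A : set T) : measurable A ->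
    (forall n, (m A <= (2^-1 ^+ n)%:E)%E) -> m A = 0%E.
  move=> mA mAn; apply/eqP; rewrite eq_le measure_ge0 andbT.
  apply/lee_addgt0Pr => e egt0; rewrite add0e.
  have /cvgrPdist_lt/(_ e egt0)[N _ /(_ N (leqnn N))] := cvg0.
  rewrite sub0r normrN ger0_norm; last exact/ltW/e0.
  by move=> lte; rewrite (le_trans (mAn N))// lee_fin ltW.
have mL n : measurable (\bigcup_(k in [set k | (n <= k)%N]) D k).
  by apply: bigcup_measurable.
pose A := \bigcap_n \bigcup_(k in [set k | (n <= k)%N]) D k.
have mA : measurable A by apply: bigcapT_measurable.
exists A; split => //.
  apply: small => // n.
  (* Starting the tail at [n.+1] makes its geometric sum exactly 2^-n. *)
  apply: (@le_trans _ _ (nu (\bigcup_(k in [set k | (n.+1 <= k)%N]) D k))).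
    by apply: le_measure; rewrite ?inE//; move=> t /(_ n.+1 I).
  have -> : \bigcup_(k in [set k | (n.+1 <= k)%N]) D k = \bigcup_k D (n.+1 + k)%N.
    apply/seteqP; split=> t /= [k].
      by move=> /= nk Dk; exists (k - n.+1)%N => //; rewrite subnKC.
    by move=> _ Dk; exists (n.+1 + k)%N => //=; rewrite leq_addr.
  apply: (le_trans (measure_sigma_subadditive nu (fun k => mD (n.+1 + k)%N) _ _)).
  - by apply: bigcupT_measurable.
  - by [].
  have geo : (\sum_(0 <= k <oo) ((2^-1 : R) ^+ n.+1 * 2^-1 ^+ k)%:E <= ((2^-1 : R) ^+ n)%:E)%E.
    have : series (geometric ((2^-1 : R) ^+ n.+1) 2^-1) @ \oo --> (2^-1 : R) ^+ n.+1 * (1 - 2^-1)^-1.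
      by apply: cvg_geometric_series; rewrite ger0_norm ?invf_lt1 ?ltr1n ?invr_ge0.
    move=> geo.
    have -> : (\sum_(0 <= k <oo) ((2^-1 : R) ^+ n.+1 * 2^-1 ^+ k)%:E)%E =
       ((2^-1 : R) ^+ n.+1 * (1 - 2^-1)^-1)%:E.
      apply/cvg_lim => //; apply: cvg_EFin.
        by apply: nearW => N; rewrite sumEFin.
      apply: cvg_trans geo; apply: near_eq_cvg; near=> N.
      by rewrite /series/= sumEFin.
    rewrite lee_fin exprS.
    have -> : (1 - 2^-1 : R)^-1 = 2 by rewrite -[RHS]invrK; congr (_^-1); lra.
    by rewrite mulrAC mulVf ?mul1r// pnatr_eq0.
  apply: le_trans geo; apply: lee_nneseries => k _ //.
  rewrite -exprD; apply: (@le_trans _ _ (prb nu (D (n.+1 + k)%N))%:E).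
    by rewrite -prbE.
  by rewrite lee_fin; have [] := HD (n.+1 + k)%N.
rewrite /A setC_bigcap; apply/eqP; rewrite eq_le measure_ge0 andbT.
apply: (le_trans (measure_sigma_subadditive mu
    (fun k => measurableC (mL k)) _ _)).
- by apply: bigcupT_measurable => k; exact: measurableC.
- by [].
rewrite eseries0// => k _ _; apply: small; first exact: measurableC.
move=> N; apply: (@le_trans _ _ (mu (~` D (maxn k N)))).
  apply: le_measure; rewrite ?inE//; try exact: measurableC.
  by apply: subsetC => t Dt; exists (maxn k N) => //=; rewrite leq_maxl.
apply: (@le_trans _ _ (prb mu (~` D (maxn k N)))%:E).
  by rewrite -prbE//; exact: measurableC.
rewrite lee_fin; have [_ _] := HD (maxn k N) => /le_trans; apply.
by apply: ler_wiXn2l; rewrite ?leq_maxr ?invr_ge0// invf_le1// ler1n.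
Unshelve. all: by end_near. Qed.

(* The likelihood-type products F = \prod_j (1 + la * g m_j) / c along a sparse
   sequence (m_j): F is exponentially small in mean under nu and 1 / F is under
   mu, because each factor gains (1 + la * a) / c, resp. c * (1 - la * b + O(la^2)). *)
Lemma mutually_singular_of_mean_gap d (T : measurableType d) (R : realType)
    (nu mu : probability T R) (C : (T -> R) -> Prop) (g : nat -> T -> R)
    (a b K : R) :
  (forall F, C F -> bmeas F) -> C (fun=> 1) ->
  (forall (op : R -> R -> R) F m, C F -> C (fun x => op (F x) (g m x))) ->
  (forall m x, 0 <= g m x <= K) -> 0 <= a -> a < b -> b <= K -> 1 <= K ->
  (forall F, C F -> (forall x, 0 <= F x) -> forall e, 0 < e ->
     \forall m \near \oo, mean nu (fun x => F x * g m x) <= a * mean nu F + e) ->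
  (forall F, C F -> (forall x, 0 <= F x) -> forall e, 0 < e ->
     \forall m \near \oo, b * mean mu F - e <= mean mu (fun x => F x * g m x)) ->
  mutually_singular nu mu.
Proof.
move=> Cb C1 Cop gK a0 ab bK K1 Hnu Hmu.
(* With this size the quadratic error 2 la^2 K^3 is half of the linear gain la (b - a) / 2 in the
   bound on [rb]. *)
pose la := (b - a) / (8 * K ^+ 3).
have K0 : 0 < K by lra.
have K3 : 0 < 8 * K ^+ 3 by rewrite mulr_gt0// exprn_gt0.
have la0 : 0 < la by rewrite divr_gt0// subr_gt0.
have laE : la * K ^+ 3 = (b - a) / 8.
  rewrite /la; apply: (mulfI (_ : 8 != 0)); first by rewrite pnatr_eq0.
  by rewrite mulrA [8 * _]mulrC -mulrA divfK ?gt_eqF// mulrC divfK// pnatr_eq0.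
have la1 : la * K <= 1 / 8.
  have KK : 1 <= K ^+ 2 by rewrite exprn_ege1.
  have : la * K ^+ 3 <= K / 8 by rewrite laE; lra.
  have -> : la * K ^+ 3 = (la * K ^+ 2) * K by lra.
  move=> h; have h2 : la * K ^+ 2 <= 1 / 8 by nra.
  by nra.
have la1' : la <= 1 / 8 by nra.
have lab : 0 < la * (b - a) by rewrite mulr_gt0// subr_gt0.
have labK : 0 <= la * (K - (a + b) / 2) by rewrite mulr_ge0 ?(ltW la0)//; lra.
have laab : 0 <= la * ((a + b) / 2) by rewrite mulr_ge0 ?(ltW la0)//; lra.
have laa : 0 <= la * a by rewrite mulr_ge0 ?(ltW la0).
(* The value of the factor at the midpoint of [a] and [b], so that both sides keep a gain of first
   order in [la]. *)
pose c := 1 + la * ((a + b) / 2).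
have c1 : 1 <= c by rewrite lerDl.
have c2 : c <= 2 by rewrite /c; lra.
pose ra := (1 + la * a) / c.
have c0 : 0 < c by lra.
have ra1 : ra < 1 by rewrite /ra ltr_pdivrMr// mul1r /c; lra.
have ra0 : 0 <= ra by rewrite /ra divr_ge0 ?ltW//; lra.
pose rb := c * (1 - la * b + la ^+ 2 * K ^+ 2).
have rb1 : rb < 1.
  have e1 : rb <= 1 - la * (b - a) / 2 + 2 * la ^+ 2 * K ^+ 3.
    rewrite /rb /c.
    have h1 : la ^+ 2 * K ^+ 2 <= la ^+ 2 * K ^+ 3.
      by rewrite ler_wpM2l ?sqr_ge0// ler_weXn2l.
    have h2 : (la * ((a + b) / 2)) * (la ^+ 2 * K ^+ 2) <= la ^+ 2 * K ^+ 3.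
      have -> : la ^+ 2 * K ^+ 3 = K * (la ^+ 2 * K ^+ 2) by lra.
      rewrite ler_wpM2r//; first by rewrite mulr_ge0 ?sqr_ge0.
      by lra.
    have h3 : 0 <= la * ((a + b) / 2) * (la * b).
      by rewrite mulr_ge0// mulr_ge0 ?(ltW la0)//; lra.
    by lra.
  have e2 : 2 * la ^+ 2 * K ^+ 3 = la * (b - a) / 4.
    have -> : 2 * la ^+ 2 * K ^+ 3 = 2 * la * (la * K ^+ 3) by lra.
    by rewrite laE; lra.
  by lra.
pose r := Num.max ra rb.
have r1 : r < 1 by rewrite gt_max ra1.
have rra : ra <= r by rewrite le_max lexx.
have rrb : rb <= r by rewrite le_max lexx orbT.
have r0 : 0 <= r by rewrite (le_trans ra0).
(* The room between [r] and [q] absorbs the additive errors [e] of the two mean estimates at each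
   step. *)
pose q := (1 + r) / 2.
have q1 : q < 1 by rewrite /q; lra.
have q0 : 0 < q by rewrite /q; lra.
have step J : exists F, [/\ C F, forall x, 0 < F x, mean nu F <= q ^+ J &
    mean mu (fun x => (F x)^-1) <= q ^+ J].
  elim: J => [|J [F [CF F0 Fnu Fmu]]].
    by exists (fun=> 1); split=> //; rewrite ?invr1 ?mean_cst ?expr0.
  pose e := (q - r) * q ^+ J / 2.
  have e0 : 0 < e by rewrite /e !mulr_gt0 ?exprn_gt0// ?invr_gt0// /q; lra.
  (* An [op] that ignores its second argument closes [C] under inversion, so the estimate under [mu]
     can be weighted by 1 / F. *)
  have CV : C (fun x => (F x)^-1).
    by have := Cop (fun u _ => u^-1) F 0%N CF.
  have [N1 _ HN1] := Hnu F CF (fun x => ltW (F0 x)) e e0.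
  have iF0 x : 0 <= (F x)^-1 by rewrite invr_ge0 ltW.
  have [N2 _ HN2] := Hmu _ CV iF0 e e0.
  pose m := maxn N1 N2.
  have {HN1} n1 := HN1 m (leq_maxl _ _).
  have {HN2} n2 := HN2 m (leq_maxr _ _).
  have gp x : 0 <= la * g m x by rewrite mulr_ge0 ?(ltW la0)//; have /andP[] := gK m x.
  have bF := Cb _ CF; have bV := Cb _ CV.
  have bFg : bmeas (fun x => F x * g m x) by exact: Cb (Cop (fun u v => u * v) F m CF).
  have bVg : bmeas (fun x => (F x)^-1 * g m x).
    exact: Cb (Cop (fun u v => u * v) _ m CV).
  pose G x := F x * ((1 + la * g m x) / c).
  have CG : C G := Cop (fun u v => u * ((1 + la * v) / c)) F m CF.
  exists G; split=> //.
  - by move=> x; rewrite mulr_gt0// divr_gt0//; have := gp x; lra.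
  - have -> : mean nu G = c^-1 * (mean nu F + la * mean nu (fun x => F x * g m x)).
      rewrite -meanZ// -meanD//; last exact: bmeasZ.
      rewrite -meanZ; last by apply: bmeasD => //; exact: bmeasZ.
      by congr mean; apply/funext => x; rewrite /G; lra.
    apply: (@le_trans _ _ (ra * q ^+ J + e)); last first.
      rewrite exprS /e; have := exprn_gt0 J q0; set w := q ^+ J.
      by rewrite /q; nra.
    have -> : ra * q ^+ J + e = c^-1 * ((1 + la * a) * q ^+ J + c * e).
      by rewrite mulrDr mulKf ?gt_eqF// mulrA [c^-1 * _]mulrC.
    rewrite ler_pM2l ?invr_gt0//.
    have h1 : la * mean nu (fun x => F x * g m x) <= la * (a * mean nu F + e).
      by rewrite ler_pM2l.
    have h2 : 0 <= (1 + la * a) * (q ^+ J - mean nu F).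
      by rewrite mulr_ge0 ?subr_ge0//; lra.
    have h3 : 0 <= (c - la) * e by rewrite mulr_ge0 ?(ltW la0)//; lra.
    by lra.
  - have CW : C (fun x => (G x)^-1) by exact: Cop (fun u _ => u^-1) G 0%N CG.
    apply: (@le_trans _ _ (c * ((1 + la ^+ 2 * K ^+ 2) * mean mu (fun x => (F x)^-1)
        - la * mean mu (fun x => (F x)^-1 * g m x)))).
      rewrite -!meanZ// -meanB; [|exact: bmeasZ|exact: bmeasZ].
      rewrite -meanZ; last by apply: bmeasB => //; exact: bmeasZ.
      apply: le_mean => [||x]; first exact: Cb.
        by apply: bmeasZ; apply: bmeasB; exact: bmeasZ.
      rewrite /G invfM invf_div.
      set u := (F x)^-1; set v := la * g m x.
      have u0 : 0 <= u by exact: iF0.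
      have v0 : 0 <= v by exact: gp.
      have vK : v ^+ 2 <= la ^+ 2 * K ^+ 2.
        rewrite -exprMn lerXn2r ?nnegrE//; first by rewrite mulr_ge0 ?(ltW la0) ?(ltW K0).
        by rewrite /v ler_pM2l//; have /andP[] := gK m x.
      (* Because (1 + v)(1 - v + v^2) = 1 + v^3 and v >= 0. *)
      have w1 : (1 + v)^-1 <= 1 - v + la ^+ 2 * K ^+ 2.
        rewrite -div1r ler_pdivrMr; last lra.
        by nra.
      rewrite mulrCA ler_pM2l//.
      apply: (@le_trans _ _ (u * (1 - v + la ^+ 2 * K ^+ 2))).
        by rewrite ler_wpM2l.
      by rewrite /v; lra.
    have M0 : 0 <= mean mu (fun x => (F x)^-1) by exact: mean_ge0.
    move: n2 Fmu M0; set M := mean mu (fun x => (F x)^-1).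
    set N := mean mu _ => n2 Fmu M0.
    apply: (@le_trans _ _ (rb * M + c * (la * e))).
      rewrite /rb -mulrA -mulrDr ler_pM2l//.
      have : 0 <= la * (N - (b * M - e)) by rewrite mulr_ge0 ?(ltW la0) ?subr_ge0.
      by lra.
    have h1 : rb * M <= r * q ^+ J.
      apply: (@le_trans _ _ (r * M)); first by rewrite ler_wpM2r.
      by rewrite ler_wpM2l.
    have h2 : c * (la * e) <= e.
      have -> : c * (la * e) = (c * la) * e by lra.
      have : c * la <= 1 by nra.
      move=> h; have := e0; nra.
    rewrite exprS; move: h1 h2; rewrite /e; have := exprn_gt0 J q0.
    set w := q ^+ J; rewrite /q => w0 h1 h2.
    have : 0 < (1 - r) * w by rewrite mulr_gt0// subr_gt0.
    by lra.
apply: mutually_singular_tests => e e0.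
have [J qJ] : exists J, q ^+ J <= e.
  have : q ^+ n @[n --> \oo] --> (0 : R).
    by apply: cvg_expr; rewrite ger0_norm// ltW.
  move=> /cvgrPdist_lt/(_ e e0)[J _ /(_ J (leqnn J))] /=.
  by rewrite sub0r normrN ger0_norm ?exprn_ge0 ?ltW// => /ltW; exists J.
have [F [CF F0 Fnu Fmu]] := step J.
have [mF _] := Cb _ CF.
have mD : measurable [set x | 1 <= F x].
  rewrite -[X in measurable X]setTI.
  have : measurable_fun setT (fun x => 1 <= F x).
    by apply: measurable_fun_ler => //; exact: measurable_cst.
  by move=> /(_ measurableT [set true] I).
have CV : C (fun x => (F x)^-1) by exact: Cop (fun u _ => u^-1) F 0%N CF.
(* Markov's inequality both ways: the indicator of F >= 1 is at most F, that of F < 1 is at most 1 /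
   F. *)
exists [set x | 1 <= F x]; split=> //; last first.
  rewrite -mean_indic; last exact: measurableC.
  apply: le_trans (le_trans Fmu qJ); apply: le_mean => [||x].
  - by apply: bmeas_indic; exact: measurableC.
  - exact: Cb.
  rewrite indicE; case: (boolP (x \in _)) => [|_]; last by rewrite invr_ge0 ltW.
  rewrite inE /= => nF1; rewrite invf_ge1//; have [/ltW//|F1] := ltP (F x) 1.
  by exfalso; exact: nF1.
rewrite -mean_indic//; apply: le_trans (le_trans Fnu qJ).
apply: le_mean => [||x]; [exact: bmeas_indic|exact: Cb|].
by rewrite indicE; case: (boolP (x \in _)) => [|_]; rewrite ?inE//= ltW.
Qed.

(** * Subtrees and survival *)

Section branches.
Context {sigma : nat}.
Implicit Types (v y : vertex sigma) (e : edge sigma) (i : 'I_sigma).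

(** Index set of the weights in the subtree of [y]: with the most recent label first, the
    descendants of [y] are the words ending in [y]. *)
Definition below y : set (edge sigma) := [set e | exists z, e.1 = z ++ y].
Definition branch y i : set (edge sigma) := (y, i) |` below (i :: y).

Lemma below_size y e : below y e -> (size y <= size e.1)%N.
Proof. by case=> z ->; rewrite size_cat leq_addl. Qed.

Lemma below_refl y i : below y (y, i).
Proof. by exists [::]. Qed.

Lemma below_trans z y e : below (z ++ y) e -> below y e.
Proof. by case=> w ew; exists (w ++ z); rewrite -catA. Qed.

Lemma below_cons y i e : below (i :: y) e -> below y e.
Proof. exact: (@below_trans [:: i]). Qed.

Lemma branch_below y i e : branch y i e -> below y e.
Proof. by case=> [->|/below_cons//]; exact: below_refl. Qed.

Lemma edge_notin_below y i : ~ below (i :: y) (y, i).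
Proof. by move=> /below_size /=; rewrite ltnn. Qed.

Lemma cat_cons_inj (a b : vertex sigma) i j y :
  a ++ i :: y = b ++ j :: y -> a = b /\ i = j.
Proof.
move=> ab; have sab : size a = size b.
  by move: (congr1 size ab); rewrite !size_cat /= => /addIn.
by move/eqP: ab; rewrite eqseq_cat// => /andP[/eqP -> /eqP[->]].
Qed.

Lemma branch_disjoint y i j : i != j -> branch y i `&` branch y j = set0.
Proof.
move=> ij; apply/seteqP; split => // e [bi bj].
case: bi bj => [-> |[a ea]] [|[b eb]].
- by case=> /eqP; rewrite (negbTE ij).
- by apply: (@edge_notin_below y j); exists b; exact: eb.
- by move=> ey; apply: (@edge_notin_below y i); exists a; rewrite -ea ey.
- by move: ij; rewrite eb in ea; have [_ ->] := cat_cons_inj ea; rewrite eqxx.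
Qed.

Fixpoint surv (o : edge sigma -> bool) n v : bool :=
  if n is n'.+1 then [exists i, o (v, i) && surv o n' (i :: v)] else true.

Lemma survS o n v : surv o n.+1 v -> surv o n v.
Proof.
elim: n v => [//|n IH] v /= /existsP[i /andP[oi si]].
by apply/existsP; exists i; rewrite oi IH.
Qed.

Lemma leq_surv o m n v : (m <= n)%N -> surv o n v -> surv o m v.
Proof. by move=> mn; rewrite -(subnK mn); elim: (n - m)%N => // k IH /survS. Qed.

End branches.

(** Probability that a Galton-Watson tree with binomial (sigma, p) offspring survives n
    generations. *)
Fixpoint survp (R : realType) (sigma : nat) (p : R) n : R :=
  if n is n'.+1 then 1 - (1 - p * survp sigma p n') ^+ sigma else 1.

Section survival_probability.
Context d (T : measurableType d) (R : realType) (P : probability T R).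
Context d' (T' : measurableType d') (sigma : nat) (X : edge sigma -> T -> T').
Hypothesis mX : forall e, measurable_fun setT (X e).
Hypothesis indX : mutually_independent P X.

Lemma prb_branches y (s : seq 'I_sigma) (A : 'I_sigma -> set T) : uniq s ->
  (forall i, sig X (branch y i) (A i)) ->
  prb P [set t | forall i, i \in s -> A i t] = \prod_(i <- s) prb P (A i).
Proof.
move=> us sA; apply: (prb_disjoint_sig mX indX us _ sA) => i j _ _.
exact: branch_disjoint.
Qed.

Variables (o : edge sigma -> T -> bool) (p : R).
Hypothesis sig_o : forall e, sig X [set e] [set t | o e t].
Hypothesis prb_o : forall e, prb P [set t | o e t] = p.

Lemma sig_surv n y : sig X (below y) [set t | surv (o ^~ t) n y].
Proof.
elim: n y => [|n IH] y /=.
  by rewrite (_ : [set _ | _] = setT); [exact: sig_setT|apply/seteqP; split].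
rewrite (_ : [set _ | _] = [set t | exists2 i, i \in enum 'I_sigma &
    ([set t | o (y, i) t] `&` [set t | surv (o ^~ t) n (i :: y)]) t]).
  apply: sig_bigcup_seq => i _; apply: sigI.
    by apply: (sig_sub (@sig_o (y, i))) => e ->; exact: below_refl.
  by apply: (sig_sub (IH (i :: y))) => e; exact: below_cons.
apply/seteqP; split=> t /=.
  by move=> /existsP[i /andP[]]; exists i; rewrite ?mem_enum.
by move=> [i _ [oi si]]; apply/existsP; exists i; rewrite oi.
Qed.

Lemma sig_branch_surv n y i :
  sig X (branch y i) [set t | o (y, i) t && surv (o ^~ t) n (i :: y)].
Proof.
rewrite (_ : [set _ | _] = [set t | o (y, i) t] `&` [set t | surv (o ^~ t) n (i :: y)]).
  apply: sigI.
    by apply: (sig_sub (@sig_o (y, i))) => e ->; left.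
  by apply: (sig_sub (@sig_surv n (i :: y))) => e; right.
by apply/seteqP; split=> t /= => [/andP[]|[->]].
Qed.

Lemma prb_open_surv n y i :
  prb P [set t | o (y, i) t && surv (o ^~ t) n (i :: y)] =
  p * prb P [set t | surv (o ^~ t) n (i :: y)].
Proof.
rewrite -(prb_o (y, i)).
rewrite -(indep_sig mX indX (S := [set (y, i)]) (S' := below (i :: y))).
- by congr prb; apply/seteqP; split=> t /= => [/andP[]|[->]].
- by apply/seteqP; split=> // e [/= ->]; exact: edge_notin_below.
- exact: sig_o.
- exact: sig_surv.
Qed.

Lemma prb_surv n y : prb P [set t | surv (o ^~ t) n y] = survp sigma p n.
Proof.
elim: n y => [|n IH] y.
  by rewrite (_ : [set _ | _] = setT) ?prb_setT//; apply/seteqP; split.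
pose A i := ~` [set t | o (y, i) t && surv (o ^~ t) n (i :: y)].
have sA i : sig X (branch y i) (A i) by apply: sigC; exact: sig_branch_surv.
have mA i : measurable (A i) by apply: (sig_measurable mX) (sA i).
have -> : [set t | surv (o ^~ t) n.+1 y] =
    ~` [set t | forall i, i \in enum 'I_sigma -> A i t].
  apply/seteqP; split=> t /=.
    by move=> /existsP[i oi] /(_ i); rewrite mem_enum => /(_ isT).
  move=> /existsNP[i /not_implyP[_ /contrapT oi]].
  by apply/existsP; exists i.
rewrite prbC; last first.
  by apply: (sig_measurable mX (S := setT)); apply: sig_bigcap_seq => i _;
    apply: (sig_sub (sA i)).
rewrite (@prb_branches y) ?enum_uniq//= big_enum/=; congr (1 - _).
rewrite -[X in _ ^+ X]card_ord -prodr_const; apply: eq_bigr => i _.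
rewrite /A prbC ?prb_open_surv ?IH//.
by apply: (sig_measurable mX) (@sig_branch_surv n y i).
Qed.

End survival_probability.

(** * Levels of the tree and functions of finitely many edges *)

Section levels.
Context {sigma : nat}.
Implicit Types (v y z : vertex sigma) (e : edge sigma) (c : edge sigma -> bool).

Fixpoint level m : seq (vertex sigma) :=
  if m is m'.+1 then [seq i :: v | v <- level m', i <- enum 'I_sigma] else [:: [::]].

Lemma mem_level m v : (v \in level m) = (size v == m).
Proof.
elim: m v => [|m IH] [|i v] /=; rewrite ?inE//.
  by apply/negbTE/allpairsP => -[[u j] /= [_ _]].
rewrite eqSS -IH; apply/allpairsP/idP => [[[u j] /= [um _ [_ ->]]]//|vm].
by exists (v, i); rewrite /= mem_enum.
Qed.

Lemma level_uniq m : uniq (level m).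
Proof.
elim: m => [//|m IH] /=; apply: allpairs_uniq => //; first exact: enum_uniq.
by move=> [u i] [v j] _ _ /= [-> ->].
Qed.

Lemma size_level m : size (level m) = (sigma ^ m)%N.
Proof.
by elim: m => [//|m IH] /=; rewrite size_allpairs IH size_enum_ord expnSr.
Qed.

Definition level_edges m : seq (edge sigma) :=
  [seq (v, i) | v <- level m, i <- enum 'I_sigma].

Lemma mem_level_edges m e : (e \in level_edges m) = (size e.1 == m).
Proof.
rewrite -mem_level; apply/allpairsP/idP => [[[u j] /= [um _ ->]]//|vm].
by exists (e.1, e.2); rewrite /= mem_enum; case: e vm.
Qed.

Lemma level_edges_uniq m : uniq (level_edges m).
Proof.
apply: allpairs_uniq; [exact: level_uniq|exact: enum_uniq|].
by move=> [u i] [v j] _ _ /= [-> ->].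
Qed.

Definition shallow n : seq (edge sigma) := flatten [seq level_edges k | k <- iota 0 n].

Lemma mem_shallow n e : (e \in shallow n) = (size e.1 < n)%N.
Proof.
apply/flatten_mapP/idP => [[k]|en].
  by rewrite mem_iota add0n mem_level_edges => /= kn /eqP ->.
by exists (size e.1); rewrite ?mem_iota ?mem_level_edges.
Qed.

Fixpoint open_to c v : bool := if v is i :: u then c (u, i) && open_to c u else true.

Lemma eq_open_to c c' v :
  (forall e, (size e.1 < size v)%N -> c e = c' e) -> open_to c v = open_to c' v.
Proof.
elim: v => [//|i v IH] cc' /=; rewrite cc'//; congr andb.
by apply: IH => e ev; apply: cc'; exact: ltnW.
Qed.

Lemma surv_open_to c n y : open_to c y ->
  surv c n y <-> exists z, size z = n /\ open_to c (z ++ y).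
Proof.
elim: n y => [|n IH] y oy /=; first by split=> // _; exists [::].
split=> [/existsP[i /andP[ci]]|[z]].
  have oiy : open_to c (i :: y) by rewrite /= ci.
  move=> /(IH _ oiy)[z [zn oz]]; exists (rcons z i).
  by rewrite size_rcons zn cat_rcons.
case/lastP: z => [[]//|z i]; rewrite size_rcons cat_rcons => -[[zn] oz].
have oiy : open_to c (i :: y).
  by elim: z {zn} oz => [//|j z IHz] /= /andP[_]; exact: IHz.
apply/existsP; exists i; have /= /andP[-> _] := oiy.
by apply/(IH _ oiy); exists z.
Qed.

(** Openness of the ancestral line is invariant along a walk: a step down uses an open edge, and a
    step up only drops a condition. *)
Lemma connected_open_to (c : subgraph sigma) v :
  connected_to c [::] v <-> open_to c v.
Proof.
split=> [[p [pp <-]]|].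
  have : open_to c [::] by [].
  elim: p [::] pp => [//|u p IH] x /= /andP[xu pp] ox.
  apply: IH pp _; move: xu => /existsP[i /orP[/andP[/eqP -> cx]|/andP[/eqP xE cx]]].
    by rewrite /= cx.
  by move: ox; rewrite xE /= => /andP[].
elim: v => [_|i v IH /= /andP[civ /IH[p [pp lp]]]]; first by exists [::].
exists (rcons p (i :: v)); rewrite last_rcons rcons_path pp lp; split=> //=.
by apply/existsP; exists i; rewrite eqxx civ.
Qed.

Lemma open_clusterE (c : subgraph sigma) e : open_cluster c e = open_to c (child_end e).
Proof.
rewrite /open_cluster; case: e => v i /=; congr andb.
by apply/asboolP/idP => /connected_open_to.
Qed.

Lemma open_to_cluster (c : subgraph sigma) v : open_to (open_cluster c) v = open_to c v.
Proof. by elim: v => [//|i v IH] /=; rewrite open_clusterE /= IH -andbA andbb. Qed.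

Lemma reaches_heightP (c : subgraph sigma) n : reaches_height n c <-> surv c n [::].
Proof.
rewrite (@surv_open_to c n [::])//; split=> [[v [vn /connected_open_to ov]]|[z [zn]]].
  by exists v; rewrite cats0.
by rewrite cats0 => oz; exists z; split=> //; exact/connected_open_to.
Qed.

Lemma surv_level c m k : surv c (m + k) [::] <->
  exists2 v, v \in level m & open_to c v && surv c k v.
Proof.
rewrite (@surv_open_to c (m + k) [::])//; split=> [[z []]|[v]].
  rewrite cats0 => zmk oz; exists (drop k z).
    by rewrite mem_level size_drop zmk addnK.
  have od : open_to c (drop k z).
    move: oz; rewrite -[X in open_to c X -> _](cat_take_drop k z).
    by elim: (take k z) => [//|i u IH] /= /andP[_]; exact: IH.
  rewrite od /=; apply/(surv_open_to _ od); exists (take k z).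
  by rewrite cat_take_drop size_takel// zmk leq_addl.
rewrite mem_level => /eqP vm /andP[ov /(surv_open_to _ ov)[z [zk oz]]].
by exists (z ++ v); rewrite cats0 size_cat zk vm addnC.
Qed.

Definition population (R : realType) m c : R := \sum_(v <- level m) (open_to c v)%:R.

Lemma populationS (R : realType) m c :
  population R m.+1 c =
  \sum_(e <- level_edges m) (open_to c e.1)%:R * (c e)%:R.
Proof.
rewrite /population /level_edges /= !big_allpairs_dep/=.
by apply: eq_bigr => v _; apply: eq_bigr => i _ /=; rewrite -mulnb natrM mulrC.
Qed.

Lemma sum_level_edges (R : realType) m c :
  \sum_(e <- level_edges m) (open_to c e.1)%:R = sigma%:R * population R m c.
Proof.
rewrite /population /level_edges big_allpairs_dep/= mulr_sumr.
apply: eq_bigr => v _; rewrite -[RHS]/(sigma%:R * _) big_enum/= sumr_const card_ord.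
by rewrite mulr_natl.
Qed.

Lemma population_ge0 (R : realType) m c : 0 <= population R m c.
Proof. by apply: sumr_ge0. Qed.

Lemma population_cluster (R : realType) m (c : subgraph sigma) :
  population R m (open_cluster c) = population R m c.
Proof. by apply: eq_bigr => v _; rewrite open_to_cluster. Qed.

Definition depends_on (s : seq (edge sigma)) (A : Type) (f : (edge sigma -> bool) -> A) :=
  forall c c', {in s, c =1 c'} -> f c = f c'.

Lemma depends_on_sub (s s' : seq (edge sigma)) A (f : _ -> A) : {subset s <= s'} ->
  depends_on s f -> depends_on s' f.
Proof. by move=> ss' df c c' cc'; apply: df => e /ss'; exact: cc'. Qed.

Lemma leq_depends_on m n A (f : _ -> A) : (m <= n)%N ->
  depends_on (shallow m) f -> depends_on (shallow n) f.
Proof.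
move=> mn; apply: depends_on_sub => e; rewrite !mem_shallow => em.
exact: leq_trans mn.
Qed.

Lemma depends_on_open_to v : depends_on (shallow (size v)) (open_to ^~ v).
Proof. by move=> c c' cc'; apply: eq_open_to => e ev; apply: cc'; rewrite mem_shallow. Qed.

Lemma depends_on_population (R : realType) m : depends_on (shallow m) (@population R m).
Proof.
move=> c c' cc'; rewrite /population big_seq [RHS]big_seq.
apply: eq_bigr => v; rewrite mem_level => /eqP vm.
by rewrite (@depends_on_open_to v c c')// vm.
Qed.

Lemma depends_on_cluster n A (f : _ -> A) : depends_on (shallow n) f ->
  depends_on (shallow n) (f \o @open_cluster sigma).
Proof.
move=> df c c' cc'; apply: df => e; rewrite mem_shallow => en.
rewrite !open_clusterE; apply: eq_open_to => e' /=; rewrite ltnS => ee'.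
by apply: cc'; rewrite mem_shallow (leq_ltn_trans ee').
Qed.

(** Restrictions to [s] form a finite type, so a function depending on [s] is a finite combination
    of indicators of patterns. *)
Definition pattern (s : seq (edge sigma)) c : (size s).-tuple bool :=
  map_tuple c (in_tuple s).

(** Edges outside [s] get an index out of range, hence the default: they are closed. *)
Definition of_pattern (s : seq (edge sigma)) (b : (size s).-tuple bool) :
  edge sigma -> bool := fun e => nth false b (index e s).

Lemma patternK s c : {in s, of_pattern (pattern s c) =1 c}.
Proof. by move=> e es; rewrite /of_pattern /= (nth_map e) ?index_mem// nth_index. Qed.

Lemma pattern_eq s c c' : {in s, c =1 c'} -> pattern s c = pattern s c'.
Proof. by move=> cc'; apply/val_inj => /=; apply/eq_in_map. Qed.

Lemma depends_on_pattern (R : realType) s (f : _ -> R) c : depends_on s f ->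
  f c = \sum_b f (of_pattern b) * (pattern s c == b)%:R.
Proof.
move=> df; rewrite (bigD1 (pattern s c))//= eqxx mulr1 big1 ?addr0.
  by apply: df => e es; rewrite patternK.
by move=> b; rewrite eq_sym => /negbTE ->; rewrite mulr0.
Qed.

End levels.

(** * Moments of finitely determined functions under independent edges *)

Section finite_dependence.
Context {R : realType} {sigma : nat}.

Lemma measurable_depends_on (s : seq (edge sigma)) (A : set (subgraph sigma)) :
  (forall c c' : edge sigma -> bool, {in s, c =1 c'} -> A c -> A c') -> measurable A.
Proof. by move=> dA; apply: sub_sigma_algebra; exists s. Qed.

Lemma bmeas_depends_on (s : seq (edge sigma)) (f : subgraph sigma -> R) :
  depends_on s f -> bmeas f.
Proof.
move=> df; split.
  move=> _ B mB; rewrite setTI; apply: (measurable_depends_on (s := s)) => c c' cc' /=.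
  by rewrite (df c c').
exists (\sum_(b : (size s).-tuple bool) `|f (of_pattern b)|) => c.
rewrite (depends_on_pattern c df) (le_trans (ler_norm_sum _ _ _))//.
apply: ler_sum => b _; rewrite normrM.
by case: eqP => _; rewrite ?normr1 ?mulr1// normr0 mulr0.
Qed.

Lemma measurable_edge (e : edge sigma) :
  measurable_fun setT (fun c : subgraph sigma => c e).
Proof.
move=> _ B _; rewrite setTI; apply: (measurable_depends_on (s := [:: e])) => c c' cc' /=.
by rewrite cc'// mem_head.
Qed.

Context (P : probability (subgraph sigma) R).
Hypothesis indP : mutually_independent P (fun (e : edge sigma) (c : subgraph sigma) => c e).
Local Notation sig := (sig (fun (e : edge sigma) (c : subgraph sigma) => c e)).

Lemma sig_edge (S : set (edge sigma)) e : S e -> sig S [set c : subgraph sigma | c e].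
Proof.
move=> Se; rewrite (_ : [set c | _] = (fun c : subgraph sigma => c e) @^-1` [set true]).
  exact: sig_preimage.
by apply/seteqP; split.
Qed.

Lemma sig_depends_on (s : seq (edge sigma)) (A : set (subgraph sigma)) :
  (forall c c' : edge sigma -> bool, {in s, c =1 c'} -> A c -> A c') ->
  sig [set` s] A.
Proof.
move=> dA.
rewrite (_ : A = [set c | exists2 b, b \in enum {: (size s).-tuple bool} &
    ([set _ | A (of_pattern b)] `&` [set c : subgraph sigma | forall e, e \in s ->
        c e = of_pattern b e]) c]).
  apply: sig_bigcup_seq => b _; apply: sigI; first exact: sig_cst.
  apply: sig_bigcap_seq => e es.
  exact: (@sig_preimage _ _ _ _ _ _ _ e [set of_pattern b e]).
apply/seteqP; split=> c /=.
  move=> Ac; exists (pattern s c); rewrite ?mem_enum//; split.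
    by apply: dA Ac => e es; rewrite patternK.
  by move=> e es; rewrite patternK.
by move=> [b _ [Ab cb]]; apply: dA Ab => e es; rewrite cb.
Qed.

(** On each pattern of [s] the function [f] is constant, and the pattern is an event independent of
    [B]. *)
Lemma mean_mul_indic s (f : subgraph sigma -> R) S B : depends_on s f ->
  [set` s] `&` S = set0 -> sig S B ->
  mean P (fun c => f c * \1_B c) = mean P f * prb P B.
Proof.
move=> df sS sB.
have mB : measurable B by apply: sig_measurable sB => e; exact: measurable_edge.
pose A b : set (subgraph sigma) := [set c | pattern s c = b].
have sA b : sig [set` s] (A b).
  by apply: sig_depends_on => c c' cc' <-; rewrite /A /=; apply: pattern_eq => e /cc'.
have mA b : measurable (A b) by apply: sig_measurable (sA b) => e; exact: measurable_edge.
have fE c : f c = \sum_b f (of_pattern b) * \1_(A b) c.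
  rewrite (depends_on_pattern c df); apply: eq_bigr => b _; congr (_ * _).
  rewrite indicE; congr (_%:R); congr nat_of_bool.
  by apply/eqP/idP; rewrite inE.
have -> : (fun c => f c * \1_B c) =
   (fun c => \sum_b f (of_pattern b) * \1_(A b `&` B) c).
  apply/funext => c; rewrite fE mulr_suml; apply: eq_bigr => b _.
  by rewrite -mulrA; congr (_ * _); rewrite !indicE in_setI -natrM mulnb.
rewrite [X in mean P X * _](_ : f = (fun c => \sum_b f (of_pattern b) * \1_(A b) c)); last first.
  by apply/funext => c; exact: fE.
rewrite !mean_sum; first last.
- by move=> b; apply: bmeasZ; apply: bmeas_indic; first [exact: mA|exact: measurableI].
- by move=> b; apply: bmeasZ; apply: bmeas_indic; first [exact: mA|exact: measurableI].
rewrite mulr_suml; apply: eq_bigr => b _.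
rewrite !meanZ; [|exact: bmeas_indic|apply: bmeas_indic; exact: measurableI].
rewrite (mean_indic P (mA b)) (mean_indic P (measurableI _ _ (mA b) mB)).
rewrite -mulrA; congr (_ * _); apply: (indep_sig _ indP sS (sA b) sB) => e.
exact: measurable_edge.
Qed.

Section moments.
Context (p : R).
Hypothesis prb_edge : forall e : edge sigma, prb P [set c : subgraph sigma | c e] = p.

Lemma mean_mul_edge s (f : subgraph sigma -> R) e : depends_on s f -> e \notin s ->
  mean P (fun c => f c * (c e)%:R) = p * mean P f.
Proof.
move=> df es; rewrite mulrC -(prb_edge e) -(@mean_mul_indic s f [set e])//.
- congr mean; apply/funext => c; rewrite indicE; congr (_ * (nat_of_bool _)%:R).
  by apply/idP/idP; rewrite inE.
- by apply/seteqP; split=> // e' [/= e's ee']; rewrite -ee' e's in es.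
- exact: sig_edge.
Qed.

Variables (s : seq (edge sigma)) (a : edge sigma -> subgraph sigma -> bool).
Hypotheses (da : forall e, depends_on s (a e)).
Hypotheses (p0 : 0 <= p) (p1 : p <= 1).

Let A L c : R := \sum_(e <- L) (a e c)%:R.
Let S L (c : subgraph sigma) : R := \sum_(e <- L) (a e c)%:R * (c e)%:R.

Let dS L : depends_on (s ++ L) (S L).
Proof.
move=> c c' cc'; rewrite /S big_seq [RHS]big_seq; apply: eq_bigr => e eL.
rewrite (@da e c c') ?cc' ?mem_cat ?eL ?orbT// => e' es.
by rewrite cc'// mem_cat es.
Qed.

Let bS L : bmeas (S L).
Proof. exact: bmeas_depends_on (@dS L). Qed.

Let ba e : bmeas (fun c => (a e c)%:R : R).
Proof. by apply: (bmeas_depends_on (s := s)) => c c' cc'; rewrite (@da e c c'). Qed.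

Let bA L : bmeas (A L).
Proof. by apply: bmeas_sum => e; exact: ba. Qed.

Let bc (e : edge sigma) : bmeas (fun c : subgraph sigma => (c e)%:R : R).
Proof.
by apply: (bmeas_depends_on (s := [:: e])) => c c' cc'; rewrite cc'// mem_head.
Qed.

Let step e L (f : subgraph sigma -> R) n : e \notin s -> e \notin L ->
  depends_on s f ->
  mean P (fun c => f c * S L c ^+ n * ((a e c)%:R * (c e)%:R)) =
  p * mean P (fun c => f c * (a e c)%:R * S L c ^+ n).
Proof.
move=> es eL df.
rewrite -(@mean_mul_edge (s ++ L) (fun c => f c * (a e c)%:R * S L c ^+ n) e).
- by congr mean; apply/funext => c; lra.
- have sub : {subset s <= s ++ L} by move=> e' es'; rewrite mem_cat es'.
  move=> c c' cc'; rewrite (depends_on_sub sub df cc').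
  by rewrite (depends_on_sub sub (@da e) cc') (@dS L c c').
- by rewrite mem_cat negb_or es.
Qed.

Ltac bm := by do ?[apply: bmeasD|apply: bmeasM|exact: bmeas_cst|
  exact: bS|exact: ba|exact: bA|exact: bc|rewrite ?expr2 ?exprS].

Let meanA0 e L (f : subgraph sigma -> R) n :
  mean P (fun c => f c * A (e :: L) c ^+ n) =
  mean P (fun c => f c * ((a e c)%:R + A L c) ^+ n).
Proof. by congr mean; apply/funext => c; rewrite /A big_cons. Qed.

Let meanS0 e L (f : subgraph sigma -> R) n :
  mean P (fun c => f c * S (e :: L) c ^+ n) =
  mean P (fun c => f c * ((a e c)%:R * (c e)%:R + S L c) ^+ n).
Proof. by congr mean; apply/funext => c; rewrite /S big_cons. Qed.

Let mean_nil (f : subgraph sigma -> R) (g : edge sigma -> subgraph sigma -> R) n :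
  mean P (fun c => f c * (\sum_(e <- [::]) g e c) ^+ n.+1) = 0.
Proof.
rewrite -[RHS](mean_cst P 0); congr mean; apply/funext => c.
by rewrite big_nil expr0n mulr0.
Qed.

Let df_a f e : depends_on s f -> depends_on s (fun c => f c * (a e c)%:R : R).
Proof. by move=> df c c' cc'; rewrite (df c c')// (@da e c c'). Qed.

Lemma mean_thinned_sum f L : depends_on s f -> uniq L ->
  (forall e, e \in L -> e \notin s) ->
  mean P (fun c => f c * S L c ^+ 1) = p * mean P (fun c => f c * A L c ^+ 1).
Proof.
move=> df; have bf := bmeas_depends_on df.
elim: L => [_ _|e L IH /= /andP[eL uL] Ls].
  by rewrite !mean_nil mulr0.
have es : e \notin s by apply: Ls; rewrite mem_head.
have {}Ls e' : e' \in L -> e' \notin s by move=> e'L; apply: Ls; rewrite inE e'L orbT.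
rewrite meanS0 meanA0.
rewrite [X in mean P X](_ : _ = fun c =>
    f c * S L c ^+ 0 * ((a e c)%:R * (c e)%:R) + f c * S L c ^+ 1); last first.
  by apply/funext => c; lra.
rewrite [X in p * mean P X](_ : _ = fun c =>
    f c * (a e c)%:R * S L c ^+ 0 + f c * A L c ^+ 1); last first.
  by apply/funext => c; lra.
by rewrite !meanD; [rewrite step// IH// mulrDr| | | |]; bm.
Qed.

(** Given the edges of [s], [S L] is binomial with [A L] trials; this is its second moment, obtained
    by adding one fresh edge at a time. *)
Lemma mean_thinned_sum2 f L : depends_on s f -> uniq L ->
  (forall e, e \in L -> e \notin s) ->
  mean P (fun c => f c * S L c ^+ 2) =
  p ^+ 2 * mean P (fun c => f c * A L c ^+ 2) +
  (p - p ^+ 2) * mean P (fun c => f c * A L c ^+ 1).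
Proof.
move=> df; have bf := bmeas_depends_on df.
elim: L => [_ _|e L IH /= /andP[eL uL] Ls].
  by rewrite !mean_nil !mulr0 addr0.
have es : e \notin s by apply: Ls; rewrite mem_head.
have {}Ls e' : e' \in L -> e' \notin s by move=> e'L; apply: Ls; rewrite inE e'L orbT.
rewrite meanS0 !meanA0.
rewrite [X in mean P X](_ : _ = fun c =>
    f c * S L c ^+ 0 * ((a e c)%:R * (c e)%:R) +
    2 * (f c * S L c ^+ 1 * ((a e c)%:R * (c e)%:R)) + f c * S L c ^+ 2); last first.
  by apply/funext => c; case: (a e c); case: (c e) => /=; lra.
rewrite [X in p ^+ 2 * mean P X](_ : _ = fun c =>
    f c * (a e c)%:R * S L c ^+ 0 + 2 * (f c * (a e c)%:R * A L c ^+ 1)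
      + f c * A L c ^+ 2); last first.
  by apply/funext => c; case: (a e c) => /=; lra.
rewrite [X in (p - p ^+ 2) * mean P X](_ : _ = fun c =>
    f c * (a e c)%:R * S L c ^+ 0 + f c * A L c ^+ 1); last first.
  by apply/funext => c; lra.
rewrite !meanD; try bm.
rewrite !meanZ; try bm.
rewrite !step// IH// (mean_thinned_sum (@df_a _ e df))//.
by lra.
Qed.

(** The third moment of the same binomial variable, with the nonpositive corrections dropped. *)
Lemma mean_thinned_sum3 f L : depends_on s f -> (forall c, 0 <= f c) -> uniq L ->
  (forall e, e \in L -> e \notin s) ->
  mean P (fun c => f c * S L c ^+ 3) <=
  p ^+ 3 * mean P (fun c => f c * A L c ^+ 3) +
  3 * p ^+ 2 * mean P (fun c => f c * A L c ^+ 2) +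
  p * mean P (fun c => f c * A L c ^+ 1).
Proof.
move=> df f0; have bf := bmeas_depends_on df.
elim: L => [_ _|e L IH /= /andP[eL uL] Ls].
  by rewrite !mean_nil !mulr0 !addr0.
have es : e \notin s by apply: Ls; rewrite mem_head.
have {}Ls e' : e' \in L -> e' \notin s by move=> e'L; apply: Ls; rewrite inE e'L orbT.
rewrite meanS0 !meanA0.
rewrite [X in mean P X](_ : _ = fun c =>
    f c * S L c ^+ 0 * ((a e c)%:R * (c e)%:R) +
    3 * (f c * S L c ^+ 1 * ((a e c)%:R * (c e)%:R)) +
    3 * (f c * S L c ^+ 2 * ((a e c)%:R * (c e)%:R)) + f c * S L c ^+ 3); last first.
  by apply/funext => c; case: (a e c); case: (c e) => /=; lra.
rewrite [X in p ^+ 3 * mean P X](_ : _ = fun c =>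
    f c * (a e c)%:R * S L c ^+ 0 + 3 * (f c * (a e c)%:R * A L c ^+ 1)
      + 3 * (f c * (a e c)%:R * A L c ^+ 2)
      + f c * A L c ^+ 3); last first.
  by apply/funext => c; case: (a e c) => /=; lra.
rewrite [X in _ * p ^+ 2 * mean P X](_ : _ = fun c =>
    f c * (a e c)%:R * S L c ^+ 0 + 2 * (f c * (a e c)%:R * A L c ^+ 1)
      + f c * A L c ^+ 2); last first.
  by apply/funext => c; case: (a e c) => /=; lra.
rewrite [X in p * mean P X](_ : _ = fun c =>
    f c * (a e c)%:R * S L c ^+ 0 + f c * A L c ^+ 1); last first.
  by apply/funext => c; lra.
rewrite !meanD; try bm.
rewrite !meanZ; try bm.
have {}IH := IH uL Ls.
rewrite !step// (mean_thinned_sum (@df_a _ e df))//.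
rewrite (mean_thinned_sum2 (@df_a _ e df))//.
have A0 c : 0 <= A L c by apply: sumr_ge0.
have N1 : 0 <= mean P (fun c => f c * (a e c)%:R * S L c ^+ 0).
  by apply: mean_ge0 => c; rewrite expr0 mulr1 mulr_ge0.
have N2 : 0 <= mean P (fun c => f c * (a e c)%:R * A L c ^+ 1).
  by apply: mean_ge0 => c; rewrite expr1 mulr_ge0// mulr_ge0.
have N3 : 0 <= p ^+ 3 by rewrite exprn_ge0.
have N4 : 0 <= p ^+ 2 by rewrite exprn_ge0.
have := mulr_ge0 N3 N1; have := mulr_ge0 N4 N1; have := mulr_ge0 N3 N2.
by lra.
Qed.

End moments.
End finite_dependence.

(** * Decay of the critical survival probability *)

Section critical_survival.
Context {R : realType}.
Implicit Types (x y : R) (k n m : nat).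

Lemma bernoulli_ge y k : 0 <= y <= 1 -> 1 - k%:R * y <= (1 - y) ^+ k.
Proof.
move=> /andP[y0 y1]; elim: k => [|k IH]; first by rewrite expr0 mul0r subr0.
rewrite exprS -natr1.
have : (1 - y) * (1 - k%:R * y) <= (1 - y) * (1 - y) ^+ k by rewrite ler_wpM2l// subr_ge0.
have : 0 <= k%:R * (y * y) by rewrite !mulr_ge0.
by lra.
Qed.

Lemma bernoulli_le y k : 0 <= y <= 1 ->
  (1 - y) ^+ k <= 1 - k%:R * y + k%:R ^+ 2 * y ^+ 2.
Proof.
move=> /andP[y0 y1]; elim: k => [|k IH]; first by rewrite expr0; lra.
rewrite exprS -natr1.
have h1 : (1 - y) * (1 - y) ^+ k <= (1 - y) * (1 - k%:R * y + k%:R ^+ 2 * y ^+ 2).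
  by rewrite ler_wpM2l// subr_ge0.
have h2 : 0 <= k%:R * y ^+ 2 by rewrite mulr_ge0// exprn_ge0.
have h3 : 0 <= k%:R ^+ 2 * y ^+ 3 by rewrite mulr_ge0// exprn_ge0.
have h4 : 0 <= y ^+ 2 by rewrite exprn_ge0.
by lra.
Qed.

(** The quadratic term, available from k = 2 on, is what drives the critical survival probability to
    0. *)
Lemma bernoulli_ge2 y k : 0 <= y <= 1 -> (2 <= k)%N ->
  1 - k%:R * y + y ^+ 2 <= (1 - y) ^+ k.
Proof.
move=> y01; case: k => [|[|j]]// _;
have -> : (1 - y) ^+ j.+2 = (1 - y) * (1 - y) * (1 - y) ^+ j by rewrite !exprS mulrA.
rewrite -!natr1; have := bernoulli_ge j y01; case/andP: y01 => y0 y1 hj.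
have h1 : (1 - y) * (1 - y) * (1 - j%:R * y) <= (1 - y) * (1 - y) * (1 - y) ^+ j.
  by rewrite ler_wpM2l// mulr_ge0// subr_ge0.
have h2 : 0 <= j%:R * y ^+ 2 * (2 - y).
  by rewrite mulr_ge0 ?mulr_ge0 ?exprn_ge0//; lra.
by lra.
Qed.

Context (sigma : nat).
Hypothesis sigma2 : (2 <= sigma)%N.
Let q n : R := survp sigma sigma%:R^-1 n.

Let s0 : 0 < sigma%:R :> R.
Proof. by rewrite ltr0n (leq_trans _ sigma2). Qed.

Let q01 n : 0 < q n <= 1.
Proof.
elim: n => [|n /andP[q0 q1]]; first by rewrite /q /= ltr01 lexx.
have y1 : sigma%:R^-1 * q n <= 1.
  by rewrite mulr_ile1 ?invr_ge0 ?(ltW s0) ?(ltW q0)// invf_le1// ler1n (leq_trans _ sigma2).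
have y0 : 0 < sigma%:R^-1 * q n by rewrite mulr_gt0 ?invr_gt0.
rewrite /q /= -/(q n); move: y0 y1; set y := _ * q n => y0 y1.
have z0 : 0 <= 1 - y by rewrite subr_ge0.
have z1 : 1 - y < 1 by rewrite ltrBlDr ltrDl.
have z2 : (1 - y) ^+ sigma < 1 by rewrite exprn_ilt1// -lt0n (leq_trans _ sigma2).
have z3 : 0 <= (1 - y) ^+ sigma by rewrite exprn_ge0.
by apply/andP; split; lra.
Qed.

Let y01 n : 0 <= sigma%:R^-1 * q n <= 1.
Proof.
have /andP[q0 q1] := q01 n; rewrite mulr_ge0 ?invr_ge0 ?(ltW s0) ?(ltW q0)//=.
by rewrite mulr_ile1 ?invr_ge0 ?(ltW s0) ?(ltW q0)// invf_le1// ler1n (leq_trans _ sigma2).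
Qed.

Let qS_le n : q n.+1 <= q n - (sigma%:R^-1 * q n) ^+ 2.
Proof.
rewrite {1}/q /= -/(q n); have := bernoulli_ge2 (y01 n) sigma2.
by rewrite mulrA divff ?gt_eqF// mul1r; lra.
Qed.

Let qS_ge n : q n * (1 - q n) <= q n.+1.
Proof.
rewrite {3}/q /= -/(q n); have := bernoulli_le sigma (y01 n).
have -> : sigma%:R ^+ 2 * (sigma%:R^-1 * q n) ^+ 2 = q n ^+ 2.
  by rewrite -exprMn mulrA divff ?gt_eqF// mul1r.
by rewrite mulrA divff ?gt_eqF// mul1r; lra.
Qed.

(** Discrete counterpart of q' = - q^2 / K with q 0 = 1, whose solution is K / (n + K), for K =
    sigma^2. *)
Let q_bound n : q n * (n%:R + sigma%:R ^+ 2) <= sigma%:R ^+ 2.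
Proof.
set K := sigma%:R ^+ 2; have K0 : 0 < K by rewrite exprn_gt0.
elim: n => [|n IH]; first by rewrite add0r ler_piMl ?(ltW K0)//; case/andP: (q01 0).
have /andP[x0 x1] := q01 n.
have xS : q n.+1 <= q n - q n ^+ 2 / K.
  by have := qS_le n; rewrite exprMn exprVn mulrC.
have w0 : 0 <= n.+1%:R + K by rewrite addr_ge0// ltW.
apply: (le_trans (ler_wpM2r w0 xS)); move: IH; rewrite -natr1.
set x := q n in x0 x1 *; set w := n%:R + K => IH.
have -> : (x - x ^+ 2 / K) * (n%:R + 1 + K) = ((K - x) * (x * w + x)) / K.
  have -> : (x - x ^+ 2 / K) = (K - x) * x / K.
    rewrite [X in _ = X / K]mulrBl [RHS]mulrBl expr2; congr (_ - _).
    by rewrite mulrAC divff ?gt_eqF// mul1r.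
  by rewrite /w; lra.
rewrite ler_pdivrMr//.
have K1 : 1 <= K by rewrite exprn_ege1// ler1n (leq_trans _ sigma2).
have : (K - x) * (x * w + x) <= (K - x) * (K + x).
  by rewrite ler_wpM2l ?lerD2r//; lra.
have := sqr_ge0 x; by lra.
Qed.

Lemma critical_survp_cvg0 : q n @[n --> \oo] --> (0 : R).
Proof.
apply/cvgrPdist_lt => e e0; near=> n.
have /andP[x0 x1] := q01 n; rewrite sub0r normrN gtr0_norm//.
have h := q_bound n; rewrite -(ltr_pM2r (_ : 0 < n%:R + sigma%:R ^+ 2)); last first.
  by rewrite ltr_wpDl// exprn_gt0.
apply: (le_lt_trans h).
have : sigma%:R ^+ 2 / e < n%:R by near: n; exact: nbhs_infty_gtr.
rewrite ltr_pdivrMr// => h2.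
have : 0 < e * sigma%:R ^+ 2 by rewrite mulr_gt0// exprn_gt0.
by lra.
Unshelve. all: by end_near. Qed.

(** One more generation multiplies [q n] by a factor between 1 - q n and 1, and [q n] tends to 0. *)
Lemma critical_survp_ratio m : q n / q (m + n)%N @[n --> \oo] --> (1 : R).
Proof.
elim: m => [|m IH].
  rewrite (_ : (fun n => _) = fun=> 1); first exact: cvg_cst.
  by apply/funext => n; rewrite divff// gt_eqF//; case/andP: (q01 n).
have h : q n.+1 / q n @[n --> \oo] --> (1 : R).
  have c1 : 1 - q n @[n --> \oo] --> (1 : R).
    by rewrite -[X in _ --> X]subr0; apply: cvgB; [exact: cvg_cst|exact: critical_survp_cvg0].
  apply: (@squeeze_cvgr _ _ _ _ (fun n => 1 - q n) (fun=> 1)) => //; [|exact: cvg_cst]; apply: nearW => n.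
  have /andP[x0 x1] := q01 n; rewrite ler_pdivlMr// ler_pdivrMr// mul1r mulrC qS_ge/=.
  by apply: (le_trans (qS_le n)); rewrite lerBlDr lerDl sqr_ge0.
have h' : q n / q n.+1 @[n --> \oo] --> (1 : R).
  rewrite -[X in _ --> X]invr1; under eq_fun do rewrite -invf_div.
  by apply: cvgV => //; rewrite oner_neq0.
have h2 : q (m + n)%N / q (m + n).+1 @[n --> \oo] --> (1 : R).
  by have := h'; rewrite -(cvg_shiftn m); under eq_fun do rewrite addnC.
rewrite -[X in _ --> X]mulr1.
rewrite (_ : (fun n => _) = fun n => q n / q (m + n)%N * (q (m + n)%N / q (m + n).+1)).
  exact: cvgM.
apply/funext => n; rewrite addSn mulrA mulfVK// gt_eqF//.
by case/andP: (q01 (m + n)).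
Qed.

(** Among k independent trees one survives with probability equivalent to k q n. This limit is the
    origin of the size bias of the incipient cluster. *)
Lemma critical_survp_forest m k :
  (1 - (1 - q n) ^+ k) / q (m + n)%N @[n --> \oo] --> (k%:R : R).
Proof.
have h : (1 - (1 - q n) ^+ k) / q n @[n --> \oo] --> (k%:R : R).
  have c1 : k%:R - k%:R ^+ 2 * q n @[n --> \oo] --> (k%:R : R).
    rewrite -[X in _ --> X]subr0; apply: cvgB; first exact: cvg_cst.
    rewrite -[X in _ --> X](mulr0 (k%:R ^+ 2)); apply: cvgMr.
    exact: critical_survp_cvg0.
  apply: (@squeeze_cvgr _ _ _ _ (fun n => k%:R - k%:R ^+ 2 * q n) (fun=> k%:R)) => //; [|exact: cvg_cst]; apply: nearW => n.
  have /andP[x0 x1] := q01 n; rewrite ler_pdivlMr// ler_pdivrMr//.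
  have x01 : 0 <= q n <= 1 by rewrite x1 ltW.
  have := bernoulli_ge k x01; have := bernoulli_le k x01.
  by move=> a b; apply/andP; split; lra.
rewrite -[X in _ --> X]mulr1.
rewrite (_ : (fun n => _) = fun n => (1 - (1 - q n) ^+ k) / q n * (q n / q (m + n)%N)).
  by apply: cvgM => //; exact: critical_survp_ratio.
by apply/funext => n; rewrite mulrA mulfVK// gt_eqF//; case/andP: (q01 n).
Qed.

End critical_survival.

(** * The incipient infinite cluster *)

Section incipient_infinite_cluster.
Context {R : realType} {sigma : nat}.
Hypothesis sigma2 : (2 <= sigma)%N.
Context (Ppc Pinf : probability (subgraph sigma) R).
Hypothesis perc : is_bond_percolation (sigma%:R^-1) Ppc.
Hypothesis iic : is_iic_law Ppc Pinf.
Local Notation pc := (sigma%:R^-1 : R).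
Local Notation Z := (@population sigma R).
Local Notation q := (survp sigma pc).
Implicit Types (f : subgraph sigma -> R).

Let s0 : 0 < sigma%:R :> R.
Proof. by rewrite ltr0n (leq_trans _ sigma2). Qed.

Let prb_edge (e : edge sigma) : prb Ppc [set c : subgraph sigma | c e] = pc.
Proof. by rewrite /prb perc.1. Qed.

Let ind := perc.2.

Let mX (e : edge sigma) := @measurable_edge sigma e.

Let prb_surv_c k v : prb Ppc [set c : subgraph sigma | surv c k v] = q k.
Proof.
apply: (@prb_surv _ _ _ Ppc _ _ sigma (fun e c => c e) mX ind (fun e c => c e)) => // e.
exact: sig_edge.
Qed.

Let sig_surv_c k v : sig (fun (e : edge sigma) (c : subgraph sigma) => c e) (below v)
  [set c : subgraph sigma | surv c k v].
Proof. by apply: (sig_surv (o := fun e (c : subgraph sigma) => c e)) => e; exact: sig_edge. Qed.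

(** Once the cluster is known up to height m, reaching height m + k means that one of its vertices
    at height m survives k generations, and their subtrees are disjoint and independent of the
    pattern. *)
Lemma prb_cluster_reaches m k (b : (size (@shallow sigma m)).-tuple bool) :
  prb Ppc ((@open_cluster sigma @^-1` [set c | pattern (shallow m) c = b]) `&`
           reaches_height (m + k)) =
  prb Ppc (@open_cluster sigma @^-1` [set c | pattern (shallow m) c = b]) *
  (1 - (1 - q k) ^+ count (open_to (of_pattern b)) (level m)).
Proof.
set B := _ @^-1` _.
pose V := [seq v <- level m | open_to (of_pattern b) v].
pose D := [set c : subgraph sigma | forall v, v \in V -> (~` [set c | surv c k v]) c].
have openB (c : subgraph sigma) v : B c -> v \in level m ->
    open_to (of_pattern b) v = open_to c v.
  move=> <- vm; rewrite -[RHS]open_to_cluster; apply: eq_open_to => e ev.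
  have em : e \in shallow m by rewrite mem_shallow; move: vm ev; rewrite mem_level => /eqP ->.
  exact: patternK em.
have -> : B `&` reaches_height (m + k) = B `&` ~` D.
  apply/seteqP; split=> c.
    move=> [Bc /reaches_heightP/surv_level[v vm /andP[ov sv]]]; split=> // /(_ v).
    by rewrite mem_filter vm andbT (openB c)// => /(_ ov); exact.
  move=> [Bc /existsNP[v /not_implyP[vV /contrapT sv]]]; split=> //.
  move: vV; rewrite mem_filter => /andP[ov vm]; apply/reaches_heightP/surv_level.
  by exists v => //; rewrite -(openB c)// ov.
have sB : sig (fun (e : edge sigma) (c : subgraph sigma) => c e) [set` shallow m] B.
  apply: sig_depends_on => c c' cc'; rewrite /B /= => <-; apply/pattern_eq => e.
  rewrite mem_shallow => em; rewrite !open_clusterE; apply: eq_open_to => e'.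
  rewrite /= ltnS => ee'; rewrite cc'// mem_shallow.
  exact: leq_ltn_trans ee' em.
have mv v : v \in V -> size v = m.
  by rewrite mem_filter mem_level => /andP[_ /eqP].
have sD : sig (fun (e : edge sigma) (c : subgraph sigma) => c e)
    [set e | exists2 v, v \in V & below v e] D.
  apply: sig_bigcap_seq => v vV; apply: sigC; apply: (sig_sub (@sig_surv_c k v)) => e bv.
  by exists v.
rewrite (indep_sig mX ind _ sB (sigC sD)); last first.
  apply/seteqP; split=> // e [/= em [v vV be]].
  by move: (below_size be); rewrite (mv _ vV) leqNgt -mem_shallow em.
congr (_ * _); rewrite prbC; last exact: (sig_measurable mX sD).
congr (1 - _).
have -> : prb Ppc D = \prod_(v <- V) prb Ppc (~` [set c : subgraph sigma | surv c k v]).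
  apply: (prb_disjoint_sig mX ind (S := @below sigma)).
  - by rewrite filter_uniq// level_uniq.
  - move=> u v uV vV uv; apply/seteqP; split=> // e [[x ex] [y ey]].
    move: uv; suff -> : u = v by rewrite eqxx.
    have : size u = size v by rewrite (mv _ uV) (mv _ vV).
    have xy : x ++ u = y ++ v by rewrite -ex -ey.
    move=> uv; have sxy : size x = size y.
      by move: (congr1 size xy); rewrite !size_cat uv => /addIn.
    by move/eqP: xy; rewrite eqseq_cat// => /andP[_ /eqP].
  - by move=> v; apply: sigC; exact: sig_surv_c.
rewrite (eq_bigr (fun=> 1 - q k)); last first.
  move=> v _; rewrite prbC ?prb_surv_c//.
  exact: (sig_measurable mX (sig_surv_c k v)).
by rewrite big_const_seq count_predT size_filter iter_mulr mulr1.
Qed.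

Lemma iic_pattern m (b : (size (@shallow sigma m)).-tuple bool) :
  prb Pinf [set c | pattern (shallow m) c = b] =
  prb Ppc (@open_cluster sigma @^-1` [set c | pattern (shallow m) c = b]) *
  Z m (of_pattern b).
Proof.
set A := [set c | _].
have cA : cylinder A.
  by exists (shallow m) => c c' cc'; rewrite /A /= => <-; apply: pattern_eq => e /cc'.
have := iic cA; rewrite -/(prb Pinf A) -(cvg_shiftn m) => h1.
set z := count (open_to (of_pattern b)) (level m).
have ZE : Z m (of_pattern b) = z%:R.
  rewrite /population /z -sum1_count natr_sum [RHS]big_mkcond.
  by apply: eq_bigr => v _; case: open_to.
have h2 : cond_probability Ppc (@open_cluster sigma @^-1` A) (reaches_height (k + m))
    @[k --> \oo] --> prb Ppc (@open_cluster sigma @^-1` A) * Z m (of_pattern b).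
  rewrite ZE (_ : (fun k => _) = fun k => prb Ppc (@open_cluster sigma @^-1` A) *
      ((1 - (1 - q k) ^+ z) / q (m + k)%N)).
    by apply: cvgMr; exact: critical_survp_forest.
  apply/funext => k; rewrite /cond_probability -!/(prb _ _) addnC.
  rewrite prb_cluster_reaches -mulrA; congr (_ * (_ / _)).
  rewrite -(prb_surv_c (m + k) [::]); congr prb.
  by apply/seteqP; split=> c; rewrite reaches_heightP.
exact: cvg_unique h1 h2.
Qed.

Lemma mean_iic m f : depends_on (shallow m) f ->
  mean Pinf f = mean Ppc (fun c => f (open_cluster c) * Z m c).
Proof.
move=> df.
pose A b : set (subgraph sigma) := [set c | pattern (shallow m) c = b].
have mA b : measurable (A b).
  by apply: (measurable_depends_on (s := shallow m)) => c c' cc'; rewrite /A /= => <-; apply: pattern_eq => e /cc'.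
have mB b : measurable (@open_cluster sigma @^-1` A b).
  apply: (measurable_depends_on (s := shallow m)) => c c' cc'; rewrite /A /= => <-.
  apply: pattern_eq => e em.
  have de : depends_on (shallow m) (fun c : edge sigma -> bool => c e).
    by move=> d d' dd'; rewrite dd'.
  exact/esym/(depends_on_cluster de cc').
have fE c : f c = \sum_b f (of_pattern b) * \1_(A b) c.
  rewrite (depends_on_pattern c df); apply: eq_bigr => b _; congr (_ * _).
  rewrite indicE; congr (_%:R); congr nat_of_bool.
  by apply/eqP/idP; rewrite inE.
rewrite (_ : f = (fun c => \sum_b f (of_pattern b) * \1_(A b) c)); last first.
  by apply/funext => c; exact: fE.
rewrite mean_sum; last by move=> b; apply: bmeasZ; exact: bmeas_indic.
rewrite [X in mean Ppc X](_ : _ = fun c => \sum_b (f (of_pattern b) * Z m (of_pattern b)) *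
    \1_(@open_cluster sigma @^-1` A b) c); last first.
  apply/funext => c; rewrite mulr_suml; apply: eq_bigr => b _.
  have AB : (open_cluster c \in A b) = (c \in @open_cluster sigma @^-1` A b).
    by apply/idP/idP; rewrite !inE.
  rewrite !indicE AB; case: (boolP (c \in _)) => [|_]; last by rewrite !mulr0 mul0r.
  rewrite inE /= !mulr1 /A /= => <-; congr (_ * _).
  rewrite -population_cluster; apply: depends_on_population => e es.
  exact/esym/patternK.
rewrite mean_sum; last by move=> b; apply: bmeasZ; exact: bmeas_indic.
apply: eq_bigr => b _; rewrite !meanZ ?mean_indic//; try exact: bmeas_indic.
by rewrite iic_pattern mulrCA mulrC.
Qed.

Let mean_iic_pow m n f : depends_on (shallow m) f ->
  mean Pinf (fun c => f c * Z m c ^+ n) =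
  mean Ppc (fun c => f (open_cluster c) * Z m c ^+ n.+1).
Proof.
move=> df; rewrite (@mean_iic m); last first.
  by move=> c c' cc'; rewrite (df c c')// (@depends_on_population _ _ _ c c').
congr mean; apply/funext => c.
by rewrite population_cluster -mulrA -exprSr.
Qed.

(** The test of membership in [level_edges m] makes this a function of [shallow m] for every edge,
    as the moment lemmas require. *)
Let attached m (e : edge sigma) (c : subgraph sigma) :=
  (e \in level_edges m) && open_to c e.1.

Let dep_attached m e : depends_on (shallow m) (attached m e).
Proof.
move=> c c' cc'; rewrite /attached; case: (boolP (_ \in _)) => //=.
rewrite mem_level_edges => /eqP em.
by rewrite (@depends_on_open_to _ e.1 c c')// em.
Qed.

Let level_edgesN m e : e \in @level_edges sigma m -> e \notin @shallow sigma m.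
Proof. by rewrite mem_level_edges mem_shallow => /eqP ->; rewrite ltnn. Qed.

Let mean_thinned m n f : mean Ppc (fun c => f c * Z m.+1 c ^+ n) =
  mean Ppc (fun c => f c * (\sum_(e <- level_edges m) (attached m e c)%:R * (c e)%:R) ^+ n).
Proof.
congr mean; apply/funext => c; rewrite populationS big_seq [in RHS]big_seq.
by congr (_ * _ ^+ _); apply: eq_bigr => e em; rewrite /attached em.
Qed.

Let mean_attached m n f : depends_on (shallow m) f ->
  mean Ppc (fun c => f c * (\sum_(e <- level_edges m) (attached m e c)%:R) ^+ n) =
   sigma%:R ^+ n * mean Ppc (fun c => f c * Z m c ^+ n).
Proof.
move=> df; rewrite -meanZ.
  congr mean; apply/funext => c; rewrite mulrCA -exprMn -sum_level_edges.
  rewrite big_seq [in RHS]big_seq.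
  by congr (_ * _ ^+ _); apply: eq_bigr => e em; rewrite /attached em.
apply: (bmeas_depends_on (s := shallow m)) => c c' cc'.
by rewrite (df c c')// (@depends_on_population _ _ _ c c').
Qed.

(** The size bias turns this into a second moment under [Ppc]. As sigma pc = 1, the binomial
    variance contributes sigma (pc - pc^2) = 1 - pc, which is also the mean number of open children
    off the backbone. *)
Lemma mean_iic_populationS m f : depends_on (shallow m) f ->
  mean Pinf (fun c => f c * Z m.+1 c) =
  mean Pinf (fun c => f c * Z m c) + (1 - pc) * mean Pinf f.
Proof.
move=> df; have dfc := depends_on_cluster df.
have -> : mean Pinf (fun c => f c * Z m.+1 c) = mean Pinf (fun c => f c * Z m.+1 c ^+ 1) by [].
rewrite (mean_iic_pow _ (leq_depends_on (leqnSn m) df)).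
rewrite -[mean Pinf (fun c => f c * Z m c)]/(mean Pinf (fun c => f c * Z m c ^+ 1)).
rewrite (mean_iic_pow _ df) (mean_iic df) (mean_thinned m 2 (f \o @open_cluster sigma)).
rewrite (mean_thinned_sum2 ind prb_edge (@dep_attached m) dfc (level_edges_uniq m) (@level_edgesN m)).
rewrite !mean_attached// mulrA -exprMn mulVf ?gt_eqF// expr1n mul1r expr1.
congr (_ + _).
by rewrite mulrA mulrBl mulVf ?gt_eqF// expr2 mulfVK ?gt_eqF.
Qed.

(** Here the size bias leads to a third moment. An upper bound is enough, since it only serves to
    control the truncation. *)
Lemma mean_iic_population2S m f : depends_on (shallow m) f -> (forall c, 0 <= f c) ->
  mean Pinf (fun c => f c * Z m.+1 c ^+ 2) <=
  mean Pinf (fun c => f c * Z m c ^+ 2) + 3 * mean Pinf (fun c => f c * Z m c) + mean Pinf f.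
Proof.
move=> df f0; have dfc := depends_on_cluster df.
rewrite (mean_iic_pow _ (leq_depends_on (leqnSn m) df)) (mean_iic_pow _ df).
rewrite -[mean Pinf (fun c => f c * Z m c)]/(mean Pinf (fun c => f c * Z m c ^+ 1)).
rewrite (mean_iic_pow _ df) (mean_iic df) (mean_thinned m 3 (f \o @open_cluster sigma)).
have fc0 c : 0 <= (f \o @open_cluster sigma) c by exact: f0.
have pc0 : 0 <= pc by rewrite invr_ge0 ltW.
apply: (le_trans (mean_thinned_sum3 ind prb_edge (@dep_attached m) pc0 dfc fc0
  (level_edges_uniq m) (@level_edgesN m))).
rewrite !mean_attached//.
have h n x : pc ^+ n * (sigma%:R ^+ n * x) = x.
  by rewrite mulrA -exprMn mulVf ?gt_eqF// expr1n mul1r.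
by rewrite h -[3 * _ * _]mulrA h -[X in _ + X * _]expr1 h.
Qed.

Lemma iic_population_gap n f : depends_on (shallow n) f -> (forall c, 0 <= f c) ->
  forall e, 0 < e ->
  \forall m \near \oo, 7 / 8 * (1 - pc) * mean Pinf f - e <=
    mean Pinf (fun c => f c * Num.min (Z m c / m%:R) 8).
Proof.
move=> df f0 e e0.
set M := mean Pinf f; have M0 : 0 <= M by exact: mean_ge0.
set M1 := mean Pinf (fun c => f c * Z n c).
have M10 : 0 <= M1 by apply: mean_ge0 => c; rewrite mulr_ge0// population_ge0.
set M2 := mean Pinf (fun c => f c * Z n c ^+ 2).
have M20 : 0 <= M2 by apply: mean_ge0 => c; rewrite mulr_ge0// exprn_ge0// population_ge0.
have pc2 : pc <= 2^-1 by rewrite lef_pV2 ?posrE// ler_nat.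
have pc0 : 0 < pc by rewrite invr_gt0.
have dfk k : depends_on (shallow (n + k)) f by apply: leq_depends_on df; rewrite leq_addr.
have m1 k : mean Pinf (fun c => f c * Z (n + k)%N c) = M1 + k%:R * (1 - pc) * M.
  elim: k => [|k IH]; first by rewrite addn0 !mul0r addr0.
  by rewrite addnS mean_iic_populationS// IH -natr1 -/M; lra.
have m2 k : mean Pinf (fun c => f c * Z (n + k)%N c ^+ 2) <=
    M2 + k%:R * (3 * M1 + M) + 2 * k%:R ^+ 2 * M.
  elim: k => [|k IH]; first by rewrite addn0 !mul0r expr0n mulr0 mul0r !addr0.
  rewrite addnS (le_trans (mean_iic_population2S (dfk k) f0))// m1 -natr1 -/M.
  have h0 : 0 <= k%:R * M by rewrite mulr_ge0.
  have h1 : 0 <= k%:R * M * pc by rewrite mulr_ge0// ltW.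
  by lra.
(* Collects the terms of order at most m after multiplication by m^2; they are below e m^2 as soon
   as m > Q / e. *)
pose Q := (1 - pc) * n%:R * M + M2 + 3 * M1 + M.
have Q0 : 0 <= Q by rewrite /Q !addr_ge0// ?mulr_ge0//; lra.
near=> m.
have m0 : 0 < m%:R :> R by rewrite ltr0n; near: m; exact: nbhs_infty_gt.
have mQ : Q / e < m%:R by near: m; exact: nbhs_infty_gtr.
have nm : (n <= m)%N by near: m; exact: nbhs_infty_ge.
have := m1 (m - n)%N; have := m2 (m - n)%N; rewrite subnKC// natrB// => h2 h1.
have dZ : depends_on (shallow m) (Z m) by exact: depends_on_population.
have dfm : depends_on (shallow m) f by apply: leq_depends_on df.
have b1 : bmeas (fun c : subgraph sigma => f c * Z m c).
  by apply: (bmeas_depends_on (s := shallow m)) => c c' cc'; rewrite (dfm c c')// (dZ c c').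
have b2 : bmeas (fun c : subgraph sigma => f c * Z m c ^+ 2).
  by apply: (bmeas_depends_on (s := shallow m)) => c c' cc'; rewrite (dfm c c')// (dZ c c').
have b3 : bmeas (fun c : subgraph sigma => f c * Num.min (Z m c / m%:R) 8).
  by apply: (bmeas_depends_on (s := shallow m)) => c c' cc'; rewrite (dfm c c')// (dZ c c').
(* The parabola x - x^2 / 32 has maximum 8, so it lies below the truncated x. The second moment of
   Z_m / m being asymptotically at most 2 M, the loss is M / 16, which is at most (1 - pc) M / 8
   because pc <= 1 / 2. *)
apply: (@le_trans _ _ (m%:R^-1 * mean Pinf (fun c => f c * Z m c) -
    (32 * m%:R ^+ 2)^-1 * mean Pinf (fun c => f c * Z m c ^+ 2))); last first.
  rewrite -!meanZ// -meanB; [|exact: bmeasZ|exact: bmeasZ].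
  apply: le_mean => // [|c]; first by apply: bmeasB; exact: bmeasZ.
  rewrite invfM -exprVn; set x := Z m c / m%:R.
  have -> : m%:R^-1 * (f c * Z m c) - 32^-1 * m%:R^-1 ^+ 2 * (f c * Z m c ^+ 2) =
    f c * (x - x ^+ 2 / 32) by rewrite /x; lra.
  rewrite ler_wpM2l// le_min; have := sqr_ge0 x; have := sqr_ge0 (x - 16).
  by move=> a b; apply/andP; split; lra.
rewrite h1; set k := m%:R in m0 mQ h1 h2 *; set j := n%:R in h1 h2 *.
have j0 : 0 <= j by rewrite /j.
have jk : j <= k by rewrite /j /k ler_nat.
have k1 : 1 <= k by move: m0; rewrite /k ltr0n ler1n.
rewrite -(ler_pM2r (_ : 0 < k ^+ 2)) ?exprn_gt0//.
have -> : (k^-1 * (M1 + (k - j) * (1 - pc) * M) -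
    (32 * k ^+ 2)^-1 * mean Pinf (fun c => f c * Z m c ^+ 2)) * k ^+ 2 =
    k * (M1 + (k - j) * (1 - pc) * M) - mean Pinf (fun c => f c * Z m c ^+ 2) / 32.
  rewrite mulrBl; congr (_ - _).
    by rewrite mulrAC; congr (_ * _); rewrite expr2 mulKf ?gt_eqF.
  rewrite invfM mulrAC mulfVK; first exact: mulrC.
  by rewrite gt_eqF// exprn_gt0.
have ek : Q * k <= e * k ^+ 2.
  rewrite expr2 mulrA ler_pM2r// ltW//.
  by move: mQ; rewrite ltr_pdivrMr// mulrC.
move: h2; set W := mean _ _ => h2.
have a1 : 0 <= k * M1 by rewrite mulr_ge0// ltW.
have a2 : (k - j) * (3 * M1 + M) <= k * (3 * M1 + M).
  by rewrite ler_wpM2r ?addr_ge0 ?mulr_ge0//; lra.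
have a3 : (k - j) ^+ 2 * M <= k ^+ 2 * M.
  by rewrite ler_wpM2r// lerXn2r ?nnegrE ?subr_ge0//; lra.
have a4 : M2 <= k * M2 by rewrite ler_peMl.
have a5 : 0 <= (1 - pc - 2^-1) * (k ^+ 2 * M).
  by rewrite mulr_ge0 ?mulr_ge0 ?exprn_ge0//; lra.
have a6 : 0 <= k * M2 by rewrite mulr_ge0// ltW.
have a7 : 0 <= k * M by rewrite mulr_ge0// ltW.
move: ek; rewrite /Q; lra.
Unshelve. all: by end_near. Qed.

End incipient_infinite_cluster.

(** * Invasion percolation for fixed weights *)

Section invasion_path.
Context {R : realType} {sigma : nat}.
Implicit Types (w : edge sigma -> R) (E : seq (edge sigma)) (e f : edge sigma)
  (v x y : vertex sigma).

(** For such sets [boundary] takes the usual form, parent inside and child outside, and membership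
    of a vertex passes to its ancestors. *)
Definition rooted E := forall i v, i :: v \in vertices E -> (v, i) \in E.

Lemma root_vertices E : [::] \in vertices E.
Proof. by rewrite /vertices mem_head. Qed.

Lemma verticesP E v : reflect (v = [::] \/ exists2 e, e \in E & v = parent_end e \/ v = child_end e)
  (v \in vertices E).
Proof.
rewrite /vertices inE mem_cat; apply: (iffP idP).
  case/orP => [/eqP|/orP[/mapP[e eE ->]|/mapP[e eE ->]]]; first by left.
    by right; exists e => //; left.
  by right; exists e => //; right.
case=> [->|[e eE [->|->]]]; rewrite ?eqxx// ?map_f ?orbT//.
Qed.

Lemma parent_vertices E e : e \in E -> parent_end e \in vertices E.
Proof. by move=> eE; apply/verticesP; right; exists e => //; left. Qed.

Lemma child_vertices E e : e \in E -> child_end e \in vertices E.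
Proof. by move=> eE; apply/verticesP; right; exists e => //; right. Qed.

Lemma sub_vertices E E' : {subset E <= E'} -> {subset vertices E <= vertices E'}.
Proof.
move=> EE' v /verticesP[->|[e /EE' eE' [->|->]]]; first exact: root_vertices.
  exact: parent_vertices.
exact: child_vertices.
Qed.

Lemma rooted_suffix E z y : rooted E -> z ++ y \in vertices E -> y \in vertices E.
Proof. by move=> rE; elim: z => [//|i z IH] /= /rE/parent_vertices; exact: IH. Qed.

Lemma rooted_boundary E e : rooted E ->
  boundary E e = (parent_end e \in vertices E) && (child_end e \notin vertices E).
Proof.
move=> rE; rewrite /boundary; case: (boolP (child_end e \in _)) => [|_]; last by rewrite addbF andbT.
by case: e => v i /rE/parent_vertices /= ->.
Qed.

Lemma rooted_cons E e : rooted E -> boundary E e -> rooted (e :: E).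
Proof.
move=> rE; rewrite rooted_boundary// => /andP[pe _] i v.
case/verticesP => [//|[f]]; rewrite inE => /orP[/eqP -> [iv|]|fE fv].
- by rewrite inE rE ?orbT// iv.
- by case: (e) => u j [-> ->]; rewrite mem_head.
- rewrite inE rE ?orbT//; apply/verticesP; right; exists f => //.
Qed.

(** The stalled step is kept as an alternative instead of being excluded; the facts on the invasion
    below hold in that case too. *)
Lemma invadeP w E : invade w E = E \/
  exists2 e, Defs.smallest w E e & invade w E = e :: E.
Proof.
rewrite /invade; case: xgetP => [b _ [f sf <-]|_]; last by left.
by right; exists f.
Qed.

Lemma invasionS w N : invasion w N.+1 = invade w (invasion w N).
Proof. by rewrite /invasion iterS. Qed.

Lemma rooted_invasion w N : rooted (invasion w N).
Proof.
elim: N => [|N IH]; first by move=> i v /verticesP[//|[]].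
rewrite invasionS; case: (invadeP w (invasion w N)) => [->//|[e [be _] ->]].
exact: rooted_cons.
Qed.

Lemma sub_invasionS w N : {subset invasion w N <= invasion w N.+1}.
Proof.
move=> e eN; rewrite invasionS; case: (invadeP w (invasion w N)) => [->//|[f _ ->]].
by rewrite inE eN orbT.
Qed.

Lemma sub_invasion w M N : (M <= N)%N -> {subset invasion w M <= invasion w N}.
Proof.
move=> /subnK <-; elim: (N - M)%N => [//|k IH] e eM.
by rewrite addSn; apply: sub_invasionS; exact: IH.
Qed.

Lemma size_invasion w N v : v \in vertices (invasion w N) -> (size v <= N)%N.
Proof.
elim: N v => [|N IH] v; first by case/verticesP => [->|[]].
rewrite invasionS; case: (invadeP w (invasion w N)) => [->|[e [be _] ->]].
  by move=> /IH /leqW.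
move: be; rewrite rooted_boundary; last exact: rooted_invasion.
move=> /andP[pe _] /verticesP[->//|[f]]; rewrite inE => /orP[/eqP ->|fN].
  by case=> ->; rewrite /child_end /= ?ltnS ?(leqW (IH _ pe))// IH.
by case=> ->; apply: leqW; apply: IH; [exact: parent_vertices|exact: child_vertices].
Qed.

Lemma invasion_step w N e : e \in invasion w N ->
  exists j, [/\ (j < N)%N, Defs.smallest w (invasion w j) e & e \in invasion w j.+1].
Proof.
elim: N => [//|N IH]; rewrite invasionS.
case: (invadeP w (invasion w N)) => [->|[f sf fE]].
  by move=> /IH[j [jN sj ej]]; exists j; split=> //; exact: ltnW.
rewrite fE inE => /orP[/eqP ->|/IH[j [jN sj ej]]].
  by exists N; split=> //; rewrite invasionS fE mem_head.
by exists j; split=> //; exact: ltnW.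
Qed.

Lemma ipcP w e : ipc w e <-> exists N, e \in invasion w N.
Proof. by split=> /asboolP. Qed.

(** The path from [v] ends above height M, hence outside [E]; the edge by which it first leaves [E]
    is a boundary edge. *)
Lemma exists_boundary w E M p k v : rooted E ->
  (forall x, x \in vertices E -> (size x <= M)%N) ->
  v \in vertices E -> (M < size v + k)%N -> surv (fun e => w e <= p) k v ->
  exists2 e, boundary E e & w e <= p.
Proof.
move=> rE sE; elim: k v => [|k IH] v vE; first by rewrite addn0 ltnNge sE.
rewrite addnS -addSn => Mk /= /existsP[i /andP[we si]].
case: (boolP (i :: v \in vertices E)) => [ivE|ivE]; first exact: (IH (i :: v)).
by exists (v, i) => //; rewrite rooted_boundary// vE.
Qed.

(** By finite branching this amounts to an infinite descending path of weights at most [p].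
    Quantifying over the depth presents it as a countable intersection of finitely determined
    events. *)
Definition survives w p v := forall k, surv (fun e => w e <= p) k v.

Lemma survives_parent w p e : w e <= p -> survives w p (child_end e) ->
  survives w p (parent_end e).
Proof.
case: e => v i we se [//|k] /=; apply/existsP; exists i.
by rewrite we (se k).
Qed.

(* An infinite path of weights at most p leaves the finite invaded cluster,
   hence offers a boundary edge of weight at most p. *)
Lemma smallest_le w j e p v : Defs.smallest w (invasion w j) e ->
  v \in vertices (invasion w j) -> survives w p v -> w e <= p.
Proof.
move=> [be sme] vj sv.
have [f bf wf] := exists_boundary (k := j.+1) (@rooted_invasion w j)
  (@size_invasion w j) vj (leq_addl _ _) (sv j.+1).
exact: le_trans (sme f bf) wf.
Qed.

Variables (p : nat -> R) (L : nat).

Definition good w l e : bool := (w e <= p l) && `[< survives w (p l) (child_end e) >].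

(* The least level at which the invasion can escape to infinity through an edge
   of B other than e, or L if there is none. *)
Definition escape w (B : seq (edge sigma)) e : nat :=
  find (fun l => has (fun f => (f != e) && good w l f) B) (iota 0 L).

Lemma escape_le w B e : (escape w B e <= L)%N.
Proof. by rewrite -[X in (_ <= X)%N](size_iota 0) find_size. Qed.

Lemma escape_min w B e l f : (l < escape w B e)%N -> f \in B -> f != e ->
  ~~ good w l f.
Proof.
move=> le fB fe; have := before_find 0%N le.
rewrite nth_iota ?add0n; last exact: leq_trans le (escape_le w B e).
by move=> /hasPn/(_ f fB); rewrite fe.
Qed.

Lemma escape_good w B e : (escape w B e < L)%N ->
  exists f, [/\ f \in B, f != e & good w (escape w B e) f].
Proof.
move=> eL; have /(nth_find 0%N) : has (fun l => has (fun f => (f != e) && good w l f) B) (iota 0 L).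
  by rewrite has_find size_iota.
rewrite -/(escape w B e) nth_iota// add0n => /hasP[f fB /andP[fe gf]].
by exists f.
Qed.

Definition children y : seq (edge sigma) := [seq (y, i) | i <- enum 'I_sigma].

Lemma mem_children y i : (y, i) \in children y.
Proof. by apply: map_f; rewrite mem_enum. Qed.

(* Whether the descending path r from y obeys the constraints imposed on an
   invaded path when escaping at level k is possible elsewhere. *)
Fixpoint passable w (r : seq 'I_sigma) y k : bool :=
  if r is i :: r' then
    let q := minn k (escape w (children y) (y, i)) in
    ((q < L)%N ==> (w (y, i) <= p q)) && passable w r' (i :: y) q
  else true.

Definition capped w k y :=
  (k < L)%N -> forall f, ipc w f -> below y f -> w f <= p k.

(** An edge below [y] is invaded when [y] already belongs to the cluster. If a sibling of the first
    edge is good at some level, then [y] itself survives at that level, and [smallest_le] caps every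
    later weight. The labels of [r] are listed downwards and those of a vertex upwards, hence
    [catrev]. *)
Lemma passable_ipc w r y k : capped w k y -> open_to (ipc w) (catrev r y) ->
  passable w r y k.
Proof.
elim: r y k => [//|i r IH] y k cy /= ox.
have oiy : open_to (ipc w) (i :: y).
  elim: r (i :: y) {IH cy} ox => [//|j r IHr] u /= /IHr /= /andP[_ ->//].
have Cyi : ipc w (y, i) by move: oiy => /= /andP[].
set q := minn _ _.
have cap f : (q < L)%N -> ipc w f -> below y f -> w f <= p q.
  rewrite /q; case: (leqP k (escape w (children y) (y, i))) => [_ kL Cf bf|ek eL].
    exact: cy.
  move=> /ipcP[N /invasion_step[j [_ sj _]]] [z fz].
  have [e' [/mapP[i' _ ->] _ /andP[we' /asboolP se']]] := escape_good eL.
  have sy := survives_parent we' se'.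
  have [bf _] := sj; apply: smallest_le sj _ sy.
  move: bf; rewrite rooted_boundary; last exact: rooted_invasion.
  by rewrite /parent_end fz => /andP[/rooted_suffix + _]; apply; exact: rooted_invasion.
apply/andP; split.
  by apply/implyP => qL; apply: cap => //; exact: below_refl.
apply: IH ox => qL f Cf bf; apply: cap => //.
exact: below_cons bf.
Qed.

Definition boundary_edges E : seq (edge sigma) :=
  undup [seq e <- [seq (v, i) | v <- vertices E, i <- enum 'I_sigma] | boundary E e].

Lemma mem_boundary_edges E e : rooted E -> (e \in boundary_edges E) = boundary E e.
Proof.
move=> rE; rewrite mem_undup mem_filter andb_idr// rooted_boundary// => /andP[pe _].
by apply/allpairsP; exists (e.1, e.2); rewrite /= mem_enum; case: e pe.
Qed.

(** The edge [e] and those beyond it are invaded from stage N on, when the other boundary edges are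
    already available; a good one among them caps all these weights. *)
Lemma boundary_ipc w N e r : boundary (invasion w N) e ->
  open_to (ipc w) (catrev r (child_end e)) ->
  ((escape w (boundary_edges (invasion w N)) e < L)%N ==>
     (w e <= p (escape w (boundary_edges (invasion w N)) e))) &&
  passable w r (child_end e) (escape w (boundary_edges (invasion w N)) e).
Proof.
set k := escape _ _ e => be ox; have rN := @rooted_invasion w N.
have Ce : ipc w e.
  have : open_to (ipc w) (child_end e).
    by elim: r (child_end e) ox => [//|j r IHr] u /= /IHr /= /andP[_ ->//].
  by case: (e) => v i /= /andP[].
have cap f : (k < L)%N -> ipc w f -> f = e \/ below (child_end e) f -> w f <= p k.
  move=> kL /ipcP[M /invasion_step[j [_ sj fj]]] fe.
  have [e' [e'B _ /andP[we' /asboolP se']]] := escape_good kL.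
  apply: smallest_le sj _ (survives_parent we' se').
  move: e'B; rewrite mem_boundary_edges// rooted_boundary// => /andP[+ _].
  have [jN|Nj] := ltnP j N; last by apply: sub_vertices; exact: sub_invasion.
  exfalso; have fN := sub_invasion jN fj.
  move: be; rewrite rooted_boundary// => /andP[_ /negP]; apply.
  case: fe => [<-|[z fz]]; first exact: child_vertices.
  by apply: (@rooted_suffix _ z) => //; rewrite -fz; exact: parent_vertices.
apply/andP; split; first by apply/implyP => kL; apply: cap => //; left.
by apply: passable_ipc ox => kL f Cf bf; apply: cap => //; right.
Qed.

Lemma exit_edge E c x : rooted E -> open_to c x -> x \notin vertices E ->
  exists e r, boundary E e /\ x = catrev r (child_end e).
Proof.
move=> rE; elim: x => [|i x IH] ox xE; first by rewrite root_vertices in xE.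
case: (boolP (x \in vertices E)) => [xE'|xE'].
  by exists (x, i), [::]; rewrite rooted_boundary// xE'.
have ox' : open_to c x by move: ox => /= /andP[].
have [e [r [be ->]]] := IH ox' xE'.
exists e, (rcons r i); split=> //.
by rewrite !catrevE rev_rcons.
Qed.

End invasion_path.

(** * Choice of the levels *)

Section geometric_sum.
Context {R : realType} (sigma : nat).
Hypothesis sigma2 : (2 <= sigma)%N.
Implicit Types a b : R.

Let S a := \sum_(i < sigma) a ^+ i.

Let s1 : 1 <= sigma%:R :> R.
Proof. by rewrite ler1n (leq_trans _ sigma2). Qed.

Lemma geometric_sumE a : (1 - a) * S a = 1 - a ^+ sigma.
Proof. by have := subrX1 a sigma; rewrite -/(S a) => h; lra. Qed.

Lemma geometric_sum_ge1 a : 0 <= a -> 1 <= S a.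
Proof.
move=> a0; rewrite /S; case: sigma sigma2 => // k _.
by rewrite big_ord_recl expr0 lerDl sumr_ge0// => i _; rewrite exprn_ge0.
Qed.

Lemma geometric_sum_le a b : 0 <= b <= a -> S b <= S a.
Proof.
move=> /andP[b0 ba]; apply: ler_sum => i _.
by rewrite lerXn2r// nnegrE (le_trans b0).
Qed.

Lemma sum_ord_half k : \sum_(i < k) i%:R = (k%:R * (k%:R - 1)) / 2 :> R.
Proof.
elim: k => [|k IH]; first by rewrite big_ord0 mul0r mul0r.
by rewrite big_ord_recr/= IH -[k.+1%:R]natr1; lra.
Qed.

(** Termwise, a^i (1 - r^i) is at most a i (1 - r) by Bernoulli's inequality. *)
Lemma geometric_sum_scale a r : 0 <= a <= 1 -> 0 <= r <= 1 ->
  S a - S (r * a) <= (1 - r) * a * ((sigma%:R * (sigma%:R - 1)) / 2).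
Proof.
move=> /andP[a0 a1] /andP[r0 r1]; rewrite -sum_ord_half -sumrB mulr_sumr.
apply: ler_sum => -[[|i] ilt] _ /=; first by rewrite !expr0 subrr mulr0.
have r'01 : 0 <= 1 - r <= 1 by rewrite subr_ge0 r1 lerBlDr lerDl.
have := bernoulli_ge i.+1 r'01.
rewrite (_ : 1 - (1 - r) = r) => [h|]; last by lra.
have ai : 0 <= a ^+ i.+1 by rewrite exprn_ge0.
have aia : a ^+ i.+1 <= a by rewrite exprS ler_piMr// exprn_ile1.
rewrite exprMn; apply: (@le_trans _ _ (a ^+ i.+1 * (i.+1%:R * (1 - r)))).
  have -> : a ^+ i.+1 - r ^+ i.+1 * a ^+ i.+1 = a ^+ i.+1 * (1 - r ^+ i.+1) by lra.
  rewrite ler_wpM2l//; move: h; set u := r ^+ _; set v := i.+1%:R * _; lra.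
rewrite mulrC [i.+1%:R * _]mulrC -!mulrA [a * _]mulrC.
by rewrite ler_wpM2l ?subr_ge0// ler_wpM2l.
Qed.

Lemma geometric_sum_ge a : 0 <= a <= 1 ->
  sigma%:R - (1 - a) * ((sigma%:R * (sigma%:R - 1)) / 2) <= S a.
Proof.
move=> a01; have one01 : 0 <= (1 : R) <= 1 by rewrite ler01 lexx.
have := geometric_sum_scale one01 a01.
have -> : S 1 = sigma%:R.
  by rewrite /S; under eq_bigr do rewrite expr1n; rewrite sumr_const card_ord.
by rewrite !mulr1; lra.
Qed.

Lemma geometric_sum0 : S 0 = 1.
Proof.
rewrite /S; case: sigma sigma2 => // k _; rewrite big_ord_recl expr0 big1 ?addr0// => i _.
by rewrite expr0n.
Qed.

Lemma expr_le_id a k : (0 < k)%N -> 0 <= a <= 1 -> a ^+ k <= a.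
Proof. by case: k => // k _ /andP[a0 a1]; rewrite exprS ler_piMr// exprn_ile1. Qed.

End geometric_sum.

(* The levels p l are parametrized by a = 1 - p l * th l, where th l is the
   survival probability at p l: then th l = 1 - a ^ sigma and
   p l = 1 / (1 + a + ... + a ^ (sigma - 1)).  Taking a geometric in l makes the
   increments of p th and th proportional, up to the mesh.  The bound psi n l is
   a supersolution of the recursion for the mean number of vertices reached at
   depth n under the cap p l; its slope (3 / 4) (1 - 1 / sigma) exceeds the
   optimal (1 / 2) (1 - 1 / sigma). *)
Section geometric_levels.
Context {R : realType} (sigma M n L : nat) (y : R).
Local Notation s := (sigma%:R : R).
Local Notation S := (fun a : R => \sum_(i < sigma) a ^+ i).
Hypothesis sigma2 : (2 <= sigma)%N.
Hypothesis y0 : 0 < y.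
Hypothesis yn : n%:R * y * s = 1 / 8.
Hypothesis Msy : M%:R * (s * y) * s <= 1 / 16.
Hypothesis ssy : 16 * s * (s * y) <= 1 / 16.
Hypothesis nL : (n < L)%N.
Hypothesis rL : (1 - y) ^+ L.-1 * (s * s * (M%:R + 16 * s + 1)) <= 1.

(** The value 0 from L on gives p L = th L = 1, so the last level imposes nothing. By [rL] the value
    at [L.-1] is already so small that the final jump is cheap. *)
Definition grid l := if (l < L)%N then (1 - y) ^+ l else 0.
Definition grid_p l := (S (grid l))^-1.
Definition grid_th l := 1 - grid l ^+ sigma.
(** The intercept of the supersolution, which has to be at least 1. A multiple of th passes through
    the recursion at little cost but vanishes at level 0; so the intercept is constant on the first
    n cells, proportional to th afterwards, and rises by a further 1 at L to pay for the jump of the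
    grid to 0. *)
Definition grid_be l := if (l <= n)%N then 1 else
  if (l < L)%N then (grid_th n)^-1 * grid_th l else (grid_th n)^-1 + 1.

Local Notation a := grid.
Local Notation p := grid_p.
Local Notation th := grid_th.
Local Notation be := grid_be.
Local Notation B := ((th n)^-1).

Lemma gs2 : 2 <= s. Proof. by rewrite ler_nat. Qed.

Lemma gs0 : 0 < s. Proof. by have := gs2; lra. Qed.

Lemma gsV : 0 < s^-1 <= 1 / 2.
Proof. by rewrite invr_gt0 gs0/= div1r lef_pV2 ?posrE ?gs0// gs2. Qed.

Lemma gy1 : y <= 1 / 16.
Proof. by have := gs2; have := y0; have := ssy; nra. Qed.

Lemma gr0 : 0 < 1 - y. Proof. by have := gy1; lra. Qed.

Lemma gr01 : 0 <= 1 - y <= 1.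
Proof. by have := gr0; have := y0; move=> *; apply/andP; split; lra. Qed.

Lemma gy01 : 0 <= y <= 1.
Proof. by have := gy1; have := y0; move=> *; apply/andP; split; lra. Qed.

Lemma sig_gt0 : (0 < sigma)%N. Proof. exact: leq_trans sigma2. Qed.

Lemma grid_ge0 l : 0 <= a l.
Proof. by rewrite /a; case: ifP => // _; rewrite exprn_ge0// (ltW gr0). Qed.

Lemma grid_le1 l : a l <= 1.
Proof.
rewrite /a; case: ifP => // _; have /andP[r0 r1] := gr01.
by rewrite exprn_ile1.
Qed.

Lemma grid01 l : 0 <= a l <= 1. Proof. by rewrite grid_ge0 grid_le1. Qed.

Lemma gridS l : (l.+1 < L)%N -> a l.+1 = (1 - y) * a l.
Proof. by move=> lL; rewrite /a lL ltnW// exprS. Qed.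

Lemma grid_out l : (L <= l)%N -> a l = 0.
Proof. by rewrite /a ltnNge => ->. Qed.

Lemma cellP l : [\/ (l.+1 < L)%N, l.+1 = L | (L <= l)%N].
Proof.
by case: (ltngtP l.+1 L) => [lt|lt|->]; [constructor 1|constructor 3|constructor 2].
Qed.

Lemma grid_dec l : 0 <= a l.+1 <= a l.
Proof.
rewrite grid_ge0 /=; case: (cellP l) => [lL|lL|lL].
- by rewrite gridS// ler_piMl ?grid_ge0//; case/andP: gr01.
- by rewrite grid_out ?grid_ge0// lL.
- by rewrite !grid_out// leqW.
Qed.

Lemma S_ge1 l : 1 <= S (a l).
Proof. exact: (geometric_sum_ge1 sigma2 (grid_ge0 l)). Qed.

Lemma S_gt0 l : 0 < S (a l). Proof. exact: lt_le_trans ltr01 (S_ge1 l). Qed.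

Lemma grid_pth l : 1 - p l * th l = a l.
Proof.
rewrite /p /th -(geometric_sumE sigma) [_^-1 * _]mulrC mulfK ?gt_eqF ?S_gt0//.
by rewrite opprB addrC subrK.
Qed.

Lemma grid_p01 l : 0 <= p l <= 1.
Proof. by rewrite /p invr_ge0 (ltW (S_gt0 l)) invf_le1 ?S_gt0// S_ge1. Qed.

Lemma grid_th01 l : 0 <= th l <= 1.
Proof.
have /andP[? ?] := grid01 l.
by rewrite /th subr_ge0 exprn_ile1//= lerBlDr lerDl exprn_ge0.
Qed.

Lemma grid_thS l : th l <= th l.+1.
Proof.
have /andP[? ?] := grid_dec l.
by rewrite /th lerD2l lerN2 lerXn2r ?nnegrE ?grid_ge0.
Qed.

Lemma grid_th_mono i j : (i <= j)%N -> th i <= th j.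
Proof.
move=> /subnK <-; elim: (j - i)%N => // k IH.
by rewrite addSn (le_trans IH)// grid_thS.
Qed.

Lemma grid_pS l : p l <= p l.+1.
Proof.
by rewrite /p lef_pV2 ?posrE ?S_gt0//; exact: (geometric_sum_le sigma (grid_dec l)).
Qed.

Lemma grid_thL : th L = 1.
Proof. by rewrite /th grid_out// expr0n eqn0Ngt sig_gt0 subr0. Qed.

Lemma grid_0 : a 0%N = 1.
Proof. by rewrite /a expr0 (leq_ltn_trans _ nL). Qed.

Lemma grid_th0 : th 0%N = 0.
Proof. by rewrite /th grid_0 expr1n subrr. Qed.

Lemma grid_p0 : p 0%N = s^-1.
Proof.
rewrite /p grid_0; under eq_bigr do rewrite expr1n.
by rewrite sumr_const card_ord.
Qed.

Lemma grid_pL : p L = 1.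
Proof. by rewrite /p grid_out// (geometric_sum0 sigma2) invr1. Qed.

Lemma d_ge : s * y * (1 - s * y) <= 1 - (1 - y) ^+ sigma.
Proof. by have := bernoulli_le sigma gy01; set u := (1 - y) ^+ _; lra. Qed.

Lemma d_le : 1 - (1 - y) ^+ sigma <= s * y.
Proof. by have := bernoulli_ge sigma gy01; set u := (1 - y) ^+ _; lra. Qed.

Lemma sy_gt0 : 0 < s * y. Proof. by rewrite mulr_gt0// gs0. Qed.

Lemma dth l : (l.+1 < L)%N -> th l.+1 - th l = a l ^+ sigma * (1 - (1 - y) ^+ sigma).
Proof.
by move=> lL; rewrite /th gridS// exprMn; set u := a l ^+ _; set v := (1 - y) ^+ _; lra.
Qed.

Lemma eta01 : 0 < n%:R * y <= 1 / 16.
Proof.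
have h : 0 < n%:R * y by rewrite -(ltr_pM2r gs0) mul0r yn.
by rewrite h /=; have := gs2; move: h yn; nra.
Qed.

Lemma thn_ge : n%:R * y / 2 <= th n.
Proof.
have /andP[e0 e1] := eta01.
have h1 : a n <= 1 - n%:R * y + (n%:R * y) ^+ 2.
  by rewrite /a nL exprMn; exact: bernoulli_le n gy01.
have h2 : a n ^+ sigma <= a n := expr_le_id sig_gt0 (grid01 n).
rewrite /th; move: e0 e1 h1 h2; set u := a n ^+ _; set v := a n.
by set e := n%:R * y; nra.
Qed.

Lemma thn_gt0 : 0 < th n.
Proof. by apply: lt_le_trans thn_ge; have /andP[? ?] := eta01; lra. Qed.

Lemma B_ge1 : 1 <= B.
Proof. by rewrite invf_ge1 ?thn_gt0//; case/andP: (grid_th01 n). Qed.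

Lemma B_gt0 : 0 < B. Proof. exact: lt_le_trans ltr01 B_ge1. Qed.

(** [th n] is at least half of n y = 1 / (8 s); this is the origin of the constant 16 s in the bound
    on psi. *)
Lemma B_le : B <= 16 * s.
Proof.
have /andP[e0 _] := eta01; rewrite -[16 * s]invrK lef_pV2 ?posrE ?invr_gt0 ?mulr_gt0 ?thn_gt0 ?gs0//.
apply: le_trans thn_ge; rewrite -div1r ler_pdivrMr ?mulr_gt0 ?gs0//.
by have := yn; lra.
Qed.

Lemma Bth_le l : B * th l <= B.
Proof. by rewrite ler_piMr ?(ltW B_gt0)//; case/andP: (grid_th01 l). Qed.

Lemma be_mid l : (n <= l)%N -> (l < L)%N -> be l = B * th l.
Proof.
rewrite /be leq_eqVlt => /orP[/eqP <- _|nl ->]; last by rewrite leqNgt nl.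
by rewrite leqnn mulVf// gt_eqF// thn_gt0.
Qed.

Lemma be_last l : (L <= l)%N -> be l = B + 1.
Proof.
move=> Ll; rewrite /be [X in if X then _ else _]leqNgt (leq_trans nL)//=.
by rewrite ltnNge Ll.
Qed.

Lemma be_ge1 l : 1 <= be l.
Proof.
have [ln|/ltnW nl] := leqP l n; first by rewrite /be ln.
have [lL|Ll] := ltnP l L; last by rewrite be_last// lerDr (ltW B_gt0).
rewrite be_mid// -(mulVf (lt0r_neq0 thn_gt0)) ler_pM2l ?B_gt0//.
exact: grid_th_mono.
Qed.

Lemma be_le l : be l <= B + 1.
Proof.
have [ln|/ltnW nl] := leqP l n; first by rewrite /be ln lerDr (ltW B_gt0).
have [lL|Ll] := ltnP l L; last by rewrite be_last.
by rewrite be_mid// (le_trans (Bth_le l))// lerDl.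
Qed.

Lemma be_inc l : be l <= be l.+1.
Proof.
have [ln|nl] := ltnP l n; first by rewrite {1}/be (ltnW ln) be_ge1.
case: (cellP l) => [lL|lL|lL].
- rewrite !be_mid ?(ltnW lL)//; last exact: leqW.
  by rewrite ler_pM2l ?B_gt0// grid_thS.
- by rewrite [X in _ <= X]be_last ?be_le// lL.
- by rewrite !be_last// leqW.
Qed.

Lemma inv_diff (x x' : R) : 1 <= x' -> x' <= x -> x'^-1 - x^-1 <= x - x'.
Proof.
move=> x'1 x'x; have x'0 : 0 < x' by apply: lt_le_trans x'1.
have x0 : 0 < x by apply: lt_le_trans x'x.
have -> : x'^-1 - x^-1 = (x - x') / (x * x').
  by rewrite invfM mulrBl mulrA divff ?gt_eqF// mul1r mulrCA divff ?gt_eqF// mulr1.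
rewrite ler_pdivrMr ?mulr_gt0// ler_peMr ?subr_ge0//.
by rewrite mulr_ege1// (le_trans x'1).
Qed.

Lemma ar_ge0 k l : 0 <= a l ^+ k. Proof. by rewrite exprn_ge0 ?grid_ge0. Qed.

Lemma ar_le1 k l : a l ^+ k <= 1.
Proof. by rewrite exprn_ile1 ?grid_ge0 ?grid_le1. Qed.

Lemma alast l : l.+1 = L -> a l * (s * s * (M%:R + 16 * s + 1)) <= 1.
Proof. by move=> lL; rewrite /a -lL ltnSn; move: rL; rewrite -lL. Qed.

Lemma mesh_th l : M%:R * (th l.+1 - th l) <= 1.
Proof.
have := gs2; have M0 : 0 <= M%:R :> R by [].
case: (cellP l) => [lL|lL|lL].
- rewrite dth//; have h : a l ^+ sigma * (1 - (1 - y) ^+ sigma) <= s * y.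
    rewrite (le_trans _ d_le)// ler_piMl ?ar_le1// subr_ge0.
    by have /andP[? ?] := gr01; rewrite exprn_ile1.
  have := ler_wpM2l M0 h; have := mulr_ge0 M0 (ltW sy_gt0).
  by move: Msy; set u := _ * (1 - _); set v := s * y; nra.
- rewrite lL grid_thL /th; have h : a l ^+ sigma <= a l := expr_le_id sig_gt0 (grid01 l).
  have := alast lL; have := grid_ge0 l; move: h M0.
  set u := a l ^+ _; set v := a l => uv M0 v0 h s2.
  have : M%:R * u <= M%:R * v by rewrite ler_wpM2l.
  have : v * M%:R * 4 <= v * M%:R * (s * s) by rewrite ler_wpM2l ?mulr_ge0//; nra.
  have : 0 <= v * (s * s) * (16 * s + 1) by rewrite !mulr_ge0//; lra.
  have : 0 <= v * M%:R by rewrite mulr_ge0.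
  by lra.
- by rewrite /th !grid_out ?leqW// subrr mulr0 ler01.
Qed.

Lemma halfs : 0 <= s * (s - 1) / 2 <= s * s.
Proof. by have := gs2; move=> s2; apply/andP; split; nra. Qed.

Lemma mesh_p l : M%:R * (p l.+1 - p l) <= 1.
Proof.
have M0 : 0 <= M%:R :> R by [].
have hS : p l.+1 - p l <= S (a l) - S (a l.+1).
  by apply: inv_diff; [exact: S_ge1|exact: (geometric_sum_le sigma (grid_dec l))].
apply: (le_trans (ler_wpM2l M0 hS)).
have /andP[ss20 ss2] := halfs.
case: (cellP l) => [lL|lL|lL].
- rewrite (gridS lL); have := geometric_sum_scale sigma (grid01 l) gr01.
  rewrite (_ : 1 - (1 - y) = y); last by lra.
  move=> h; have h2 : y * a l * (s * (s - 1) / 2) <= y * (s * s).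
    apply: ler_pM => //; first by rewrite mulr_ge0 ?grid_ge0// (ltW y0).
    by rewrite ler_piMr ?grid_le1// (ltW y0).
  have := ler_wpM2l M0 (le_trans h h2); move: Msy.
  by set u := _ - _; lra.
- rewrite lL (grid_out (leqnn L)); have z01 : 0 <= (0 : R) <= 1 by rewrite lexx ler01.
  have := geometric_sum_scale sigma (grid01 l) z01.
  rewrite mul0r subr0 mul1r => h.
  have h2 : a l * (s * (s - 1) / 2) <= a l * (s * s) by rewrite ler_wpM2l ?grid_ge0.
  have := ler_wpM2l M0 (le_trans h h2); have := alast lL.
  have : 0 <= a l * (s * s) * (16 * s + 1).
    by rewrite !mulr_ge0 ?grid_ge0 ?(ltW gs0)// addr_ge0// mulr_ge0 ?(ltW gs0).
  by set u := _ - _; lra.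
- by rewrite !grid_out ?leqW// subrr mulr0 ler01.
Qed.

(** On the first n cells the sums S stay above 15/16 s, because 1 - a is at most n y = 1 / (8 s).
    The constant is then (16/15)^2 / 2 = 128/225, which is less than 2/3. *)
Lemma cell_p l : (l < n)%N -> (l.+1 < L)%N ->
  p l.+1 - p l <= y * a l * (2 / 3 * (1 - s^-1)).
Proof.
move=> ln lL.
have S'ge : 15 / 16 * s <= S (a l.+1).
  have h1 : 1 - a l.+1 <= n%:R * y.
    rewrite lerBlDl -lerBlDr (le_trans (bernoulli_ge n gy01))// /a lL.
    by apply: ler_wiXn2l => //; case/andP: gr01.
  have /andP[hs0 _] := halfs.
  have := geometric_sum_ge sigma (grid01 l.+1); have := ler_wpM2r hs0 h1.
  have -> : n%:R * y * (s * (s - 1) / 2) = n%:R * y * s * (s - 1) / 2 by lra.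
  by rewrite yn; have := gs2; set u := _ * (s * _ / 2); lra.
have SS : S (a l.+1) <= S (a l) := geometric_sum_le sigma (grid_dec l).
have inv_le x : 15 / 16 * s <= x -> x^-1 <= 16 / 15 * s^-1.
  move=> sx; have -> : 16 / 15 * s^-1 = (15 / 16 * s)^-1.
    by rewrite invfM; congr (_ * _); lra.
  have h0 : 0 < 15 / 16 * s by rewrite mulr_gt0 ?gs0// divr_gt0.
  by rewrite lef_pV2 ?posrE// (lt_le_trans h0).
have -> : p l.+1 - p l = (S (a l) - S (a l.+1)) * ((S (a l))^-1 * (S (a l.+1))^-1).
  by rewrite mulrBl mulrA divff ?gt_eqF ?S_gt0// mul1r mulrCA divff ?gt_eqF ?S_gt0// mulr1.
have h2 : S (a l) - S (a l.+1) <= y * a l * (s * (s - 1) / 2).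
  have := geometric_sum_scale sigma (grid01 l) gr01.
  by rewrite (gridS lL) (_ : 1 - (1 - y) = y)//; lra.
have h3 : (S (a l))^-1 * (S (a l.+1))^-1 <= (16 / 15 * s^-1) * (16 / 15 * s^-1).
  apply: ler_pM; rewrite ?invr_ge0 ?(ltW (S_gt0 _))// inv_le//.
  exact: le_trans SS.
have h30 : 0 <= (S (a l))^-1 * (S (a l.+1))^-1.
  by rewrite mulr_ge0 ?invr_ge0 ?(ltW (S_gt0 _)).
have dS : 0 <= S (a l) - S (a l.+1) by rewrite subr_ge0.
apply: (le_trans (ler_pM dS h30 h2 h3)).
rewrite -[X in X <= _]mulrA ler_wpM2l//; first by rewrite mulr_ge0 ?grid_ge0 ?(ltW y0).
have ssV : s * s^-1 = 1 by rewrite divff ?gt_eqF ?gs0.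
have /andP[_ sV] := gsV.
have -> : s * (s - 1) / 2 * (16 / 15 / s * (16 / 15 / s)) =
   128 / 225 * ((s * s^-1) * (s * s^-1) - (s * s^-1) * s^-1) by lra.
by rewrite ssV; move: sV; lra.
Qed.

Local Notation ss := (1 - s^-1).
Local Notation al := (3 / 4 * ss).

Definition grid_psi m l := al * m%:R * th l + be l.

Local Notation F m l := (s * p l * grid_psi m l).

Lemma al01 : 3 / 8 <= al <= 1.
Proof. by have /andP[u v] := gsV; move: u v; move=> u v; apply/andP; split; lra. Qed.

Lemma al_ge0 : 0 <= al. Proof. by have /andP[h _] := al01; move: h; lra. Qed.

Lemma grid_psi_ge0 m l : 0 <= grid_psi m l.
Proof.
apply: addr_ge0; last exact: le_trans ler01 (be_ge1 l).
apply: mulr_ge0; last by case/andP: (grid_th01 l).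
by apply: mulr_ge0; [exact: al_ge0|exact: ler0n].
Qed.

Lemma grid_F m l : F m l = s * (al * m%:R * (1 - a l) + p l * be l).
Proof.
rewrite /grid_psi; have -> : 1 - a l = p l * th l by rewrite -grid_pth opprB addrC subrK.
by set u := p l; set v := th l; set w := be l; lra.
Qed.

Lemma apred l : a l ^+ sigma.-1 * a l = a l ^+ sigma.
Proof. by rewrite -exprSr prednK// sig_gt0. Qed.

Lemma msy m : (m < M)%N -> 0 <= (m%:R + 1) * (s * y) <= 1 / 32.
Proof.
move=> mM; have mM1 : m%:R + 1 <= M%:R :> R by rewrite natr1 ler_nat.
have := sy_gt0; set u := s * y => u0; rewrite mulr_ge0 ?(ltW u0) ?addr_ge0//=.
apply: (le_trans (ler_wpM2r (ltW u0) mM1)).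
have : 0 <= M%:R * u by rewrite mulr_ge0 ?(ltW u0).
by have := gs2; move: Msy; rewrite -/u; nra.
Qed.

(** In units of s y a^sigma, the constant intercept costs at most 2/3 (1 - 1/s) through the
    increment of p, while passing from m to m + 1 brings 3/4 (1 - 1/s). The difference covers the
    factor 1 - s y of [d_ge]. *)
Lemma cell_low m l : (m < M)%N -> (l < n)%N -> (l.+1 < L)%N ->
  a l ^+ sigma.-1 * (F m l.+1 - F m l) <= grid_psi m.+1 l.+1 - grid_psi m.+1 l.
Proof.
move=> mM ln lL; rewrite !grid_F /grid_psi.
have -> : be l = 1 by rewrite /be ltnW.
have -> : be l.+1 = 1 by rewrite /be ln.
have -> : al * m.+1%:R * th l.+1 + 1 - (al * m.+1%:R * th l + 1) =
    al * (m%:R + 1) * (th l.+1 - th l).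
  by rewrite natr1; set u := th l; set v := th l.+1; set w := m.+1%:R; lra.
rewrite dth//.
have Dp := ler_wpM2l (mulr_ge0 (ltW gs0) (ar_ge0 sigma.-1 l)) (cell_p ln lL).
have al2 : 0 <= al * (m%:R + 1) by rewrite mulr_ge0 ?al_ge0 ?addr_ge0.
have := ler_wpM2l al2 (ler_wpM2l (ar_ge0 sigma l) d_ge).
apply: le_trans; rewrite gridS//.
have -> : a l ^+ sigma.-1 * (s * (al * m%:R * (1 - (1 - y) * a l) + p l.+1 * 1)
   - s * (al * m%:R * (1 - a l) + p l * 1)) =
   s * y * al * m%:R * (a l ^+ sigma.-1 * a l) + s * a l ^+ sigma.-1 * (p l.+1 - p l).
  by set u := a l; set v := u ^+ _; set w := p l; set x := p _; lra.
have E : s * a l ^+ sigma.-1 * (y * a l * (2 / 3 * ss)) = s * y * (2 / 3 * ss) * a l ^+ sigma.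
  by rewrite -apred; set u := a l; set v := u ^+ _; lra.
rewrite E in Dp; rewrite apred.
have /andP[h1 h2] := msy mM; have /andP[v1 v2] := gsV.
have h3 : 0 <= a l ^+ sigma * (s * y) * (ss * (1 / 32 - (m%:R + 1) * (s * y))).
  by rewrite !mulr_ge0 ?ar_ge0 ?(ltW gs0) ?(ltW y0) ?subr_ge0// (le_trans v2)//; lra.
have h4 : 0 <= a l ^+ sigma * (s * y) * ss.
  by rewrite !mulr_ge0 ?ar_ge0 ?(ltW gs0) ?(ltW y0) ?subr_ge0// (le_trans v2)//; lra.
move: Dp h3 h4; set A := a l ^+ sigma; set Q := s * a l ^+ sigma.-1 * (_ - _); set v := s^-1.
by lra.
Qed.

(** Here p be = B (1 - a), so the left side is affine in a. The gain [al] from m to m + 1 exceeds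
    the errors of second order in s y. *)
Lemma cell_mid m l : (m < M)%N -> (n <= l)%N -> (l.+1 < L)%N ->
  a l ^+ sigma.-1 * (F m l.+1 - F m l) <= grid_psi m.+1 l.+1 - grid_psi m.+1 l.
Proof.
move=> mM nl lL; rewrite !grid_F /grid_psi !be_mid ?(ltnW lL)//; last exact: leqW.
have E k : al * m%:R * (1 - a k) + p k * (B * th k) = (al * m%:R + B) * (1 - a k).
  have -> : 1 - a k = p k * th k by rewrite -grid_pth opprB addrC subrK.
  by set u := p k; set v := th k; set b := B; lra.
rewrite !E.
have -> : al * m.+1%:R * th l.+1 + B * th l.+1 - (al * m.+1%:R * th l + B * th l) =
    (al * (m%:R + 1) + B) * (th l.+1 - th l).
  by rewrite natr1; set u := th l; set v := th l.+1; set b := B; set w := m.+1%:R; lra.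
rewrite dth// gridS//.
have -> : a l ^+ sigma.-1 * (s * ((al * m%:R + B) * (1 - (1 - y) * a l)) -
    s * ((al * m%:R + B) * (1 - a l))) = (al * m%:R + B) * (s * y) * a l ^+ sigma.
  by rewrite -apred; set u := a l; set v := u ^+ _; set b := B; lra.
have al2 : 0 <= al * (m%:R + 1) + B.
  by rewrite addr_ge0 ?(ltW B_gt0)// mulr_ge0 ?al_ge0 ?addr_ge0.
have := ler_wpM2l al2 (ler_wpM2l (ar_ge0 sigma l) d_ge).
apply: le_trans.
have Bsy : B * (s * y) <= 1 / 16 by have := ler_wpM2r (ltW sy_gt0) B_le; move: ssy; set b := B; lra.
have /andP[h1 h2] := msy mM; have /andP[a1 a2] := al01.
have h3 : al * ((m%:R + 1) * (s * y)) <= 1 / 32.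
  by rewrite (le_trans _ h2)// ler_piMl.
have : 0 <= a l ^+ sigma * (s * y) * (al - al * ((m%:R + 1) * (s * y)) - B * (s * y)).
  rewrite mulr_ge0// ?mulr_ge0 ?ar_ge0 ?(ltW gs0) ?(ltW y0)//.
  move: a1 h3 Bsy; set u := al * (_ * _); set v := B * _; set w := al; lra.
by set u := a l ^+ _; set b := B; set c := al; lra.
Qed.

(** The left side is at most 1 by the choice of the last nonzero grid value, and the right side is
    at least the jump 1 of the intercept. *)
Lemma cell_top m l : (m < M)%N -> l.+1 = L ->
  a l ^+ sigma.-1 * (F m l.+1 - F m l) <= grid_psi m.+1 l.+1 - grid_psi m.+1 l.
Proof.
move=> mM lL.
have nl : (n <= l)%N by rewrite -ltnS lL.
have F0 : 0 <= F m l.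
  rewrite mulr_ge0 ?grid_psi_ge0// mulr_ge0 ?(ltW gs0)//.
  by case/andP: (grid_p01 l).
have FE : F m l.+1 = s * (al * m%:R + (B + 1)).
  by rewrite lL grid_pL mulr1 /grid_psi grid_thL mulr1 be_last.
have h1 : al * m%:R <= M%:R.
  have /andP[_ a1] := al01; apply: (@le_trans _ _ m%:R); first by rewrite ler_piMl.
  by rewrite ler_nat ltnW.
have FL : F m l.+1 <= s * s * (M%:R + 16 * s + 1).
  have h2 : al * m%:R + (B + 1) <= M%:R + 16 * s + 1.
    by have := B_le; move: h1; set b := B; set u := al * _; lra.
  rewrite FE; apply: (le_trans (ler_wpM2l (ltW gs0) h2)).
  have X0 : 0 <= M%:R + 16 * s + 1 by have := gs2; have : 0 <= M%:R :> R by []; lra.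
  have s1 : 1 <= s by have := gs2; lra.
  have := ler_wpM2r (mulr_ge0 (ltW gs0) X0) s1; set X := M%:R + _; lra.
have FL0 : 0 <= F m l.+1.
  have am0 : 0 <= al * m%:R by apply: mulr_ge0; [exact: al_ge0|exact: ler0n].
  rewrite FE; apply: mulr_ge0; first exact: (ltW gs0).
  by apply: addr_ge0 => //; apply: addr_ge0 => //; exact: (ltW B_gt0).
apply: (@le_trans _ _ 1).
  apply: (@le_trans _ _ (a l ^+ sigma.-1 * F m l.+1)).
    by rewrite ler_wpM2l ?ar_ge0// lerBlDr lerDl.
  apply: le_trans (alast lL); apply: ler_pM; rewrite ?ar_ge0//.
  by apply: expr_le_id; rewrite ?grid01// -subn1 subn_gt0.
rewrite {1}/grid_psi lL grid_thL be_last// /grid_psi be_mid//; last by rewrite -lL.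
have : 0 <= al * m.+1%:R * (1 - th l).
  apply: mulr_ge0; last by rewrite subr_ge0; case/andP: (grid_th01 l).
  by apply: mulr_ge0; [exact: al_ge0|exact: ler0n].
have := Bth_le l; set u := th l; set b := B; set c := al * _; lra.
Qed.

End geometric_levels.

(** The grid depends on M through the mesh conditions, but the bound 16 sigma + 1 on the intercept
    of psi does not; this keeps the additive error bounded as the height grows. *)
Lemma exists_levels (R : realType) (sigma : nat) : (2 <= sigma)%N ->
  forall M : nat, exists (L : nat) (p th : nat -> R) (psi : nat -> nat -> R),
  let al := 3 / 4 * (1 - sigma%:R^-1) in
  let F m l := sigma%:R * p l * psi m l in
  [/\ [/\ p L = 1, th 0%N = 0, forall l, th l <= 1 & forall l, 0 <= p l <= 1],
      forall l, 0 <= th l <= 1 - (1 - p l * th l) ^+ sigma,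
      [/\ forall l, p l <= p l.+1, forall l, M%:R * (p l.+1 - p l) <= 1 &
          forall l, M%:R * (th l.+1 - th l) <= 1],
      [/\ forall l, psi 0%N l >= 1, forall m l, 0 <= psi m l,
          forall m l, psi m l <= psi m l.+1 &
          forall m l, psi m l <= al * m%:R * th l + (16 * sigma%:R + 1)] &
      forall m, (m < M)%N -> F m 0%N <= psi m.+1 0%N /\
        forall l, (l < L)%N ->
          (1 - p l * th l) ^+ sigma.-1 * (F m l.+1 - F m l) <=
          psi m.+1 l.+1 - psi m.+1 l].
Proof.
move=> sigma2 M.
have s0 : 0 < sigma%:R :> R by exact: gs0.
have s2 : 2 <= sigma%:R :> R by exact: gs2.
(* Chosen so that n / 2 dominates both M sigma and 16 sigma; since n sigma y = 1 / 8, this yields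
   [Msy] and [ssy]. *)
pose n := ((2 * M.+1 + 16 * sigma) * sigma * 2)%N.
have nE : n%:R = (2 * (M%:R + 1) + 16 * sigma%:R) * sigma%:R * 2 :> R.
  by rewrite /n !natrM natrD !natrM -[M.+1%:R]natr1.
have M0 : 0 <= M%:R :> R by [].
have n0 : 0 < n%:R :> R by rewrite nE !mulr_gt0// addr_gt0 ?mulr_gt0 ?addr_gt0//; lra.
pose y : R := (8 * sigma%:R * n%:R)^-1.
have y0 : 0 < y by rewrite invr_gt0 !mulr_gt0.
have yn : n%:R * y * sigma%:R = 1 / 8.
  have -> : n%:R * y * sigma%:R = (8 * (sigma%:R * n%:R)) * y / 8 by lra.
  by rewrite /y mulrA divff// !mulf_neq0// gt_eqF.
have syn : n%:R * (sigma%:R * y) = 1 / 8 by rewrite -yn; lra.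
have sy0 : 0 < sigma%:R * y by rewrite mulr_gt0.
have Msy : M%:R * (sigma%:R * y) * sigma%:R <= 1 / 16.
  have h : M%:R * sigma%:R <= n%:R / 2 :> R.
    have := mulr_ge0 M0 (ltW s0); have := mulr_ge0 (ltW s0) (ltW s0); lra.
  have := ler_wpM2r (ltW sy0) h; lra.
have ssy : 16 * sigma%:R * (sigma%:R * y) <= 1 / 16.
  have h : 16 * sigma%:R <= n%:R / 2 :> R.
    have := mulr_ge0 M0 (ltW s0); have : 0 <= sigma%:R * (sigma%:R - 1) :> R.
      by rewrite mulr_ge0 ?(ltW s0)//; lra.
    by lra.
  have := ler_wpM2r (ltW sy0) h; lra.
pose D := sigma%:R * sigma%:R * (M%:R + 16 * sigma%:R + 1) : R.
have D0 : 0 < D by rewrite !mulr_gt0// ltr_wpDl// addr_ge0// mulr_ge0// ltW.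
have /andP[r0 r1] := gr01 sigma2 y0 ssy.
(* Further cells, beyond the first n, that bring the last nonzero grid value below 1 / D. *)
have [k rk] : exists k, (1 - y) ^+ k * D <= 1.
  have : (1 - y) ^+ k @[k --> \oo] --> (0 : R).
    by apply: cvg_expr; rewrite ger0_norm// ltrBlDr ltrDl.
  have D10 : 0 < D^-1 by rewrite invr_gt0.
  move=> /cvgrPdist_lt/(_ _ D10)[k _ /(_ k (leqnn k))] /=.
  rewrite sub0r normrN ger0_norm ?exprn_ge0// => /ltW h; exists k.
  by rewrite -ler_pdivlMr// div1r.
pose L := (n + k).+1.
have nL : (n < L)%N by rewrite ltnS leq_addr.
have rL : (1 - y) ^+ L.-1 * D <= 1.
  rewrite /L /= exprD -mulrA (le_trans _ rk)// ler_piMl ?exprn_ile1//.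
  by rewrite mulr_ge0 ?exprn_ge0// ltW.
exists L, (grid_p sigma L y), (grid_th sigma L y), (grid_psi sigma n L y).
split.
- split; [exact: grid_pL|exact: (grid_th0 sigma y nL)| |].
    by move=> l; case/andP: (grid_th01 L sigma2 y0 ssy l).
  exact: (grid_p01 L sigma2 y0 ssy).
- move=> l; rewrite (grid_pth L sigma2 y0 ssy) -/(grid_th sigma L y l) lexx andbT.
  by case/andP: (grid_th01 L sigma2 y0 ssy l).
- split.
  + exact: (grid_pS L sigma2 y0 ssy).
  + exact: (mesh_p sigma2 y0 Msy ssy rL).
  + exact: (mesh_th sigma2 y0 Msy ssy rL).
- split=> [l|m l|m l|m l].
  + by rewrite /grid_psi mulr0 mul0r add0r (be_ge1 sigma2 y0 yn ssy nL).
  + exact: (grid_psi_ge0 sigma2 y0 yn ssy nL).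
  + rewrite lerD ?(be_inc sigma2 y0 yn ssy nL)// ler_wpM2l ?(grid_thS L sigma2 y0 ssy)//.
    by rewrite mulr_ge0// (al_ge0 sigma2).
  + rewrite lerD2l (le_trans (be_le sigma2 y0 yn ssy nL l))// lerD2r.
    exact: (B_le sigma2 y0 yn ssy nL).
move=> m mM; split.
  rewrite (grid_p0 sigma y nL) divff ?gt_eqF// mul1r /grid_psi.
  by rewrite (grid_th0 sigma y nL) !mulr0.
move=> l lL; rewrite (grid_pth L sigma2 y0 ssy).
case: (cellP L l) => [lL1|lL1|]; last by rewrite leqNgt lL.
  have [ln|nl] := ltnP l n; first exact: (cell_low sigma2 y0 yn Msy ssy mM ln lL1).
  exact: (cell_mid sigma2 y0 yn Msy ssy nL mM nl lL1).
exact: (cell_top sigma2 y0 yn ssy nL rL mM lL1).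
Qed.

(** * Finite unions of events and telescoping sums *)

Section union_bounds.
Context d (T : measurableType d) (R : realType) (P : probability T R).

Lemma prb_le_sum (J : Type) (s : seq J) (A : set T) (B : J -> set T) :
  measurable A -> (forall j, measurable (B j)) ->
  (forall t, A t -> has (fun j => t \in B j) s) ->
  prb P A <= \sum_(j <- s) prb P (B j).
Proof.
move=> mA mB AB; rewrite -mean_indic//.
under eq_bigr do rewrite -mean_indic//.
rewrite -mean_sum; last by move=> j; exact: bmeas_indic.
apply: le_mean => [||t]; first exact: bmeas_indic.
  by apply: bmeas_sum => j; exact: bmeas_indic.
rewrite indicE; case: (boolP (t \in A)) => [|_]; last first.
  by apply: sumr_ge0 => j _; rewrite indicE.
rewrite inE => /AB; elim: s {AB} => [//|j s IH] /=; rewrite big_cons indicE.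
case: (t \in B j) => /= [_|/IH h].
  by rewrite lerDl sumr_ge0// => k _; rewrite indicE.
by rewrite add0r.
Qed.

Lemma sum_prb_le (J : eqType) (s : seq J) (A : set T) (B : J -> set T) :
  measurable A -> (forall j, measurable (B j)) -> uniq s ->
  (forall j, B j `<=` A) ->
  (forall j k t, j \in s -> k \in s -> B j t -> B k t -> j = k) ->
  \sum_(j <- s) prb P (B j) <= prb P A.
Proof.
move=> mA mB us BA dB; rewrite -mean_indic//.
under eq_bigr do rewrite -mean_indic//.
rewrite -mean_sum; last by move=> j; exact: bmeas_indic.
apply: le_mean => [||t]; last 1 first.
- have [/hasP[j js]|/hasPn nB] := boolP (has (fun j => t \in B j) s).
    move=> tBj; rewrite (bigD1_seq j)//= big_seq_cond big1 ?addr0.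
      rewrite !indicE tBj; suff -> : (t \in A) = true by [].
      by apply/mem_set/(BA j)/set_mem.
    move=> k /andP[ks kj]; rewrite indicE; case: (boolP (t \in B k)) => // tBk.
    by move: kj; rewrite (dB k j t) ?eqxx//; rewrite -inE.
  rewrite big_seq big1 ?indicE// => j /nB /negbTE tj.
  by rewrite indicE tj.
- by apply: bmeas_sum => j; exact: bmeas_indic.
- exact: bmeas_indic.
Qed.

End union_bounds.

Lemma telescope_iota (V : zmodType) (f : nat -> V) k :
  f k = f 0%N + \sum_(l <- iota 0 k) (f l.+1 - f l).
Proof.
elim: k => [|k IH]; first by rewrite big_nil addr0.
by rewrite -[in iota _ _]addn1 iotaD big_cat /= big_seq1 addrA add0n -IH addrC subrK.
Qed.

(** * The population of the invasion percolation cluster *)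

Section uniform_weights.
Context d (T : measurableType d) (R : realType) (P : probability T R) (sigma : nat).
Context (U : edge sigma -> {RV P >-> R}).
Hypothesis iidU : iid_uniform01 U.
Local Notation X := (fun e => U e : T -> R).
Local Notation sig := (sig X).
Local Notation w t := (fun e => U e t).

Lemma measurable_weight e : measurable_fun setT (X e).
Proof. exact: measurable_funPT. Qed.

Lemma indep_weights : mutually_independent P X.
Proof. exact: iidU.2. Qed.

Lemma sig_weight_le e q : sig [set e] [set t | U e t <= q].
Proof.
have mA : measurable [set x : R | x <= q].
  by rewrite (_ : [set x | x <= q] = `]-oo, q]%classic).
exact: (@sig_preimage _ _ _ _ _ X [set e] e _ _ mA).
Qed.

Lemma prb_weight_le e q : 0 <= q <= 1 -> prb P [set t | U e t <= q] = q.
Proof.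
move=> /andP[q0 q1]; have mA : measurable [set x : R | x <= q].
  by rewrite (_ : [set x | x <= q] = `]-oo, q]%classic).
have := iidU.1 e _ mA; rewrite /distribution /pushforward /prb /= => ->.
rewrite /uniform_prob integral_uniform_pdf.
have -> : [set x : R | x <= q] `&` `[0, 1] = `[0, q]%classic.
  apply/seteqP; split=> x /=; rewrite !in_itv /=; first by case=> -> /andP[-> _].
  by move=> /andP[x0 xq]; rewrite x0 xq (le_trans xq q1).
rewrite (eq_integral (fun=> 1%:E)); last first.
  move=> x; rewrite inE /= in_itv /= => /andP[x0 xq].
  by rewrite /uniform_pdf x0 (le_trans xq q1) subr0 invr1.
rewrite integral_cst//= mul1e lebesgue_measure_itv/= lte_fin.
by rewrite lt_neqAle q0 andbT; case: (eqVneq 0 q) => [<-|_] /=; rewrite ?subr0.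
Qed.

Lemma sig_weight_cmp (S : set (edge sigma)) e f : S e -> S f ->
  sig S [set t | U e t <= U f t].
Proof.
move=> Se Sf; split.
(* The same sample space with the sigma-algebra of the weights in [S], so that the comparison of two
   measurable real functions applies. *)
pose T2 := g_sigma_algebraType (rectangles X S).
have mU g : S g -> measurable_fun [set: T2] (U g : T2 -> R).
  by move=> Sg _ B mB; rewrite setTI; have [] := @sig_preimage _ _ _ _ _ X S g B Sg mB.
have : measurable_fun [set: T2] (fun t : T2 => U e t <= U f t).
  by apply: measurable_fun_ler; exact: mU.
by move=> /(_ measurableT [set true] Logic.I); rewrite setTI.
Qed.

Lemma sig_survives q v : sig (below v) [set t | survives (w t) q v].
Proof.
rewrite (_ : [set t | _] = \bigcap_k [set t | surv (fun e => U e t <= q) k v]).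
  apply: sig_bigcapT => k; apply: (sig_surv (o := fun e t => U e t <= q)) => e.
  exact: sig_weight_le.
by apply/seteqP; split=> t /= h k; [move=> _; exact: h|exact: h].
Qed.

(** [th] is a subsolution of a monotone recursion that starts at 1, so it stays below every iterate,
    and hence below the limit. *)
Lemma survp_ge (p th : R) n : 0 <= p <= 1 -> 0 <= th <= 1 ->
  th <= 1 - (1 - p * th) ^+ sigma -> th <= survp sigma p n <= 1.
Proof.
move=> /andP[p0 p1] /andP[th0 th1] thle.
have pow01 (x : R) : 0 <= x <= 1 -> 0 <= x ^+ sigma <= 1.
  by move=> /andP[x0 x1]; rewrite exprn_ge0// exprn_ile1.
have sub01 (x : R) : 0 <= x <= 1 -> 0 <= 1 - p * x <= 1.
  move=> /andP[x0 x1]; rewrite subr_ge0 lerBlDr lerDl mulr_ge0// andbT.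
  by rewrite mulr_ile1.
elim: n => [|n /andP[IH IH1]] /=; first by rewrite th1 lexx.
have q01 : 0 <= survp sigma p n <= 1 by rewrite IH1 (le_trans th0 IH).
have /andP[a0 a1] := sub01 _ q01; have /andP[b0 b1] := pow01 _ (sub01 _ q01).
rewrite lerBlDr lerDl b0 andbT (le_trans thle)// lerD2l lerN2.
by rewrite lerXn2r ?nnegrE ?lerD2l ?lerN2 ?ler_wpM2l// (le_trans a0)// lerD2l lerN2 ler_wpM2l.
Qed.

Lemma prb_survives_ge (q th : R) v : 0 <= q <= 1 -> 0 <= th <= 1 ->
  th <= 1 - (1 - q * th) ^+ sigma -> th <= prb P [set t | survives (w t) q v].
Proof.
move=> q01 th01 thle.
rewrite (_ : [set t | _] = \bigcap_k [set t | surv (fun e => U e t <= q) k v]); last first.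
  by apply/seteqP; split=> t /= h k; [move=> _; exact: h|exact: h].
have mS k : measurable [set t | surv (fun e => U e t <= q) k v].
  apply: (sig_measurable measurable_weight (S := below v)).
  by apply: (sig_surv (o := fun e t => U e t <= q)) => e; exact: sig_weight_le.
have nS : nonincreasing_seq (fun k => [set t | surv (fun e => U e t <= q) k v]).
  by move=> m n mn; apply/subsetPset => t; exact: leq_surv.
have /cvgr_to_ge := @prb_bigcap_cvg _ _ _ P _ mS nS; apply; apply: nearW => k.
rewrite (prb_surv measurable_weight indep_weights (o := fun e t => U e t <= q) (p := q)).
- by have /andP[] := survp_ge k q01 th01 thle.
- by move=> e; exact: sig_weight_le.
- by move=> e; exact: prb_weight_le.
Qed.

Section invasion_events.
Implicit Types (E : seq (edge sigma)).

(** The edges whose weights decide whether the invasion passes through the state [E]: those issuing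
    from a vertex of [E]. *)
Let W E : set (edge sigma) := [set e | e.1 \in vertices E].

Lemma sig_smallest E e : rooted E -> boundary E e ->
  sig (W E) [set t | Defs.smallest (w t) E e].
Proof.
move=> rE be; rewrite (_ : [set t | _] = [set t | forall f, f \in boundary_edges E ->
    [set t | U e t <= U f t] t]).
  apply: sig_bigcap_seq => f; rewrite mem_boundary_edges// => bf.
  by apply: sig_weight_cmp; [move: be|move: bf]; rewrite /W rooted_boundary// => /andP[].
apply/seteqP; split=> t /= => [[_ h] f|h].
  by rewrite mem_boundary_edges//; exact: h.
by split=> // f bf; apply: h; rewrite mem_boundary_edges.
Qed.

Lemma sig_invade E E' : rooted E -> sig (W E) [set t | invade (w t) E = E'].
Proof.
move=> rE; pose B := boundary_edges E.
pose h e t := `[< Defs.smallest (w t) E e >].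
(* The choice among ties is a function of the set of minimal edges, so the next state depends on
   finitely many comparisons. *)
pose g (l : seq bool) := if xget None (Some @` [set` mask l B]) is Some e
  then e :: E else E.
have gE t : invade (w t) E = g [seq h e t | e <- B].
  rewrite /g /invade -filter_mask.
  suff -> : [set` [seq e <- B | h e t]] = Defs.smallest (w t) E by [].
  apply/seteqP; split=> e /=; rewrite mem_filter.
    by case/andP=> /asboolP.
  move=> se; rewrite mem_boundary_edges//; have [-> _] := se.
  by rewrite andbT; apply/asboolP.
rewrite (_ : [set t | _] = [set t | exists2 b, b \in enum {: (size B).-tuple bool} &
    ([set _ | g (pattern B (of_pattern b)) = E'] `&` [set t | forall e, e \in B ->
        [set t | h e t = of_pattern b e] t]) t]).
  apply: sig_bigcup_seq => b _; apply: sigI; first exact: sig_cst.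
  apply: sig_bigcap_seq => e eB.
  have be : boundary E e by rewrite -mem_boundary_edges.
  rewrite (_ : [set t | h e t = _] = if of_pattern b e then
     [set t | Defs.smallest (w t) E e] else ~` [set t | Defs.smallest (w t) E e]).
    by case: ifP => _; [|apply: sigC]; exact: sig_smallest.
  apply/seteqP; split=> t /=; case: (of_pattern b e) => /=.
  - by move=> /asboolP.
  - by move=> /negbT/asboolPn.
  - by move=> ?; apply/asboolP.
  - by move=> ?; apply/negbTE/asboolPn.
apply/seteqP; split=> t /=; rewrite gE.
  move=> gE'; exists (pattern B (h ^~ t)); rewrite ?mem_enum//; split=> [|e eB].
    rewrite -gE'; congr g; apply/eq_in_map => e eB.
    by rewrite patternK.
  by rewrite patternK.
move=> [b _ [<- hb]]; congr g.
by apply/eq_in_map => e eB; exact: hb.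
Qed.

Lemma sig_invasion N E : sig (W E) [set t | invasion (w t) N = E].
Proof.
have WS E1 E2 : {subset E1 <= E2} -> W E1 `<=` W E2.
  by move=> E12 e; rewrite /W /=; exact: sub_vertices.
elim: N E => [|N IH] E.
  exact: (@sig_cst _ _ _ _ _ X (W E) ([::] = E)).
have key E' : {subset E' <= E} -> sig (W E)
    [set t | invasion (w t) N = E' /\ invade (w t) E' = E].
  move=> E'E; have [rE|nrE] := pselect (rooted E').
    by apply: sigI; [apply: (sig_sub (IH E'))|apply: (sig_sub (sig_invade E rE))]; exact: WS.
  rewrite (_ : [set t | _] = set0); first exact: sig_set0.
  by apply/seteqP; split=> // t [/= EE' _]; apply: nrE; rewrite -EE'; exact: rooted_invasion.
(* A step either stalls or adds one edge in front, so the predecessor of [E] is [E] or its tail. *)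
rewrite (_ : [set t | _] = [set t | invasion (w t) N = E /\ invade (w t) E = E] `|`
    [set t | invasion (w t) N = behead E /\ invade (w t) (behead E) = E]).
  by apply: sigU; apply: key => // e; exact: mem_behead.
apply/seteqP; split=> t.
  move=> E2; have {}E2 : invade (w t) (invasion (w t) N) = E by [].
  case: (invadeP (w t) (invasion (w t) N)) => [E1|[e _ E1]].
    by left; rewrite /= -{2}E2 -E2 !E1.
  by right; rewrite /= -E2 !E1.
by move=> h; change (invade (w t) (invasion (w t) N) = E); case: h => -[-> ->].
Qed.

End invasion_events.

Lemma measurable_reached x : measurable [set t | open_to (ipc (w t)) x].
Proof.
have mO : measurable [set c : subgraph sigma | open_to c x].
  apply: (measurable_depends_on (s := shallow (size x))) => c c' cc' /=.
  by rewrite (depends_on_open_to cc').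
have := @measurable_funPT _ _ _ _ (random_ipc U) measurableT _ mO.
by rewrite setTI.
Qed.

(** * Mean number of vertices reached under the caps *)

Section paths.
Variables (p th : nat -> R) (psi : nat -> nat -> R) (L M : nat) (al C : R).
Hypothesis sigma0 : (0 < sigma)%N.
Hypothesis p01 : forall l, 0 <= p l <= 1.
Hypothesis pL : p L = 1.
Hypothesis thP : forall l, 0 <= th l <= 1 - (1 - p l * th l) ^+ sigma.
Hypothesis th1 : forall l, th l <= 1.
Hypothesis psi_ge1 : forall l, 1 <= psi 0%N l.
Hypothesis psi_ge0 : forall m l, 0 <= psi m l.
Hypothesis psi_mono : forall m l, psi m l <= psi m l.+1.
Hypothesis p_mono : forall l, p l <= p l.+1.
Local Notation F := (fun m l => sigma%:R * p l * psi m l).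
Hypothesis psi0 : forall m, (m < M)%N -> F m 0%N <= psi m.+1 0%N.
Hypothesis psiS : forall m l, (m < M)%N -> (l < L)%N ->
  (1 - p l * th l) ^+ sigma.-1 * (F m l.+1 - F m l) <= psi m.+1 l.+1 - psi m.+1 l.

Lemma set_good l v i : [set t | good p (w t) l (v, i)] =
  [set t | U (v, i) t <= p l] `&` [set t | survives (w t) (p l) (i :: v)].
Proof.
apply/seteqP; split=> t; rewrite /= /good; first by move=> /andP[-> /asboolP].
by move=> [-> /asboolP].
Qed.

Lemma sig_good l v i : sig (branch v i) [set t | good p (w t) l (v, i)].
Proof.
rewrite set_good; apply: sigI.
  by apply: (sig_sub (@sig_weight_le (v, i) (p l))) => e ->; left.
by apply: (sig_sub (sig_survives (p l) (i :: v))) => e be; right.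
Qed.

Lemma prb_good_ge l v i : p l * th l <= prb P [set t | good p (w t) l (v, i)].
Proof.
rewrite set_good.
rewrite (indep_sig measurable_weight indep_weights (S := [set (v, i)]) (S' := below (i :: v))).
- rewrite prb_weight_le// ler_wpM2l//; first by case/andP: (p01 l).
  have /andP[t0 tle] := thP l.
  by apply: prb_survives_ge => //; rewrite t0 th1.
- by apply/seteqP; split=> // e [/= ->]; exact: edge_notin_below.
- exact: sig_weight_le.
- exact: sig_survives.
Qed.

Lemma escape_gtE t B e l : (l <= L)%N -> (l <= escape p L (w t) B e)%N <->
  forall k, k \in iota 0 l -> forall f, f \in [seq f <- B | f != e] -> ~ good p (w t) k f.
Proof.
move=> lL; split=> [le k|H].
  rewrite mem_iota add0n => /= kl f; rewrite mem_filter => /andP[fe fB].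
  exact/negP/(escape_min (leq_trans kl le) fB fe).
rewrite leqNgt; apply/negP => lt.
have [f [fB fe gf]] := escape_good (leq_trans lt lL).
by apply: (H _ _ f) gf; rewrite ?mem_filter ?fe// mem_iota.
Qed.

Lemma sig_escape_ge (S : set (edge sigma)) B e l : (l <= L)%N ->
  (forall f, f \in B -> f != e -> branch f.1 f.2 `<=` S) ->
  sig S [set t | (l <= escape p L (w t) B e)%N].
Proof.
move=> lL BS.
rewrite (_ : [set t | _] = [set t | forall k, k \in iota 0 l ->
   [set t | forall f, f \in [seq f <- B | f != e] -> (~` [set t | good p (w t) k f]) t] t]).
  apply: sig_bigcap_seq => k _; apply: sig_bigcap_seq => f.
  rewrite mem_filter => /andP[fe fB]; apply: sigC.
  by case: f fe fB => v i fe fB; apply: (sig_sub (sig_good k v i)); exact: (BS (v, i)).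
by apply/seteqP; split=> t; rewrite /= escape_gtE.
Qed.

Lemma sig_escape (S : set (edge sigma)) B e k :
  (forall f, f \in B -> f != e -> branch f.1 f.2 `<=` S) ->
  sig S [set t | escape p L (w t) B e = k].
Proof.
move=> BS; have [kL|Lk] := leqP k L; last first.
  rewrite (_ : [set t | _] = set0); first exact: sig_set0.
  apply/seteqP; split=> // t /= ek; move: Lk; rewrite -ek ltnNge.
  by rewrite escape_le.
have [kL'|Lk] := ltnP k L.
  rewrite (_ : [set t | _] = [set t | (k <= escape p L (w t) B e)%N] `&`
      ~` [set t | (k < escape p L (w t) B e)%N]).
    by apply: sigI; [|apply: sigC]; exact: sig_escape_ge.
  apply/seteqP; split=> t /=; first by move=> ->; rewrite leqnn ltnn.
  by move=> [h1 /negP]; rewrite -leqNgt => h2; apply/eqP; rewrite eqn_leq h2.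
rewrite (_ : [set t | _] = [set t | (k <= escape p L (w t) B e)%N]).
  exact: sig_escape_ge.
apply/seteqP; split=> t /=; first by move=> ->.
by move=> h; apply/eqP; rewrite eqn_leq h (leq_trans (escape_le _ _ _ _ _) Lk).
Qed.

(** An escape level above l prevents the sigma - 1 other children, which lie in independent
    branches, from being good at level l. *)
Lemma prb_escape_gt v i l : (l < L)%N ->
  prb P [set t | (l < escape p L (w t) (children v) (v, i))%N] <=
  (1 - p l * th l) ^+ sigma.-1.
Proof.
move=> lL; pose A j := ~` [set t | good p (w t) l (v, j)].
have sA j : sig (branch v j) (A j) by apply: sigC; exact: sig_good.
pose s := [seq j <- enum 'I_sigma | j != i].
have mE : measurable [set t | (l < escape p L (w t) (children v) (v, i))%N].
  by apply: (sig_measurable measurable_weight (S := setT)); exact: sig_escape_ge.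
have mA : measurable [set t | forall j, j \in s -> A j t].
  apply: (sig_measurable measurable_weight (S := setT)).
  by apply: sig_bigcap_seq => j _; apply: (sig_sub (sA j)).
apply: (@le_trans _ _ (prb P [set t | forall j, j \in s -> A j t])).
  apply: le_prb => // t /= le j; rewrite mem_filter => /andP[ji _].
  apply/negP; apply: (escape_min le); first exact: mem_children.
  by apply: contraNN ji => /eqP[->].
have us : uniq s by rewrite filter_uniq ?enum_uniq.
rewrite (prb_branches measurable_weight indep_weights us sA).
have <- : \prod_(j <- s) (1 - p l * th l) = (1 - p l * th l) ^+ sigma.-1.
  rewrite big_const_seq iter_mulr mulr1 count_predT; congr (_ ^+ _).
  rewrite size_filter; have := count_predC (pred1 i) (enum 'I_sigma).
  rewrite size_enum_ord count_uniq_mem ?enum_uniq// mem_enum /= => h.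
  exact: (congr1 predn h).
apply: ler_prod => j _; rewrite prb_ge0 /A prbC.
  by rewrite lerD2l lerN2 prb_good_ge.
by apply: (sig_measurable measurable_weight (S := branch v j)); exact: sig_good.
Qed.

(** No constraint at q = L, the value that stands for the absence of an escape; this agrees with p L
    = 1. *)
Let fits e q : set T := [set t | (q < L)%N ==> (U e t <= p q)].

Lemma sig_fits e q : sig [set e] (fits e q).
Proof.
rewrite /fits; case: (q < L)%N => /=; first exact: sig_weight_le.
by rewrite (_ : [set _ | _] = setT); [exact: sig_setT|apply/seteqP; split].
Qed.

Lemma prb_fits e q : (q <= L)%N -> prb P (fits e q) <= p q.
Proof.
rewrite /fits leq_eqVlt => /orP[/eqP ->|->]; last by rewrite /= prb_weight_le.
rewrite [X in _ <= X]pL; apply: prb_le1.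
exact: (sig_measurable measurable_weight (sig_fits e L)).
Qed.

(** Once the escape level j is fixed, the three conditions concern disjoint sets of edges: the
    sibling branches, the edge (y, i), and the subtree of its child. *)
Lemma passable_consE r y i k : [set t | passable p L (w t) (i :: r) y k] =
  [set t | exists2 j, j \in iota 0 L.+1 &
    ([set t | escape p L (w t) (children y) (y, i) = j] `&`
     (fits (y, i) (minn k j) `&` [set t | passable p L (w t) r (i :: y) (minn k j)])) t].
Proof.
apply/seteqP; split=> t /=.
  move=> /andP[wt pt]; exists (escape p L (w t) (children y) (y, i)) => //.
  by rewrite -[_ :: _]/(iota 0 L.+1) mem_iota add0n ltnS escape_le.
by move=> [j _ [-> [-> ->]]].
Qed.

Lemma sig_escape_children y i j :
  sig [set e | exists2 i', i' != i & branch y i' e]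
      [set t | escape p L (w t) (children y) (y, i) = j].
Proof.
apply: sig_escape => f /mapP[i' _ ->] fi e be; exists i' => //.
by apply: contraNN fi => /eqP ->.
Qed.

Lemma sig_passable r y k : sig (below y) [set t | passable p L (w t) r y k].
Proof.
elim: r y k => [|i r IH] y k.
  by rewrite (_ : [set _ | _] = setT); [exact: sig_setT|apply/seteqP; split].
rewrite passable_consE; apply: sig_bigcup_seq => j _; apply: sigI.
  by apply: (sig_sub (sig_escape_children y i j)) => e [i' _ /branch_below].
apply: sigI.
  by apply: (sig_sub (sig_fits (y, i) (minn k j))) => e ->; exact: below_refl.
by apply: (sig_sub (IH (i :: y) (minn k j))) => e; exact: below_cons.
Qed.

Let F_mono m l : F m l <= F m l.+1.
Proof.
have pl0 j : 0 <= p j by case/andP: (p01 j).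
by apply: ler_pM; rewrite ?mulr_ge0// ler_wpM2l.
Qed.

Let F_minn m k j : F m (minn k j) =
  F m 0%N + \sum_(l <- iota 0 k) (F m l.+1 - F m l) * (l < j)%:R.
Proof.
elim: k => [|k IH]; first by rewrite min0n big_nil addr0.
rewrite -addn1 iotaD big_cat /= big_seq1 addrA add0n -IH addn1.
have [kj|jk] := ltnP k j.
  by rewrite mulr1 (minn_idPl kj) addrC subrK.
by rewrite mulr0 addr0 (minn_idPr (leqW jk)).
Qed.

(* Summing by parts over the level of the siblings' escape: it exceeds l with
   probability at most (1 - p l * th l) ^+ sigma.-1, and psiS is the resulting
   recursion. *)
Lemma prb_passable r y k : (size r <= M)%N -> (k <= L)%N ->
  sigma%:R ^+ size r * prb P [set t | passable p L (w t) r y k] <= psi (size r) k.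
Proof.
elim: r y k => [|i r IH] y k rM kL.
  rewrite mul1r; apply: le_trans (psi_ge1 k); apply: prb_le1.
  by apply: (sig_measurable measurable_weight); exact: (sig_passable [::] y k).
have {}rM : (size r < M)%N by [].
set m := size r; pose A j := [set t | escape p L (w t) (children y) (y, i) = j].
pose Q j := fits (y, i) (minn k j) `&` [set t | passable p L (w t) r (i :: y) (minn k j)].
have sQ j : sig (branch y i) (Q j).
  apply: sigI; first by apply: (sig_sub (sig_fits (y, i) (minn k j))) => e ->; left.
  by apply: (sig_sub (sig_passable r (i :: y) (minn k j))) => e; right.
have mA j : measurable (A j).
  by apply: (sig_measurable measurable_weight); exact: sig_escape_children.
have mQ j : measurable (Q j) by apply: (sig_measurable measurable_weight); exact: sQ.
have prQ j : prb P (A j `&` Q j) = prb P (A j) * prb P (Q j).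
  apply: (indep_sig measurable_weight indep_weights _ (sig_escape_children y i j) (sQ j)).
  apply/seteqP; split=> // e [[i' i'i b'] b].
  by rewrite -(@branch_disjoint _ y i' i i'i).
have prQ2 j : prb P (Q j) <= p (minn k j) * prb P [set t | passable p L (w t) r (i :: y) (minn k j)].
  rewrite (indep_sig measurable_weight indep_weights _ (@sig_fits (y, i) (minn k j))
    (sig_passable r (i :: y) (minn k j))).
    by rewrite ler_wpM2r ?prb_ge0// prb_fits// geq_min kL.
  by apply/seteqP; split=> // e [/= ->]; exact: edge_notin_below.
apply: (@le_trans _ _ (\sum_(j <- iota 0 L.+1) prb P (A j) * F m (minn k j))).
  have -> : size (i :: r) = m.+1 by [].
  apply: (@le_trans _ _ (sigma%:R ^+ m.+1 * \sum_(j <- iota 0 L.+1) prb P (A j `&` Q j))).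
    rewrite ler_wpM2l ?exprn_ge0//; apply: prb_le_sum => [|j|t].
    - by apply: (sig_measurable measurable_weight); exact: (sig_passable (i :: r) y k).
    - exact: measurableI.
    - move=> pt; have : [set t | passable p L (w t) (i :: r) y k] t by [].
      rewrite passable_consE => -[j jL AQ]; apply/hasP; exists j => //.
      by rewrite inE.
  rewrite mulr_sumr; apply: ler_sum => j _; rewrite prQ mulrCA ler_wpM2l ?prb_ge0//.
  rewrite exprSr -[X in X <= _]mulrA; apply: (@le_trans _ _ (sigma%:R ^+ m * (sigma%:R *
      (p (minn k j) * prb P [set t | passable p L (w t) r (i :: y) (minn k j)])))).
    by rewrite ler_wpM2l ?exprn_ge0// ler_wpM2l.
  have := IH (i :: y) (minn k j) (ltnW rM); rewrite geq_min kL => /(_ isT) h.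
  have sp : 0 <= sigma%:R * p (minn k j) by rewrite mulr_ge0//; case/andP: (p01 (minn k j)).
  have := ler_wpM2l sp h; rewrite -/m; set u := _ ^+ m; set v := prb P _; lra.
under eq_bigr do rewrite F_minn mulrDr mulr_sumr.
rewrite big_split /= exchange_big /= -mulr_suml.
have psiE : psi m.+1 k = psi m.+1 0%N + \sum_(l <- iota 0 k) (psi m.+1 l.+1 - psi m.+1 l).
  exact: (telescope_iota (psi m.+1)).
have uL : uniq (iota 0 L.+1) := iota_uniq _ _.
rewrite -/m psiE; apply: lerD.
  apply: le_trans (psi0 rM); rewrite ler_piMl//.
    by rewrite mulr_ge0// mulr_ge0//; case/andP: (p01 0).
  rewrite -(prb_setT P); apply: sum_prb_le => // j j' t _ _.
  by rewrite /A /= => -> ->.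
rewrite big_seq [X in _ <= X]big_seq; apply: ler_sum => l; rewrite mem_iota add0n => /= lk.
have lL : (l < L)%N := leq_trans lk kL.
apply: le_trans (psiS rM lL).
have -> : \sum_(j <- iota 0 L.+1) prb P (A j) * ((F m l.+1 - F m l) * (l < j)%:R) =
    (\sum_(j <- iota 0 L.+1) prb P (if (l < j)%N then A j else set0)) * (F m l.+1 - F m l).
  rewrite mulr_suml; apply: eq_bigr => j _; case: ifP => _; first by rewrite mulr1.
  by rewrite prb_set0 !mulr0 mul0r.
rewrite ler_wpM2r ?subr_ge0//; apply: le_trans (prb_escape_gt y i lL).
apply: sum_prb_le => //.
- by apply: (sig_measurable measurable_weight (S := setT)); exact: sig_escape_ge.
- by move=> j; case: ifP.
- by move=> j; case: ifP => [lj t|_ t []]; rewrite /A /= => ->.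
- move=> j j' t _ _; case: ifP => [_ Aj|_ //]; case: ifP => [_ Aj'|_ //].
  by rewrite -[j]Aj -[j']Aj'.
Qed.

Hypothesis al0 : 0 <= al.
Hypothesis C0 : 0 <= C.
Hypothesis th0 : th 0%N = 0.
Hypothesis psi_le : forall m l, psi m l <= al * m%:R * th l + C.
Hypothesis mesh_p : forall l, M%:R * (p l.+1 - p l) <= 1.
Hypothesis mesh_th : forall l, M%:R * (th l.+1 - th l) <= 1.

Section star.
Variables (N : nat) (E : seq (edge sigma)).
Hypothesis rE : rooted E.

Let B := boundary_edges E.
Let G : set T := [set t | invasion (w t) N = E].
Let K e k : set T := [set t | escape p L (w t) B e = k].
(** With k = j.+1, the edge [e] escapes at level j whereas the other boundary edges do not before
    j.+1. For k = 0 there is no lower level, and the corresponding term vanishes because th 0 =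
    0. *)
Let D e k : set T := if k is j.+1 then G `&` (K e k `&` [set t | good p (w t) j e]) else set0.

(** If two such branches met, one edge would descend from the other. The parent end of the lower one
    lies in [E], so rootedness would put the child end of the upper one in [E] as well. *)
Lemma branch_boundary e f : e \in B -> f \in B -> f != e ->
  branch f.1 f.2 `<=` ~` branch e.1 e.2.
Proof.
have suffix (g h : edge sigma) : branch h.1 h.2 g -> exists z, child_end g = z ++ child_end h.
  by case=> [->|[z gz]]; [exists [::]; case: h|exists (g.2 :: z); rewrite /child_end gz].
have diff g h u i : g \in B -> h \in B -> child_end g = i :: u ++ child_end h -> False.
  rewrite !mem_boundary_edges// !rooted_boundary// => /andP[pg _] /andP[_ /negP nh].
  by move=> [_ gu]; apply: nh; apply: (rooted_suffix (z := u)) => //; rewrite -gu.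
have case2 g h u : g \in B -> h \in B -> child_end g = u ++ child_end h -> g = h.
  case: u => [_ _|i u gB hB]; last by move=> /(diff _ _ _ _ gB hB).
  by case: g => v i; case: h => v' i' [-> ->].
move=> eB fB fe g /suffix[z gf] /suffix[z' ge].
have zz : z ++ child_end f = z' ++ child_end e by rewrite -gf.
have [le|/ltnW le] := leqP (size z) (size z').
  move: zz; rewrite -(cat_take_drop (size z) z') -catA => /eqP.
  rewrite eqseq_cat ?size_takel// => /andP[_ /eqP /(case2 _ _ _ fB eB) E1].
  by rewrite E1 eqxx in fe.
move: zz; rewrite -(cat_take_drop (size z') z) -catA => /esym/eqP.
rewrite eqseq_cat ?size_takel// => /andP[_ /eqP /(case2 _ _ _ eB fB) E1].
by rewrite E1 eqxx in fe.
Qed.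

(** All edges except those beyond [e]; the edge [e] itself is included, since its weight takes part
    in the choice of the next state. *)
Let away e : set (edge sigma) := ~` below (child_end e).

Let below_branch (e : edge sigma) : below (child_end e) `<=` branch e.1 e.2.
Proof. by move=> f; right. Qed.

Let sig_G e : e \in B -> sig (away e) G.
Proof.
move=> eB; apply: (sig_sub (sig_invasion N E)) => f fE [z fz]; move: eB.
rewrite mem_boundary_edges// rooted_boundary// => /andP[_ /negP]; apply.
by apply: (rooted_suffix (z := z)) => //; rewrite -fz.
Qed.

Let sig_K (e : edge sigma) k : e \in B -> sig (~` branch e.1 e.2) (K e k).
Proof. by move=> eB; apply: sig_escape => f fB fe; exact: branch_boundary. Qed.

Let sig_K' e k : e \in B -> sig (away e) (K e k).
Proof. by move=> eB; apply: (sig_sub (sig_K k eB)) => f; apply: contra_not; exact: below_branch. Qed.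

Let e_away (e : edge sigma) : away e e.
Proof. by case: e => v i; exact: edge_notin_below. Qed.

Let sig_fits' e k : sig (away e) (fits e k).
Proof. by apply: (sig_sub (sig_fits e k)) => f ->; exact: e_away. Qed.

Let meas (S : set (edge sigma)) A : sig S A -> measurable A.
Proof. exact: (sig_measurable measurable_weight). Qed.

Let mG : measurable G. Proof. exact: meas (sig_invasion N E). Qed.

Let mK e k : measurable (K e k).
Proof. by apply: (@meas setT); apply: sig_escape. Qed.

Let mfits e k : measurable (fits e k). Proof. exact: meas (sig_fits e k). Qed.

Let mgood e l : measurable [set t | good p (w t) l e].
Proof. by case: e => v i; exact: meas (sig_good l v i). Qed.

Let mD e k : measurable (D e k).
Proof.
case: k => [|k]; first exact: measurable0.
by apply: measurableI => //; apply: measurableI.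
Qed.

Let g e k := prb P (G `&` (K e k `&` fits e k)).

Let mg e k : measurable (G `&` (K e k `&` fits e k)).
Proof. by apply: measurableI => //; apply: measurableI. Qed.

Lemma sum_g e : \sum_(k <- iota 0 L.+1) g e k <= 1.
Proof.
rewrite -(prb_setT P); apply: sum_prb_le => //; first exact: iota_uniq.
by move=> j k t _ _ [_ [+ _]] [_ [+ _]]; rewrite /K /= => -> ->.
Qed.

Lemma sum_K e : \sum_(k <- iota 0 L.+1) prb P (K e k) <= 1.
Proof.
rewrite -(prb_setT P); apply: sum_prb_le => //; first exact: iota_uniq.
by move=> j k t _ _; rewrite /K /= => -> ->.
Qed.

(* On D e k, the edge e is good at a lower level than any other boundary edge,
   so these events are disjoint. *)
Lemma sum_D : \sum_(e <- B) \sum_(k <- iota 0 L.+1) prb P (D e k) <= prb P G.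
Proof.
have -> : \sum_(e <- B) \sum_(k <- iota 0 L.+1) prb P (D e k) =
    \sum_(ek <- [seq (e, k) | e <- B, k <- iota 0 L.+1]) prb P (D ek.1 ek.2).
  by rewrite big_allpairs_dep.
apply: sum_prb_le => //.
- apply: allpairs_uniq => //; [exact: undup_uniq|exact: iota_uniq|].
  by move=> [e k] [e' k'] _ _ [-> ->].
- by move=> [e [|k]] t //= [].
have inB e k : (e, k) \in [seq (e, k) | e <- B, k <- iota 0 L.+1] -> e \in B.
  by move=> /allpairsP[[e1 k1] [/= eB _ [-> _]]].
move=> [e1 k1] [e2 k2] t /inB eB /inB eB'.
case: k1 => // k1; case: k2 => // k2 /= [_ [Ke ge]] [_ [Ke' ge']].
have key f f' (i i' : nat) : f \in B -> f' \in B -> f != f' -> (i <= i')%N ->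
    K f' i'.+1 t -> good p (w t) i f -> False.
  move=> fB f'B ff' ii' Kf' gf; apply/negP: gf.
  by apply: (@escape_min _ _ p L (w t) B f'); rewrite // Kf' ltnS.
have [ee|ee] := eqVneq e1 e2; last first.
  have [kk|/ltnW kk] := leqP k1 k2; first by case: (key e1 e2 k1 k2).
  by case: (key e2 e1 k2 k1); rewrite // eq_sym.
by congr pair => //; rewrite -Ke -Ke' ee.
Qed.

(* Given all weights outside the subtree of e, the edge e is good at level k - 1
   with probability about p k.-1 * th k.-1, which the mesh conditions allow to be
   replaced by p k * th k. *)
Lemma g_le e k : e \in B -> k \in iota 0 L.+1 ->
  M%:R * (g e k * th k) <= M%:R * prb P (D e k) + g e k + prb P (K e k).
Proof.
move=> eB; rewrite mem_iota add0n ltnS => /= kL.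
have th00 l : 0 <= th l by case/andP: (thP l).
case: k kL => [|j] jL; first by rewrite th0 mulr0 mulr0 !addr_ge0 ?mulr_ge0 ?prb_ge0.
set k := j.+1; set V := [set t | U e t <= p j].
have sV : sig [set e] V by exact: sig_weight_le.
have mV := meas sV.
have Vfits : V `<=` fits e k.
  by move=> t; rewrite /V /fits /= => Vt; apply/implyP => _; exact: le_trans (p_mono j).
have prV : prb P (fits e k `\` V) <= p k - p j.
  have -> : prb P (fits e k `\` V) = prb P (fits e k) - p j.
    apply/eqP; rewrite eq_sym subr_eq addrC -{1}(prb_weight_le e (p01 j)) -/V -prbU//.
    - by rewrite setDUK.
    - exact: measurableD.
    - by rewrite setDIK.
  by rewrite lerD2r prb_fits.
(* Lowering the cap on the weight of [e] by one level costs at most p k - p j. In this error term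
   [G] is dropped, as it may depend on that weight, while [K e k] is independent of it. *)
have gV : g e k <= prb P (G `&` (K e k `&` V)) + prb P (K e k) * (p k - p j).
  apply: (@le_trans _ _ (prb P (G `&` (K e k `&` V)) + prb P (K e k `&` (fits e k `\` V)))).
    have m1 : measurable (G `&` (K e k `&` V)) by apply: measurableI => //; exact: measurableI.
    have m2 : measurable (K e k `&` (fits e k `\` V)) by apply: measurableI => //; exact: measurableD.
    rewrite -prbU//.
      apply: le_prb => //; first exact: measurableU.
      move=> t [Gt [Kt ft]]; have [Vt|nVt] := pselect (V t); [left|right]; split=> //.
    by apply/seteqP; split=> // t [[_ [_ Vt]] [_ [_ nVt]]]; exact: nVt.
  rewrite lerD2l (indep_sig measurable_weight indep_weights _ (sig_K k eB)
    (sigI (sig_fits e k) (sigC sV))).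
    by rewrite ler_wpM2l ?prb_ge0.
  by apply/seteqP; split=> // f [/= nb fe]; apply: nb; rewrite fe; left; case: (e).
(* The subtree beyond [e] is independent of the other conditions and leads to infinity at level j
   with probability at least th j. *)
have DE : prb P (G `&` (K e k `&` V)) * th j <= prb P (D e k).
  apply: (@le_trans _ _ (prb P (G `&` (K e k `&` V)) *
      prb P [set t | survives (w t) (p j) (child_end e)])).
    rewrite ler_wpM2l ?prb_ge0//; apply: prb_survives_ge => //; first by rewrite th00 th1.
    by case/andP: (thP j).
  rewrite -(indep_sig measurable_weight indep_weights (S := away e) (S' := below (child_end e))).
  - apply: le_prb.
    + apply: measurableI; first by apply: measurableI => //; exact: measurableI.
      exact: meas (sig_survives _ _).
    + exact: (mD e k).
    + by move=> t [[Gt [Kt Vt]] st]; do 2 split=> //; apply/andP; split=> //; apply/asboolP.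
  - by rewrite /away setICl.
  - apply: sigI; first exact: sig_G.
    by apply: sigI; [exact: sig_K'|apply: (sig_sub sV) => f ->; exact: e_away].
  - exact: sig_survives.
have M0 : 0 <= M%:R :> R by [].
have g0 : 0 <= g e k by exact: prb_ge0.
have K0 : 0 <= prb P (K e k) by exact: prb_ge0.
have a1 : M%:R * (g e k * (th k - th j)) <= g e k.
  by rewrite mulrCA ler_piMr// mesh_th.
have a2 : M%:R * (prb P (K e k) * (p k - p j)) <= prb P (K e k).
  by rewrite mulrCA ler_piMr// mesh_p.
have a3 : M%:R * (g e k * th j) <= M%:R * (prb P (D e k) + prb P (K e k) * (p k - p j)).
  rewrite ler_wpM2l//; apply: (le_trans (ler_wpM2r (th00 j) gV)); rewrite mulrDl lerD//.
  by rewrite ler_piMr ?th1// mulr_ge0// subr_ge0.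
by lra.
Qed.

(** Splitting by the escape level k, every condition except [passable] is decided away from the
    subtree beyond [e]; the supersolution then bounds the remaining factor. *)
Lemma reach_le e r : e \in B -> (size r <= M)%N ->
  sigma%:R ^+ size r * prb P (G `&` [set t | open_to (ipc (w t)) (catrev r (child_end e))])
  <= \sum_(k <- iota 0 L.+1) g e k * (al * M%:R * th k + C).
Proof.
move=> eB rM.
pose Q k := [set t | passable p L (w t) r (child_end e) k].
have mQ k : measurable (Q k) by exact: meas (sig_passable r (child_end e) k).
have mO := measurable_reached (catrev r (child_end e)).
apply: (@le_trans _ _ (sigma%:R ^+ size r * \sum_(k <- iota 0 L.+1)
    prb P ((G `&` (K e k `&` fits e k)) `&` Q k))).
  rewrite ler_wpM2l ?exprn_ge0//; apply: prb_le_sum.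
  - exact: measurableI.
  - by move=> k; exact: measurableI.
  move=> t [Gt ot]; apply/hasP; exists (escape p L (w t) B e).
    by rewrite mem_iota add0n ltnS escape_le.
  have be : boundary (invasion (w t) N) e by rewrite Gt -mem_boundary_edges.
  have := boundary_ipc p L be ot; rewrite Gt -/B => /andP[h1 h2].
  by rewrite inE; split=> //; split.
rewrite mulr_sumr big_seq [X in _ <= X]big_seq; apply: ler_sum => k.
rewrite mem_iota add0n ltnS => /= kL.
rewrite (indep_sig measurable_weight indep_weights (S := away e) (S' := below (child_end e))).
- rewrite -/(g e k) mulrCA ler_wpM2l ?prb_ge0//.
  apply: (le_trans (prb_passable (child_end e) rM kL)); apply: (le_trans (psi_le _ _)).
  rewrite lerD2r ler_wpM2r//; first by case/andP: (thP k).
  by rewrite ler_wpM2l// ler_nat.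
- by rewrite /away setICl.
- by apply: sigI; [exact: sig_G|apply: sigI; [exact: sig_K'|exact: sig_fits']].
- exact: sig_passable.
Qed.

Lemma reach_level_le : (forall v, v \in vertices E -> (size v < M)%N) ->
  \sum_(x <- level M) prb P (G `&` [set t | open_to (ipc (w t)) x]) <=
  al * M%:R * prb P G + (size B)%:R * (2 * al + C).
Proof.
move=> sE.
pose h e r := prb P (G `&` [set t | open_to (ipc (w t)) (catrev r (child_end e))]).
have h0 e r : 0 <= h e r by exact: prb_ge0.
have sB e : e \in B -> (size (child_end e) <= M)%N.
  by rewrite mem_boundary_edges// rooted_boundary// => /andP[/sE].
have size_catrev (r y : seq 'I_sigma) : size (catrev r y) = (size r + size y)%N.
  by rewrite catrevE size_cat size_rev.
apply: (@le_trans _ _ (\sum_(e <- B) \sum_(r <- level (M - size (child_end e))) h e r)).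
  apply: (@le_trans _ _ (\sum_(x <- level M) \sum_(e <- B)
      \sum_(r <- level (M - size (child_end e))) h e r * (catrev r (child_end e) == x)%:R)).
    rewrite big_seq [X in _ <= X]big_seq; apply: ler_sum => x; rewrite mem_level => /eqP xM.
    have xE : x \notin vertices E by apply/negP => /sE; rewrite xM ltnn.
    (* With all edges open, [exit_edge] only expresses the position of [x] relative to [E]. *)
    have ox : open_to (fun=> true) x by elim: (x).
    have [e [r [be xr]]] := exit_edge rE ox xE.
    have eB : e \in B by rewrite mem_boundary_edges.
    have rl : r \in level (M - size (child_end e)).
      by rewrite mem_level -xM xr size_catrev addnK.
    have -> : prb P (G `&` [set t | open_to (ipc (w t)) x]) =
        h e r * (catrev r (child_end e) == x)%:R by rewrite /h xr eqxx mulr1.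
    rewrite (bigD1_seq e) ?undup_uniq//= (bigD1_seq r) ?level_uniq//=.
    rewrite -addrA lerDl addr_ge0//.
      by apply: sumr_ge0 => r' _; rewrite mulr_ge0.
    by apply: sumr_ge0 => e' _; apply: sumr_ge0 => r' _; rewrite mulr_ge0.
  rewrite exchange_big /=; apply: ler_sum => e _.
  rewrite exchange_big /=; apply: ler_sum => r _.
  rewrite -mulr_sumr ler_piMr//.
  have [xl|xl] := boolP (catrev r (child_end e) \in level M).
    rewrite (bigD1_seq _ xl) ?level_uniq//= eqxx big1 ?addr0// => x.
    by rewrite eq_sym => /negbTE ->.
  rewrite big_seq big1 ?ler01// => x xM; case: eqP => // rx.
  by rewrite rx xM in xl.
have sigma0' : 0 < sigma%:R :> R by rewrite ltr0n.
apply: (@le_trans _ _ (\sum_(e <- B) \sum_(k <- iota 0 L.+1) g e k * (al * M%:R * th k + C))).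
  rewrite big_seq [X in _ <= X]big_seq; apply: ler_sum => e eB.
  set j := (M - _)%N.
  have hr r : r \in level j -> h e r <= (sigma%:R ^+ j)^-1 *
      \sum_(k <- iota 0 L.+1) g e k * (al * M%:R * th k + C).
    rewrite mem_level => /eqP rj; rewrite mulrC ler_pdivlMr ?exprn_gt0// mulrC -rj.
    by apply: reach_le => //; rewrite rj leq_subr.
  (* There are sigma^j paths of length j beyond [e], which cancels the normalisation. *)
  rewrite big_seq; apply: (le_trans (ler_sum _ hr)).
  rewrite -big_seq big_const_seq count_predT size_level iter_addr addr0 -[X in X <= _]mulr_natl natrX.
  by rewrite mulrA divff ?mul1r// gt_eqF// exprn_gt0.
(* Each boundary edge contributes [al] for each of the two error terms of [g_le], and [C] for the
   intercept of psi. *)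
apply: (@le_trans _ _ (\sum_(e <- B) (al * M%:R * \sum_(k <- iota 0 L.+1) prb P (D e k)
    + (2 * al + C)))); last first.
  rewrite big_split /= -mulr_sumr big_const_seq count_predT iter_addr addr0.
  rewrite -[_ *+ size B]mulr_natl; apply: lerD => //.
  by apply: ler_wpM2l sum_D; rewrite mulr_ge0.
rewrite big_seq [X in _ <= X]big_seq; apply: ler_sum => e eB.
apply: (@le_trans _ _ (\sum_(k <- iota 0 L.+1)
   (al * (M%:R * prb P (D e k) + g e k + prb P (K e k)) + C * g e k))).
  rewrite big_seq [X in _ <= X]big_seq; apply: ler_sum => k kL.
  have := ler_wpM2l al0 (g_le eB kL); set u := g e k; set v := prb P (D e k).
  by set z := prb P (K e k); lra.
rewrite big_split /= -!mulr_sumr !big_split /= -mulr_sumr.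
have := ler_wpM2l al0 (sum_g e); have := ler_wpM2l C0 (sum_g e).
have := ler_wpM2l al0 (sum_K e).
set u := \sum_(_ <- _) g _ _; set v := \sum_(_ <- _) prb P (K _ _).
by set z := \sum_(_ <- _) prb P (D _ _); lra.
Qed.

End star.

End paths.

End uniform_weights.

(** * Weighted mean population under the law of the invasion cluster *)

Section invasion_population.
Context d (T : measurableType d) (R : realType) (P : probability T R) (sigma : nat).
Context (U : edge sigma -> {RV P >-> R}).
Hypothesis sigma2 : (2 <= sigma)%N.
Hypothesis iidU : iid_uniform01 U.
Local Notation w t := (fun e => U e t).
Local Notation al := (3 / 4 * (1 - sigma%:R^-1) : R).
Local Notation Z := (@population sigma R).
Implicit Types (f : subgraph sigma -> R).

Let measurable_invasion N E : measurable [set t | invasion (w t) N = E].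
Proof. by have := sig_measurable (measurable_weight U) (sig_invasion U N E). Qed.

Let bmeas_ipc f : bmeas f -> bmeas (fun t => f (ipc (w t))).
Proof.
move=> [mf [A fA]]; split; last by exists A => t; exact: fA.
exact: (measurableT_comp mf (@measurable_funPT _ _ _ _ (random_ipc U))).
Qed.

Lemma mean_ipc_law f : bmeas f -> (forall c, 0 <= f c) ->
  mean (ipc_law U) f = mean P (fun t => f (ipc (w t))).
Proof.
move=> [mf _] f0; rewrite /mean /Rintegral; congr fine.
rewrite ge0_integral_distribution//.
exact/measurable_EFinP.
Qed.

(** A finite list containing all states possible after N steps; it turns functions of the state into
    finite sums of indicators. *)
Fixpoint reachable N : seq (seq (edge sigma)) :=
  if N is N'.+1 then
    reachable N' ++ [seq e :: E | E <- reachable N', e <- boundary_edges E]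
  else [:: [::]].

Lemma invasion_reachable (u : edge sigma -> R) N : invasion u N \in reachable N.
Proof.
elim: N => [|N IH]; first by rewrite mem_head.
rewrite invasionS /= mem_cat; case: (invadeP u (invasion u N)) => [->|[e [be _] ->]].
  by rewrite IH.
apply/orP; right; apply/allpairsPdep; exists (invasion u N), e; split=> //.
by rewrite mem_boundary_edges//; exact: rooted_invasion.
Qed.

Lemma sum_reachable N (F : seq (edge sigma) -> R) t :
  F (invasion (w t) N) = \sum_(E <- undup (reachable N))
    F E * \1_[set t | invasion (w t) N = E] t.
Proof.
rewrite (bigD1_seq (invasion (w t) N)) ?undup_uniq ?mem_undup ?invasion_reachable//=.
rewrite indicE mem_set// mulr1 big1 ?addr0// => E nE.
by rewrite indicE memNset ?mulr0// => /= h; rewrite h eqxx in nE.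
Qed.

Lemma bmeas_invasion N (F : seq (edge sigma) -> R) : bmeas (fun t => F (invasion (w t) N)).
Proof.
under eq_fun do rewrite sum_reachable; apply: bmeas_sum => E; apply: bmeasZ.
exact: bmeas_indic.
Qed.

Let G N E : set T := [set t | invasion (w t) N = E].

Let mG N E : measurable (G N E). Proof. exact: measurable_invasion. Qed.

Lemma reach_level_bound N E : exists2 k : R, 0 <= k & forall m, (N < m)%N ->
  mean P (fun t => \1_(G N E) t * Z m (ipc (w t))) <= al * m%:R * prb P (G N E) + k.
Proof.
have mGO x : measurable (G N E `&` [set t | open_to (ipc (w t)) x]).
  by apply: measurableI; [exact: measurable_invasion|exact: measurable_reached].
have meanE m : mean P (fun t => \1_(G N E) t * Z m (ipc (w t))) =
    \sum_(x <- level m) prb P (G N E `&` [set t | open_to (ipc (w t)) x]).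
  transitivity (mean P (fun t => \sum_(x <- level m)
      \1_(G N E `&` [set t | open_to (ipc (w t)) x]) t)).
    congr mean; apply/funext => t; rewrite /population mulr_sumr.
    apply: eq_bigr => x _; rewrite !indicE in_setI.
    case: (t \in _); last by rewrite mul0r.
    by rewrite mul1r /=; congr (nat_of_bool _)%:R; apply/idP/idP; rewrite inE.
  rewrite mean_sum => [|x]; last exact/bmeas_indic/mGO.
  by apply: eq_bigr => x _; rewrite mean_indic.
have [[t0 Gt0]|nG] := pselect (exists t, G N E t); last first.
  exists 0 => // m _; have -> : G N E = set0.
    by apply/seteqP; split=> // t Gt; apply: nG; exists t.
  rewrite prb_set0 mulr0 addr0; under [X in mean P X]eq_fun do rewrite indic0 mul0r.
  by rewrite mean_cst.
have rE : rooted E by rewrite -Gt0; exact: rooted_invasion.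
have sE v : v \in vertices E -> (size v <= N)%N by rewrite -Gt0; exact: size_invasion.
have s2 : 2 <= sigma%:R :> R by rewrite ler_nat.
have al0 : 0 <= al.
  by rewrite mulr_ge0// subr_ge0 invf_le1; lra.
exists ((size (boundary_edges E))%:R * (2 * al + (16 * sigma%:R + 1))) => [|m Nm].
  by rewrite mulr_ge0// !addr_ge0 ?mulr_ge0//; lra.
(* The levels are chosen anew for each height m, whereas the constant above involves only sigma and
   the boundary of [E]. *)
have [L [p [th [psi /= [[pL th0 th1 p01] thP [p_mono mesh_p mesh_th]
  [psi_ge1 psi_ge0 psi_mono psi_le] psiS]]]]] := exists_levels R sigma2 m.
rewrite meanE; apply: (reach_level_le iidU (p := p) (th := th) (psi := psi) (L := L)) => //.
- exact: leq_trans sigma2.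
- by move=> k km; have [] := psiS k km.
- by move=> k l km lL; have [_] := psiS k km; exact.
- by move=> v /sE vN; exact: leq_ltn_trans Nm.
Qed.

Lemma mean_invasion_population N (F : seq (edge sigma) -> R) : (forall E, 0 <= F E) ->
  exists k : R, forall m, (N < m)%N ->
  mean P (fun t => F (invasion (w t) N) * Z m (ipc (w t))) <=
  al * m%:R * mean P (fun t => F (invasion (w t) N)) + k.
Proof.
move=> F0.
pose k E := projT1 (cid2 (reach_level_bound N E)).
have [k0 kP] : (forall E, 0 <= k E) /\ forall E m, (N < m)%N ->
    mean P (fun t => \1_(G N E) t * Z m (ipc (w t))) <= al * m%:R * prb P (G N E) + k E.
  by split=> E; rewrite /k; case: (cid2 _).
exists (\sum_(E <- undup (reachable N)) F E * k E) => m Nm.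
have bZ E : bmeas (fun t => \1_(G N E) t * Z m (ipc (w t))).
  apply: bmeasM; first exact/bmeas_indic/mG.
  exact: bmeas_ipc (bmeas_depends_on (@depends_on_population _ _ m)).
have -> : (fun t => F (invasion (w t) N) * Z m (ipc (w t))) =
    (fun t => \sum_(E <- undup (reachable N)) F E * (\1_(G N E) t * Z m (ipc (w t)))).
  apply/funext => t; rewrite sum_reachable mulr_suml.
  by apply: eq_bigr => E _; rewrite mulrA.
have -> : (fun t => F (invasion (w t) N)) =
    (fun t => \sum_(E <- undup (reachable N)) F E * \1_(G N E) t).
  by apply/funext => t; exact: sum_reachable.
rewrite !mean_sum => [|E|E]; [|exact/bmeasZ/bmeas_indic/mG|exact: bmeasZ].
rewrite mulr_sumr -big_split /=; apply: ler_sum => E _.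
rewrite !meanZ//; last exact/bmeas_indic/mG.
rewrite (mean_indic _ (mG N E)) mulrCA -mulrDr; apply: ler_wpM2l => //.
exact: kP.
Qed.

(** The invasion may return to low levels at a late stage; on this event stage N already contains
    all that it will ever use of the first n levels. *)
Let A n N : set T := [set t | forall k e, e \in shallow n ->
  e \in invasion (w t) k -> e \in invasion (w t) N].

Let measurable_A n N : measurable (A n N).
Proof.
apply: (sig_measurable (measurable_weight U) (S := setT)).
have sI k e : sig (fun e => U e : T -> R) setT [set t | e \in invasion (w t) k].
  rewrite (_ : [set t | _] = [set t | exists2 E, E \in reachable k &
      ([set t | invasion (w t) k = E] `&` [set t | e \in E]) t]).
    apply: sig_bigcup_seq => E _; apply: sigI; last exact: sig_cst.
    by apply: (sig_sub (sig_invasion U k E)).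
  apply/seteqP; split=> t; last by case=> E _ [/= ->].
  by move=> ek; exists (invasion (w t) k) => //; exact: invasion_reachable.
rewrite (_ : A n N = \bigcap_k [set t | forall e, e \in shallow n ->
    (~` [set t | e \in invasion (w t) k] `|` [set t | e \in invasion (w t) N]) t]).
  by apply: sig_bigcapT => k; apply: sig_bigcap_seq => e _; apply: sigU => //; exact: sigC.
apply/seteqP; split=> t At.
  move=> k _ e en; have [ek|ek] := pselect (e \in invasion (w t) k); last by left.
  by right; exact: At en ek.
by move=> k e en ek; case: (At k Logic.I e en).
Qed.

(** Each of the finitely many edges of [shallow n] is invaded at a finite stage or never. *)
Let cvg_A n : prb P (~` A n N) @[N --> \oo] --> (0 : R).
Proof.
have mC N : measurable (~` A n N) by exact: measurableC.
rewrite -(prb_set0 P) (_ : set0 = \bigcap_N ~` A n N).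
  apply: prb_bigcap_cvg => // i j ij; apply/subsetPset.
  by apply: subsetC => t At k e en ek; exact: sub_invasion ij _ (At k e en ek).
apply/esym; rewrite -subset0 => t At.
have [N NP] : exists N, forall e, e \in shallow n -> ipc (w t) e -> e \in invasion (w t) N.
  elim: (shallow n) => [|e s [N IH]]; first by exists 0%N.
  have [[k ek]|nk] := pselect (exists k, e \in invasion (w t) k).
    exists (maxn N k) => f; rewrite inE => /orP[/eqP -> _|fs cf].
      by apply: sub_invasion ek; exact: leq_maxr.
    by apply: sub_invasion (IH f fs cf); exact: leq_maxl.
  exists N => f; rewrite inE => /orP[/eqP -> /ipcP//|]; exact: IH.
by apply: (At N Logic.I) => k e en ek; apply: NP => //; apply/ipcP; exists k.
Qed.

Lemma ipc_population_gap n f : depends_on (shallow n) f -> (forall c, 0 <= f c) ->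
  forall e, 0 < e -> \forall m \near \oo,
  mean (ipc_law U) (fun c => f c * Num.min (Z m c / m%:R) 8) <=
    al * mean (ipc_law U) f + e.
Proof.
move=> df f0 e e0.
have bf := bmeas_depends_on df.
have [K fK] := bf.2.
have K0 : 0 <= K by apply: le_trans (fK (fun=> false)); exact: normr_ge0.
have al01 : 0 <= al <= 1.
  have s2 : 2 <= sigma%:R :> R by rewrite ler_nat.
  have : 0 <= (sigma%:R^-1 : R) <= 1 by rewrite invr_ge0 invf_le1; lra.
  by move=> /andP[u v]; move: u v; set x := _^-1 => u v; apply/andP; split; lra.
(* Replacing the cluster by stage N costs K r in the mean of [f] and, thanks to the truncation, 8 K
   r in the weighted mean; together they must stay within e / 2. The summand 1 covers the case K =
   0. *)
have K9 : 0 < 2 * (9 * K + 1) by lra.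
have d0 : 0 < e / (2 * (9 * K + 1)) by rewrite divr_gt0.
have := cvg_A n => /cvgrPdist_lt/(_ _ d0)[N _ /(_ N (leqnn N))] /=.
rewrite sub0r normrN ger0_norm ?prb_ge0// ltr_pdivlMr//.
set D := ~` A n N; set r := prb P D => rK; have r0 : 0 <= r by exact: prb_ge0.
have mD : measurable D by exact: measurableC.
pose F (E : seq (edge sigma)) := f (fun e => e \in E).
have [k kP] := @mean_invasion_population N F (fun E => f0 _).
pose a t := F (invasion (w t) N); pose b t := f (ipc (w t)).
pose g m t := Num.min (Z m (ipc (w t)) / m%:R) 8.
have abD t : `|a t - b t| <= K * \1_D t.
  have [At|nAt] := pselect (A n N t).
    have -> : a t = b t.
      apply: df => e' e'n; apply/idP/idP => [e'N|/ipcP[j]]; last exact: At.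
      by apply/ipcP; exists N.
    by rewrite subrr normr0 mulr_ge0.
  have -> : \1_D t = 1 :> R by rewrite indicE mem_set.
  rewrite mulr1 ler_norml; have := f0 (ipc (w t)); have := f0 (fun e => e \in invasion (w t) N).
  have := fK (ipc (w t)); have := fK (fun e => e \in invasion (w t) N).
  rewrite !ler_norml -/(b t) -/(F _) -/(a t) => /andP[_ h1] /andP[_ h2] h3 h4.
  by apply/andP; split; lra.
have ba : bmeas a by exact: bmeas_invasion.
have bb : bmeas b by exact: bmeas_ipc.
have bD : bmeas (\1_D : T -> R) by exact: bmeas_indic.
have dg m : depends_on (shallow m) (fun c => Num.min (Z m c / m%:R) 8).
  by move=> c c' cc'; rewrite (depends_on_population _ cc').
have bg m : bmeas (g m) by exact: bmeas_ipc (bmeas_depends_on (dg m)).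
have g0 m t : 0 <= g m t by rewrite le_min divr_ge0 ?population_ge0/=.
have g8 m t : g m t <= 8 by rewrite ge_min lexx orbT.
have mDE : mean P (\1_D : T -> R) = r by exact: mean_indic.
have aleb : mean P a <= mean P b + K * r.
  rewrite -mDE -meanZ// -meanD//; last exact: bmeasZ.
  apply: le_mean => // [|t]; first by apply: bmeasD => //; exact: bmeasZ.
  by have := abD t; rewrite ler_norml => /andP[_]; lra.
near=> m.
have Nm : (N < m)%N by near: m; exact: nbhs_infty_gt.
have m0 : 0 < m%:R :> R by rewrite ltr0n (leq_ltn_trans _ Nm).
have mk : k / m%:R <= e / 2.
  rewrite ler_pdivrMr// mulrC -ler_pdivrMr ?divr_gt0//.
  by near: m; exact: nbhs_infty_ger.
rewrite !mean_ipc_law//; last 2 first.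
- by apply: bmeasM => //; exact: bmeas_depends_on (dg m).
- by move=> c; rewrite mulr_ge0// le_min divr_ge0 ?population_ge0/=.
have bleg : mean P (fun t => b t * g m t) <= mean P (fun t => a t * g m t) + 8 * K * r.
  rewrite -mDE -meanZ// -meanD; [|exact: bmeasM|exact: bmeasZ].
  apply: le_mean => [||t]; first exact: bmeasM.
    by apply: bmeasD; [exact: bmeasM|exact: bmeasZ].
  rewrite -lerBlDl -mulrBl; apply: (@le_trans _ _ (K * \1_D t * g m t)).
    by apply: ler_wpM2r => //; have := abD t; rewrite ler_norml => /andP[]; lra.
  rewrite -[8 * K * _]mulrA [8 * _]mulrC; apply: ler_wpM2l; last exact: g8.
  by rewrite mulr_ge0.
have agle : mean P (fun t => a t * g m t) <= al * mean P a + k / m%:R.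
  have bZ : bmeas (fun t => Z m (ipc (w t))).
    exact: bmeas_ipc (bmeas_depends_on (@depends_on_population _ _ m)).
  apply: (@le_trans _ _ (m%:R^-1 * mean P (fun t => a t * Z m (ipc (w t))))).
    rewrite -meanZ; last exact: bmeasM.
    apply: le_mean => [||t]; [exact: bmeasM|exact/bmeasZ/bmeasM|].
    rewrite mulrCA ler_wpM2l ?f0// /g [_^-1 * _]mulrC.
    by rewrite ge_min lexx.
  rewrite mulrC ler_pdivrMr// mulrDl divfK ?gt_eqF// mulrAC.
  exact: kP.
change (mean P (fun t => b t * g m t) <= al * mean P b + e).
have rK' : 18 * (K * r) <= e by lra.
have := ler_wpM2l (proj1 (andP al01)) aleb.
have : al * (K * r) <= K * r by rewrite ler_piMl ?mulr_ge0//; case/andP: al01.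
move: agle bleg mk rK'; rewrite -[8 * K * r]mulrA.
set x := al; set kr := K * r; set u := mean P a; set v := mean P b.
by set y := mean P _; set z := mean P _; lra.
Unshelve. all: by end_near. Qed.

End invasion_population.

Theorem theorem1p7 (R : realType) (sigma : nat) (sigma_ge2 : (2 <= sigma)%N)
    (d : measure_display) (T : measurableType d) (P : probability T R)
    (U : edge sigma -> {RV P >-> R}) (iidU : iid_uniform01 U)
    (Ppc : probability (subgraph sigma) R)
    (perc : is_bond_percolation (sigma%:R^-1) Ppc)
    (Pinf : probability (subgraph sigma) R) (iic : is_iic_law Ppc Pinf) :
  mutually_singular (ipc_law U) Pinf.
Proof.
have s2 : 2 <= sigma%:R :> R by rewrite ler_nat.
have s01 : 0 <= 1 - sigma%:R^-1 :> R by rewrite subr_ge0 invf_le1; lra.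
have s0 : 0 < 1 - sigma%:R^-1 :> R by rewrite subr_gt0 invf_lt1; lra.
have s1 : 1 - sigma%:R^-1 <= 1 :> R by rewrite lerBlDr lerDl invr_ge0; lra.
(* Functions of finitely many levels are stable under the operations of the criterion and are
   admissible weights in both mean estimates. *)
pose C (F : subgraph sigma -> R) := exists n, depends_on (shallow n) F.
pose g m (c : subgraph sigma) := Num.min (population R m c / m%:R) 8 : R.
have dg m : depends_on (shallow m) (g m).
  by move=> c c' cc'; rewrite /g (depends_on_population _ cc').
apply: (@mutually_singular_of_mean_gap _ _ _ _ _ C g
  (3 / 4 * (1 - sigma%:R^-1)) (7 / 8 * (1 - sigma%:R^-1)) 8).
- by move=> F [n]; exact: bmeas_depends_on.
- by exists 0%N.
- move=> op F m [n dF]; exists (maxn n m) => c c' cc'.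
  by rewrite (leq_depends_on (leq_maxl n m) dF cc') (leq_depends_on (leq_maxr n m) (dg m) cc').
- by move=> m c; rewrite /g le_min ge_min lexx orbT divr_ge0 ?population_ge0 //= ler0n.
- by lra.
- by lra.
- by lra.
- by lra.
- by move=> F [n dF] F0 e e0; exact: (ipc_population_gap sigma_ge2 iidU dF F0 e0).
- by move=> F [n dF] F0 e e0; exact: (iic_population_gap sigma_ge2 perc iic dF F0 e0).
Qed.
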